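(* Let $(M,\mathcal{F})$ be a foliated manifold and let $L\subseteq TM\oplus T^*M$ be an $\mathcal{F}$-coupling almost Dirac structure with associated geometric data $(H,\sigma,\Pi)$. Then $L$ is a Dirac structure if and only if the following four conditions hold: (i) $\Pi$ is a leaf-tangent Poisson structure on $(M,\mathcal{F})$, i.e., its restriction to each leaf of $\mathcal{F}$ is a Poisson structure of the leaf; (ii) $d'\sigma=0$, equivalently, $d\sigma(X_1,X_2,X_3)=0$ for all $X_1,X_2,X_3\in\Gamma H$; (iii) for any projectable vector fields $X_1,X_2\in\Gamma_{pr}H$ one has $pr_F[X_1,X_2]=\sharp_{\Pi}(d''(\sigma(X_1,X_2)))$; (iv) for any projectable vector field $X\in\Gamma_{pr}H$ one has $L_X\Pi=0$ (Lie derivative).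
   Context: All objects are $C^\infty$. $M$ is an $n$-dimensional manifold with a regular foliation $\mathcal{F}$; $F=T\mathcal{F}\subseteq TM$ is its tangent bundle and $ann\,F\subseteq T^*M$ is the annihilator of $F$. On $TM\oplus T^*M$ consider the pairing $g((X,\alpha),(Y,\beta))=\frac12(\beta(X)+\alpha(Y))$ and the Courant bracket $[(X,\alpha),(Y,\beta)]=([X,Y],\,L_X\beta-L_Y\alpha+\frac12 d(\alpha(Y)-\beta(X)))$. An almost Dirac structure on $M$ is a maximal $g$-isotropic (hence rank $n$) subbundle $L\subseteq TM\oplus T^*M$; it is a Dirac structure if $\Gamma L$ is closed under the Courant bracket. For an almost Dirac structure $L$, put, for $x\in M$, $H_x(L,\mathcal{F})=\{Z\in T_xM\,:\,\exists\,\alpha\in ann\,F_x \text{ with } (Z,\alpha)\in L_x\}$. $L$ is $\mathcal{F}$-coupling if $T_xM=H_x(L,\mathcal{F})\oplus F_x$ for every $x\in M$. In this case $H=H(L,\mathcal{F})$ is a differentiable normal bundle of $\mathcal{F}$, $TM=H\oplus F$, $T^*M=H^*\oplus F^*$ with $H^*=ann\,F$, $F^*=ann\,H$, and there are unique $\sigma\in\Gamma\wedge^2(ann\,F)$, $\Pi\in\Gamma\wedge^2F$ such that $$L=\{(X,\flat_\sigma X)+(\sharp_\Pi\lambda,\lambda)\,:\,X\in H,\ \lambda\in F^*\},$$ where $\flat_\sigma X=\sigma(X,\cdot)$ and $\mu(\sharp_\Pi\lambda)=\Pi(\lambda,\mu)$. The triple $(H,\sigma,\Pi)$ is the system of geometric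 data associated with $L$. Differential forms are bigraded by $T^*M=H^*\oplus F^*$ (first degree: $H^*$; second degree: $F^*$), and $d=d'_{1,0}+d''_{0,1}+\partial_{2,-1}$ is the corresponding decomposition of the exterior differential. $pr_F$ is the projection $TM=H\oplus F\to F$. Sections may be local, i.e. defined on open subsets of $M$. $\Gamma_{pr}H$ denotes the sections $X$ of $H$ that are projectable to the space of leaves, i.e. $[Y,X]\in\Gamma F$ for all $Y\in\Gamma F$ (on the domain of $X$). *)

(* Defs.v *)
From HB Require Import structures.
From mathcomp Require Import all_boot all_order all_algebra.
From mathcomp Require Import all_classical all_reals topology normedtype derive.

Set Implicit Arguments.
Unset Strict Implicit.
Unset Printing Implicit Defensive.

Import Order.TTheory GRing.Theory Num.Theory.
Import numFieldNormedType.Exports.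

Local Open Scope classical_set_scope.
Local Open Scope ring_scope.

Definition iter_derive (R : realType) (V W : normedModType R)
    (vs : seq V) (f : V -> W) : V -> W :=
  foldr (fun v h => 'D_v h) f vs.

(** All iterated directional derivatives exist and are again differentiable;
    for finite-dimensional [V] and open [A] this is smoothness on [A]. *)
Definition smooth_on (R : realType) (V W : normedModType R)
    (A : set V) (f : V -> W) : Prop :=
  forall (vs : seq V) (u : V), A u -> differentiable (iter_derive vs f) u.

(** [coord] and [param] are total functions, meaningful only on [dom] and on
    [coord @` dom]. *)
Record chart (R : realType) (n : nat) (M : topologicalType) := Chart {
  dom : set M;
  coord : M -> 'rV[R]_n;
  param : 'rV[R]_n -> M;
  dom_open : open dom;
  image_open : open (coord @` dom);
  coordK : forall x, dom x -> param (coord x) = x;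
  coord_continuous : {within dom, continuous coord};
  param_continuous : {within coord @` dom, continuous param} }.

(** A foliation of dimension [p] and codimension [q] is given by an atlas
    modelled on R^p x R^q whose transition maps are smooth and locally of the
    form (t, y) |-> (h (t, y), k y).  Such an atlas also determines the smooth
    structure.  [chart_at x] is a preferred chart around [x], through which the
    tangent space at [x] is identified with R^(p + q). *)
Record foliated_manifold (R : realType) (p q : nat) := FoliatedManifold {
  space :> topologicalType;
  space_hausdorff : hausdorff_space space;
  space_second_countable : @second_countable space;
  atlas : set (chart R (p + q) space);
  chart_at : space -> chart R (p + q) space;
  chart_at_atlas : forall x, atlas (chart_at x);
  chart_at_dom : forall x, dom (chart_at x) x;
  transition_smooth : forall c c', atlas c -> atlas c' ->
    smooth_on (coord c @` (dom c `&` dom c')) (coord c' \o param c);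
  transition_foliated : forall c c', atlas c -> atlas c' ->
    forall u, (coord c @` (dom c `&` dom c')) u ->
    exists2 B, nbhs u B & forall u1 u2, B u1 -> B u2 ->
      rsubmx u1 = rsubmx u2 ->
      rsubmx (coord c' (param c u1)) = rsubmx (coord c' (param c u2)) }.

(** A vector field is [X : M -> 'rV_(p + q)], where [X x] is the row of
    components of a tangent vector at [x] in [chart_at x]; a 1-form is
    likewise the row of its components in the dual basis.  A bilinear form
    [B] on tangent (or cotangent) vectors is a matrix,
    B(u, v) = u *m B *m v^T.  These component functions need not be
    continuous, since [chart_at] jumps; smoothness is expressed below through
    the components in each fixed chart of the atlas.  Fields are total
    functions, of which only the values on some open set [U] are relevant. *)

Definition pairing (R : realType) (n : nat) (a v : 'rV[R]_n) : R :=
  (a *m v^T) 0 0.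

Definition bil (R : realType) (n : nat) (B : 'M[R]_n) (u v : 'rV[R]_n) : R :=
  (u *m B *m v^T) 0 0.

Section Fields.
Context {R : realType} {p q : nat} {M : foliated_manifold R p q}.
Local Notation n := (p + q)%N.
Implicit Types (c : chart R n M) (U V : set M) (x y : M).
Implicit Types (X Y : M -> 'rV[R]_n) (alpha beta : M -> 'rV[R]_n).
Implicit Types (sigma Pi : M -> 'M[R]_n).

Definition deriv (W : normedModType R) x (v : 'rV[R]_n) (f : M -> W) : W :=
  'D_v (f \o param (chart_at x)) (coord (chart_at x) x).

Definition act (W : normedModType R) X (f : M -> W) : M -> W :=
  fun x => deriv x (X x) f.

Definition dfun (f : M -> R) : M -> 'rV[R]_n :=
  fun x => \row_i deriv x (delta_mx 0 i) f.

(** The vector field, resp. 1-form, on [dom c] with constant components in the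
    chart [c]; for basis vectors these are the coordinate vector fields and the
    differentials of the coordinate functions. *)
Definition const_vf c (v : 'rV[R]_n) : M -> 'rV[R]_n :=
  fun y => 'D_v (coord (chart_at y) \o param c) (coord c y).

Definition const_form c (a : 'rV[R]_n) : M -> 'rV[R]_n :=
  dfun (fun y => pairing a (coord c y)).

Definition smooth_fun (W : normedModType R) U (f : M -> W) : Prop :=
  forall c, atlas c -> smooth_on (coord c @` (dom c `&` U)) (f \o param c).

Definition smooth_in_charts (W : normedModType R) U
    (f : chart R n M -> M -> W) : Prop :=
  forall c, atlas c -> smooth_fun (dom c `&` U) (f c).

(** [act X (coord c) y] is the row of components of [X y] in the chart [c]. *)
Definition smooth_vf U X : Prop :=
  smooth_in_charts U (fun c => act X (coord c)).

Definition smooth_form U alpha : Prop :=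
  forall v, smooth_in_charts U (fun c y =>
    pairing (alpha y) (const_vf c v y) : R^o).

Definition smooth_form2 U sigma : Prop :=
  forall v w, smooth_in_charts U (fun c y =>
    bil (sigma y) (const_vf c v y) (const_vf c w y) : R^o).

Definition smooth_bivector U Pi : Prop :=
  forall a b, smooth_in_charts U (fun c y =>
    bil (Pi y) (const_form c a y) (const_form c b y) : R^o).

(** [X, Y] f = X (Y f) - Y (X f), applied to the coordinates of [chart_at x]. *)
Definition bracket X Y : M -> 'rV[R]_n := fun x =>
  let f := coord (chart_at x) in act X (act Y f) x - act Y (act X f) x.

(** (L_X beta)(Y) = X (beta(Y)) - beta([X, Y]), for [Y] running over the
    coordinate vector fields of [chart_at x]. *)
Definition lie_form X beta : M -> 'rV[R]_n := fun x =>
  \row_i (let Y := const_vf (chart_at x) (delta_mx 0 i) in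
    act X (fun y => pairing (beta y) (Y y) : R^o) x
    - pairing (beta x) (bracket X Y x)).

(** (L_X Pi)(a, b) = X (Pi(a, b)) - Pi(L_X a, b) - Pi(a, L_X b), evaluated at
    the covectors [a] and [b] at [x]. *)
Definition lie_bivector X Pi x (a b : 'rV[R]_n) : R :=
  let a' := const_form (chart_at x) a in
  let b' := const_form (chart_at x) b in
  act X (fun y => bil (Pi y) (a' y) (b' y) : R^o) x
  - bil (Pi x) (lie_form X a' x) b - bil (Pi x) a (lie_form X b' x).

(** (d sigma)_x(u, v, w): the bracket terms of the Koszul formula vanish for
    vector fields with constant components. *)
Definition dform2 sigma x (u v w : 'rV[R]_n) : R :=
  let K := const_vf (chart_at x) in
  deriv x u (fun y => bil (sigma y) (K v y) (K w y) : R^o)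
  + deriv x v (fun y => bil (sigma y) (K w y) (K u y) : R^o)
  + deriv x w (fun y => bil (sigma y) (K u y) (K v y) : R^o).

End Fields.

Definition annv (R : realType) (n : nat) (U : {vspace 'rV[R]_n}) :
    {vspace 'rV[R]_n} :=
  lker (linfun (mulmxr (\matrix_(i < \dim U) (vbasis U)`_i)^T)).

Lemma memv_ann (R : realType) (n : nat) (U : {vspace 'rV[R]_n}) a :
  a \in annv U <-> forall v, v \in U -> pairing a v = 0.
Proof.
have pairE i : (a *m (\matrix_(j < \dim U) (vbasis U)`_j)^T) 0 i
    = pairing a (vbasis U)`_i.
  by rewrite /pairing !mxE; apply: eq_bigr => j _; rewrite !mxE.
rewrite memv_ker lfunE /=; split=> [/eqP a0 v vU | a0].
  rewrite (coord_vbasis vU) /pairing linear_sum mulmx_sumr summxE big1 // => i _.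
  rewrite linearZ -scalemxAr mxE -[X in _ * X]/(pairing a (vbasis U)`_i).
  by rewrite -pairE a0 mxE mulr0.
apply/eqP/matrixP => i j; rewrite ord1 pairE mxE; apply: a0.
by apply: vbasis_mem; rewrite mem_nth ?size_tuple.
Qed.

(** TF; it is the same subspace for all points because every [chart_at x] is a
    foliated chart, with leaf coordinates first. *)
Definition tangF (R : realType) (p q : nat) : {vspace 'rV[R]_(p + q)} :=
  lker (linfun (fun v : 'rV[R]_(p + q) => rsubmx v)).

Lemma memv_tangF (R : realType) (p q : nat) (v : 'rV[R]_(p + q)) :
  (v \in tangF R p q) = (rsubmx v == 0).
Proof. by rewrite memv_ker lfunE. Qed.

Section Leaves.
Context {R : realType} {p q : nat} {M : foliated_manifold R p q}.
Local Notation n := (p + q)%N.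

(** The plaque of [c] through [x]: the connected component of the slice. *)
Definition plaque (c : chart R n M) (x : M) : set M :=
  dom c `&` [set y |
    connected_component
      (coord c @` dom c `&` [set u | rsubmx u = rsubmx (coord c x)])
      (coord c x) (coord c y)].

(** The leaf through [x0] is the smallest set that contains [x0] and, with each
    of its points, the plaques through that point. *)
Definition leaf (x0 : M) : set M :=
  [set y | forall S : set M, S x0 ->
    (forall c x, atlas c -> dom c x -> S x -> plaque c x `<=` S) -> S y].

Definition leaf_coord (x : M) : 'rV[R]_p := lsubmx (coord (chart_at x) x).

Definition leaf_param (x : M) : 'rV[R]_p -> M := fun t =>
  param (chart_at x) (row_mx t (rsubmx (coord (chart_at x) x))).

(** Openness in the leaf topology of [S], not the subspace topology. *)
Definition leaf_open (S W : set M) : Prop :=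
  W `<=` S /\ forall x, W x -> \forall t \near leaf_coord x, W (leaf_param x t).

(** For [x] in a leaf [S], this only involves the restriction of [f] to [S]. *)
Definition leaf_smooth (W : set M) (f : M -> R) : Prop :=
  forall x, W x -> exists B : set 'rV[R]_p,
    [/\ open B, B (leaf_coord x) & smooth_on B (f \o leaf_param x : _ -> R^o)].

Definition leaf_dfun (f : M -> R) : M -> 'rV[R]_p := fun x =>
  \row_i 'D_(delta_mx 0 i) (f \o leaf_param x : _ -> R^o) (leaf_coord x).

(** A section of /\^2 F is supported by the upper left block, which is its
    restriction to the leaf. *)
Definition leaf_poisson_bracket (Pi : M -> 'M[R]_n) (f g : M -> R) : M -> R :=
  fun x => bil (ulsubmx (Pi x)) (leaf_dfun f x) (leaf_dfun g x).

Definition leaf_tangent_poisson (Pi : M -> 'M[R]_n) : Prop :=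
  forall x0 W, leaf_open (leaf x0) W ->
  forall f g h, leaf_smooth W f -> leaf_smooth W g -> leaf_smooth W h ->
  let br := leaf_poisson_bracket Pi in
  forall x, W x -> br f (br g h) x + br g (br h f) x + br h (br f g) x = 0.

End Leaves.

Section Dirac.
Context {R : realType} {p q : nat} {M : foliated_manifold R p q}.
Local Notation n := (p + q)%N.
Local Notation fibre := ('rV[R]_n * 'rV[R]_n)%type.
Implicit Types (L : M -> {vspace fibre}) (s t : M -> fibre).

Definition pair_g (z w : fibre) : R :=
  2^-1 * (pairing w.2 z.1 + pairing z.2 w.1).

Definition courant s t : M -> fibre := fun x =>
  let X := fst \o s in let alpha := snd \o s in
  let Y := fst \o t in let beta := snd \o t in
  (bracket X Y x,
   lie_form X beta x - lie_form Y alpha x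
   + 2^-1 *: dfun (fun y => pairing (alpha y) (Y y) - pairing (beta y) (X y)) x).

Definition smooth_section (U : set M) s : Prop :=
  smooth_vf U (fst \o s) /\ smooth_form U (snd \o s).

Definition section_of L (U : set M) s : Prop :=
  smooth_section U s /\ forall x, U x -> s x \in L x.

Definition smooth_subbundle L : Prop :=
  forall x, exists U, [/\ open U, U x &
    exists (r : nat) (s : 'I_r -> M -> fibre),
      (forall i, smooth_section U (s i)) /\
      forall y, U y -> basis_of (L y) [seq s i y | i <- enum 'I_r]].

Definition isotropic (V : {vspace fibre}) : Prop :=
  forall z w, z \in V -> w \in V -> pair_g z w = 0.

Definition almost_dirac L : Prop :=
  [/\ smooth_subbundle L, forall x, isotropic (L x) &
      forall x V, isotropic V -> (L x <= V)%VS -> V = L x].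

Definition dirac L : Prop :=
  almost_dirac L /\
  forall U, open U -> forall s t, section_of L U s -> section_of L U t ->
    section_of L U (courant s t).

Local Notation F := (tangF R p q).

Definition normalH L (x : M) : {vspace 'rV[R]_n} :=
  (linfun fst @: (L x :&: linfun snd @^-1: annv F))%VS.

Lemma memv_normalH L x Z :
  Z \in normalH L x <-> exists2 alpha, alpha \in annv F & (Z, alpha) \in L x.
Proof.
split=> [/memv_imgP[[Z' a]] | [a aF ZL]].
  by rewrite memv_cap -memv_preim !lfunE /= => /andP[ZL aF] ->; exists a.
apply/memv_imgP; exists (Z, a); last by rewrite lfunE.
by rewrite memv_cap ZL -memv_preim lfunE.
Qed.

Definition coupling L : Prop :=
  forall x, (normalH L x + F = fullv /\ normalH L x :&: F = 0)%VS.

Definition prF L (x : M) : 'End('rV[R]_n) := daddv_pi F (normalH L x).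
Definition prH L (x : M) : 'End('rV[R]_n) := daddv_pi (normalH L x) F.

(** flat v = sigma(v, -), and mu(sharp a) = Pi(a, mu). *)
Definition flat (sigma : M -> 'M[R]_n) (x : M) (v : 'rV[R]_n) : 'rV[R]_n :=
  v *m sigma x.

Definition sharp (Pi : M -> 'M[R]_n) (x : M) (a : 'rV[R]_n) : 'rV[R]_n :=
  a *m Pi x.

Definition geometric_data L (sigma Pi : M -> 'M[R]_n) : Prop :=
  [/\ smooth_form2 setT sigma /\ smooth_bivector setT Pi,
      forall x, (sigma x)^T = - sigma x /\
        forall v, flat sigma x v \in annv F,
      forall x, (Pi x)^T = - Pi x /\ forall a, sharp Pi x a \in F &
      forall x z, z \in L x <->
        exists2 v, v \in normalH L x &
        exists2 a, a \in annv (normalH L x) &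
          z = (v + sharp Pi x a, flat sigma x v + a)].

(** (d' sigma)_x(u, v, w): [d'] is the (1, 0)-component of [d], so that
    [d' sigma] is the (3, 0)-component of [d sigma] for [sigma] of type (2, 0). *)
Definition d'form2 L (sigma : M -> 'M[R]_n) x (u v w : 'rV[R]_n) : R :=
  dform2 sigma x (prH L x u) (prH L x v) (prH L x w).

(** [d'' f] is the (0, 1)-component of [d f]. *)
Definition d''fun L (f : M -> R) : M -> 'rV[R]_n := fun x =>
  \row_i pairing (dfun f x) (prF L x (delta_mx 0 i)).

Definition sectionH L (U : set M) (X : M -> 'rV[R]_n) : Prop :=
  smooth_vf U X /\ forall x, U x -> X x \in normalH L x.

Definition sectionF (U : set M) (Y : M -> 'rV[R]_n) : Prop :=
  smooth_vf U Y /\ forall x, U x -> Y x \in F.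

Definition projectable (U : set M) (X : M -> 'rV[R]_n) : Prop :=
  forall V Y, open V -> V `<=` U -> sectionF V Y -> sectionF V (bracket Y X).

Definition sectionH_pr L (U : set M) (X : M -> 'rV[R]_n) : Prop :=
  sectionH L U X /\ projectable U X.

End Dirac.

(* Main.v *)
(** In a foliated chart, with leaf coordinates first, H is the row space of
    [(A, 1)] for a matrix function [A], while Pi = diag(P, 0) and
    sigma = diag(0, S).  Hence L consists of the pairs

      ((s A + l P, s), (l, s S - l A^T)),    s in R^q, l in R^p.

    For sections [e1, e2, e3] of L with vector parts [X1, X2, X3], isotropy turns
    <[e1, e2], e3> into the cyclic sum of <D_X1 e2, e3>, computed in coordinates;
    this is tensorial in the three sections, and L is Dirac iff it vanishes, as L
    is its own orthogonal.  Evaluated on three, two, one or none of the elements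
    with l = 0 (the others having s = 0), this tensor is respectively d' sigma,
    the difference of the two sides of (iii), the Lie derivative of Pi, and the
    Jacobiator of P along the leaf.  Constant [s] yields projectable sections of
    H, and conversely the leafwise derivatives of [s] vanish for any projectable
    section, so that (iii) and (iv) need only be tested on constant [s]. *)

Require Import Defs.
From HB Require Import structures.
From mathcomp Require Import all_boot all_order all_algebra.
From mathcomp Require Import all_classical all_reals topology normedtype derive.
From mathcomp Require Import landau lra.

Set Implicit Arguments.
Unset Strict Implicit.
Unset Printing Implicit Defensive.

Import Order.TTheory GRing.Theory Num.Theory.
Import numFieldNormedType.Exports.
(* [vector] also exports a [coord]. *)
Import Defs.

Local Open Scope classical_set_scope.
Local Open Scope ring_scope.

(** The frame in which the values at [x] are written comes from [chart_at x] and jumps with [x], so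
    no field can be differentiated as it stands. Fields are moved to a fixed chart by the Jacobians
    [Smx] and [Tmx]. The tensor is evaluated in [chart_at x] at [x] itself, where both are identity
    matrices; a fixed chart is needed for the smoothness of the Courant bracket, for the
    projectability of sections with constant [s], and for the leafwise bracket, which is
    differentiated a second time. That brackets and Lie derivatives do not depend on the chart rests
    on the symmetry of second derivatives, obtained from the mean value theorem. The matrix function
    [A] is not given: its smoothness is extracted from a smooth frame of L, by removing the
    contribution of Pi from the vector parts and inverting a matrix. The factor 1/2 of the Courant
    bracket disappears on L, where alpha(Y) = - beta(X) turns the exact term into d(alpha(Y)). The
    functions in the Poisson condition live on one leaf, which need not be embedded; they are
    handled through extensions to a chart. *)

(** * Pairings, bilinear forms and block matrices *)

Section Bilinear.
Context {R : realType}.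

Lemma mulmx_rV_inj m n (A B : 'M[R]_(m, n)) :
  (forall v : 'rV_m, v *m A = v *m B) -> A = B.
Proof. by move=> AB; apply/row_matrixP => i; rewrite !rowE AB. Qed.

Lemma pairingC n (a v : 'rV[R]_n) : pairing a v = pairing v a.
Proof. by rewrite /pairing !mxE; apply: eq_bigr => i _; rewrite !mxE mulrC. Qed.

Lemma bil_mulmx n (A B C : 'M[R]_n) (u v : 'rV[R]_n) :
  bil B (u *m A) (v *m C) = bil (A *m B *m C^T) u v.
Proof. by rewrite /bil trmx_mul !mulmxA. Qed.

Lemma bil_delta n (A B C : 'M[R]_n) i j :
  bil B (delta_mx 0 i *m A) (delta_mx 0 j *m C) = (A *m B *m C^T) i j.
Proof.
by rewrite /bil trmx_mul !mulmxA -!mulmxA trmx_delta -rowE mxE !mulmxA -colE mxE.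
Qed.

Lemma bilE n (B : 'M[R]_n) u v : bil B u v = pairing u (v *m B^T).
Proof. by rewrite /bil /pairing trmx_mul trmxK mulmxA. Qed.

Lemma pairing_mulmx m n (A B : 'M[R]_(m, n)) u v :
  pairing (u *m A) (v *m B) = bil (A *m B^T) u v.
Proof. by rewrite /bil /pairing trmx_mul !mulmxA. Qed.

Lemma pairing0l n (v : 'rV[R]_n) : pairing 0 v = 0.
Proof. by rewrite /pairing mul0mx mxE. Qed.

Lemma pairing0r n (v : 'rV[R]_n) : pairing v 0 = 0.
Proof. by rewrite pairingC pairing0l. Qed.

Lemma pairingDl n (a b v : 'rV[R]_n) : pairing (a + b) v = pairing a v + pairing b v.
Proof. by rewrite /pairing mulmxDl mxE. Qed.

Lemma pairingDr n (a u v : 'rV[R]_n) : pairing a (u + v) = pairing a u + pairing a v.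
Proof. by rewrite /pairing linearD/= mulmxDr mxE. Qed.

Lemma pairingNl n (a v : 'rV[R]_n) : pairing (- a) v = - pairing a v.
Proof. by rewrite /pairing mulNmx mxE. Qed.

Lemma pairingNr n (a v : 'rV[R]_n) : pairing a (- v) = - pairing a v.
Proof. by rewrite /pairing linearN/= mulmxN mxE. Qed.

Lemma pairingZl n k (a v : 'rV[R]_n) : pairing (k *: a) v = k * pairing a v.
Proof. by rewrite /pairing -scalemxAl mxE. Qed.

Lemma pairing_trmx n (a w : 'rV[R]_n) (J : 'M[R]_n) : pairing (a *m J^T) w = pairing a (w *m J).
Proof. by rewrite /pairing trmx_mul mulmxA. Qed.

Lemma bil0l n (B : 'M[R]_n) v : bil B 0 v = 0.
Proof. by rewrite /bil !mul0mx mxE. Qed.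

Lemma bil0r n (B : 'M[R]_n) v : bil B v 0 = 0.
Proof. by rewrite /bil trmx0 mulmx0 mxE. Qed.

Lemma bilDm n (B C : 'M[R]_n) u v : bil (B + C) u v = bil B u v + bil C u v.
Proof. by rewrite /bil mulmxDr mulmxDl mxE. Qed.

Lemma bilDl n (B : 'M[R]_n) u u' v : bil B (u + u') v = bil B u v + bil B u' v.
Proof. by rewrite /bil !mulmxDl mxE. Qed.

Lemma bilDr n (B : 'M[R]_n) u v v' : bil B u (v + v') = bil B u v + bil B u v'.
Proof. by rewrite /bil linearD/= mulmxDr mxE. Qed.

Lemma bil_tr n (B : 'M[R]_n) u v : bil B^T u v = bil B v u.
Proof.
by rewrite /bil -[in RHS](trmxK (v *m B *m u^T)) [RHS]mxE !trmx_mul trmxK mulmxA.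
Qed.

Lemma bil_anti m (B : 'M[R]_m) (a b : 'rV[R]_m) : B^T = - B -> bil B a b = - pairing a (b *m B).
Proof. by move=> anti; rewrite bilE anti mulmxN pairingNr. Qed.

Lemma bil_block p q (a1 b1 : 'rV[R]_q) (a2 b2 : 'rV[R]_p) B11 B12 B21 B22 :
  bil (block_mx B11 B12 B21 B22) (row_mx a1 a2) (row_mx b1 b2) =
  bil B11 a1 b1 + pairing (a2 *m B21) b1 + (pairing (a1 *m B12) b2 + bil B22 a2 b2).
Proof.
by rewrite /bil /pairing mul_row_block tr_row_mx mul_row_col !mulmxDl !mxE.
Qed.

Lemma bil_dr p q (B : 'M[R]_q) (a b : 'rV[R]_(p + q)) :
  bil (block_mx 0 0 0 B) a b = bil B (rsubmx a) (rsubmx b).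
Proof.
rewrite -{1}[a]hsubmxK -{1}[b]hsubmxK /bil mul_row_block tr_row_mx mul_row_col.
by rewrite !(mulmx0, mul0mx, add0r).
Qed.

Lemma bil_ul p q (B : 'M[R]_p) (a b : 'rV[R]_(p + q)) :
  bil (block_mx B 0 0 0) a b = bil B (lsubmx a) (lsubmx b).
Proof.
rewrite -{1}[a]hsubmxK -{1}[b]hsubmxK /bil mul_row_block tr_row_mx mul_row_col.
by rewrite !(mulmx0, mul0mx, addr0).
Qed.

End Bilinear.

(** * Smooth functions *)

Section Calculus.
Context {R : realType} {V : normedModType R}.

Lemma differentiable_mxP m n (F : V -> 'M[R]_(m, n)) x :
  differentiable F x <->
  forall i j, differentiable (fun u => F u i j : R^o) x.
Proof.
split=> [dF i j | dF].
  exact: (differentiable_comp dF (differentiable_coord (F x) i j)).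
have -> : F = \sum_(i < m) \sum_(j < n) (fun u => F u i j *: delta_mx i j).
  apply/funext => u; rewrite {1}(matrix_sum_delta (F u)) fct_sumE.
  by apply: eq_bigr => i _; rewrite fct_sumE.
apply: differentiable_sum => i; apply: differentiable_sum => j.
exact: differentiableZl.
Qed.

Lemma derive_entry m n (F : V -> 'M[R]_(m, n)) x v i j :
  differentiable F x -> ('D_v F x) i j = 'D_v (fun u => F u i j : R^o) x.
Proof. by move=> dF; rewrite derive_mx ?mxE//; exact: diff_derivable. Qed.

Lemma differentiable_mulmx m n k (F : V -> 'M[R]_(m, n)) (G : V -> 'M[R]_(n, k)) x :
  differentiable F x -> differentiable G x ->
  differentiable (fun u => F u *m G u) x.
Proof.
move=> /differentiable_mxP dF /differentiable_mxP dG.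
apply/differentiable_mxP => i j.
have -> : (fun u => (F u *m G u) i j : R^o) =
    \sum_(l < n) ((fun u => F u i l : R^o) * (fun u => G u l j : R^o)).
  by apply/funext => u; rewrite mxE fct_sumE.
by apply: differentiable_sum => l; apply: differentiableM.
Qed.

Lemma derive_mulmx m n k (F : V -> 'M[R]_(m, n)) (G : V -> 'M[R]_(n, k)) x v :
  differentiable F x -> differentiable G x ->
  'D_v (fun u => F u *m G u) x = 'D_v F x *m G x + F x *m 'D_v G x.
Proof.
move=> dF dG; have dFG := differentiable_mulmx dF dG.
move: (dF) (dG) => /differentiable_mxP dFe /differentiable_mxP dGe.
apply/matrixP => i j; rewrite derive_entry// !mxE -big_split/=.
have -> : (fun u => (F u *m G u) i j : R^o) =
    \sum_(l < n) ((fun u => F u i l : R^o) * (fun u => G u l j : R^o)).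
  by apply/funext => u; rewrite mxE fct_sumE.
rewrite derive_sum => [|l]; last first.
  by apply: diff_derivable; apply: differentiableM.
apply: eq_bigr => l _; rewrite deriveM; try exact: diff_derivable.
rewrite !derive_entry// addrC; congr (_ + _).
by rewrite -[LHS]/(G x l j * _) mulrC.
Qed.

Lemma derive_comp (W X : normedModType R) (f : V -> W) (g : W -> X) x v :
  differentiable f x -> differentiable g (f x) ->
  'D_v (g \o f) x = 'D_('D_v f x) g (f x).
Proof.
move=> df dg; rewrite !deriveE//; last exact: differentiable_comp.
by rewrite diff_comp.
Qed.

(** Differentiability depends only on the germ at [x]: the first-order expansion of [f] is also one
    of [g], and uniqueness of the differential identifies ['d g x] with the continuous map
    ['d f x]. *)
Lemma near_eq_differentiable (W : normedModType R) (f g : V -> W) x :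
  {near x, f =1 g} -> differentiable f x -> differentiable g x.
Proof.
move=> fg /diff_locallyP[cf ef]; have fgx := nbhs_singleton fg.
apply/diff_locallyP.
suff eg : g \o shift x = cst (g x) + 'd f x +o_ 0 id.
  by have -> : 'd g x = 'd f x :> (V -> W) by exact: diff_unique.
apply/eqaddoP => e e0; move/eqaddoP : ef => /(_ e e0) ef.
have fg' : \forall u \near (0 : V), f (u + x) = g (u + x).
  by move: fg; rewrite (near_shift (0 : V)) subr0.
apply: filterS2 ef fg' => u ef eu.
suff <- : (f \o shift x - (cst (f x) + 'd f x)) u =
          (g \o shift x - (cst (g x) + 'd f x)) u by [].
by rewrite -[LHS]/(f (u + x) - (f x + 'd f x u)) eu fgx.
Qed.

Lemma deriveDr (W : normedModType R) (f : V -> W) x u v :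
  differentiable f x -> 'D_(u + v) f x = 'D_u f x + 'D_v f x.
Proof. by move=> df; rewrite !deriveE// linearD. Qed.

Lemma deriveZr (W : normedModType R) (f : V -> W) x k v :
  differentiable f x -> 'D_(k *: v) f x = k *: 'D_v f x.
Proof. by move=> df; rewrite !deriveE// linearZ. Qed.

Lemma derive_sumr (W : normedModType R) (f : V -> W) x I (r : seq I) (v : I -> V) :
  differentiable f x ->
  'D_(\sum_(i <- r) v i) f x = \sum_(i <- r) 'D_(v i) f x.
Proof. by move=> df; rewrite deriveE// linear_sum; apply: eq_bigr => i _; rewrite deriveE. Qed.

End Calculus.

Lemma derive_linear (R : realType) (V W X : normedModType R) (h : {linear W -> X})
    (f : V -> W) x v : continuous h -> differentiable f x ->
  differentiable (h \o f) x /\ 'D_v (h \o f) x = h ('D_v f x).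
Proof.
move=> ch df; have dh : differentiable h (f x) by exact: linear_differentiable.
split; first exact: differentiable_comp.
by rewrite derive_comp// [LHS]deriveE// diff_lin.
Qed.

(** * Mean value theorem along lines and symmetry of second derivatives *)

Section LineDerivative.
Context {R : realType} {V : normedModType R}.

Lemma is_derive_line (f : V -> R^o) (a u : V) (s : R) :
  differentiable f (a + s *: u) ->
  is_derive s 1 (fun s : R => f (a + s *: u) : R^o) ('D_u f (a + s *: u)).
Proof.
move=> df.
set l := fun s : R => a + s *: u.
have dZ : differentiable (fun s : R => s *: u) s by exact: differentiableZl.
have dl : differentiable l s by apply: (differentiableD (differentiable_cst a s) dZ).
have Dl : 'D_1 l s = u.
  rewrite (deriveD (derivable_cst a s 1) (diff_derivable dZ)) derive_cst add0r.
  by rewrite deriveE// diffZl// (diff_val (x := nbhs_filter_on s)) scale1r.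
apply: DeriveDef; first exact: diff_derivable (differentiable_comp dl df).
by rewrite (derive_comp (f := l) (g := f))// Dl.
Qed.

Lemma MVT_line (f : V -> R^o) (a u : V) (h : R) : 0 < h ->
  (forall s, 0 <= s <= h -> differentiable f (a + s *: u)) ->
  exists2 t, 0 <= t <= h & f (a + h *: u) - f a = 'D_u f (a + t *: u) * h.
Proof.
move=> h0 df.
have [|||t] := @MVT R (fun s : R => f (a + s *: u)) (fun s => 'D_u f (a + s *: u)) 0 h.
- by [].
- move=> s; rewrite in_itv/= => /andP[s0 sh]; apply: is_derive_line.
  by apply: df; rewrite !ltW.
- apply: continuous_in_subspaceT => s; rewrite inE/= in_itv/= => sh.
  have /is_derive_line[+ _] := df _ sh.
  by move=> /derivable1_diffP /differentiable_continuous.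
rewrite in_itv/= => /andP[t0 th]; rewrite scale0r addr0 subr0 => e.
by exists t => //; rewrite !ltW.
Qed.

End LineDerivative.

Section Schwarz.
Context {R : realType} {V : normedModType R}.

Lemma differentiable_shift (f : V -> R^o) (a x : V) :
  differentiable f (x + a) -> differentiable (fun y => f (y + a) : R^o) x.
Proof.
move=> df; have dsh : differentiable (fun y => y + a) x.
  by apply: differentiableD => //; exact: differentiable_cst.
exact: (differentiable_comp dsh).
Qed.

Lemma is_derive_shift (f : V -> R^o) (a x u : V) : differentiable f (x + a) ->
  is_derive x u (fun y => f (y + a) : R^o) ('D_u f (x + a)).
Proof.
move=> df; have dsh : differentiable (fun y => y + a) x.
  by apply: differentiableD => //; exact: differentiable_cst.
have Dsh : 'D_u (fun y => y + a) x = u.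
  rewrite (deriveD (@derivable_id _ _ x u) (derivable_cst a x u)).
  by rewrite derive_id derive_cst addr0.
apply: DeriveDef; first exact: diff_derivable (differentiable_shift df).
by rewrite -[in RHS]Dsh; exact: (derive_comp (W := V) (X := R^o) (g := f) u dsh df).
Qed.

(* Two applications of the mean value theorem; exchanging [u] and [v] leaves the
   second difference unchanged, whence Schwarz's theorem. *)
Lemma second_difference (f : V -> R^o) (x u v : V) (h : R) : 0 < h ->
  (forall s t, 0 <= s <= h -> 0 <= t <= h ->
     differentiable f (x + s *: u + t *: v) /\
     differentiable ('D_u f) (x + s *: u + t *: v)) ->
  exists s t, [/\ 0 <= s <= h, 0 <= t <= h &
    f (x + h *: u + h *: v) - f (x + h *: u) - (f (x + h *: v) - f x) =
    'D_v ('D_u f) (x + s *: u + t *: v) * h * h].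
Proof.
move=> h0 df.
have hh : 0 <= h <= h by rewrite lexx ltW.
have h00 : 0 <= (0 : R) <= h by rewrite lexx ltW.
have df0 s : 0 <= s <= h -> differentiable f (x + s *: u).
  by move=> sh0; have [] := df s 0 sh0 h00; rewrite scale0r addr0.
have dsh s : 0 <= s <= h ->
    is_derive (x + s *: u) u (fun y => f (y + h *: v) : R^o)
      ('D_u f (x + s *: u + h *: v)).
  by move=> sh0; apply: is_derive_shift; have [] := df s h sh0 hh.
have dg s : 0 <= s <= h -> differentiable (fun y => f (y + h *: v) - f y : R^o) (x + s *: u).
  move=> sh0; apply: differentiableB; last exact: df0.
  by apply: differentiable_shift; have [] := df s h sh0 hh.
(* The mean value theorem is used in direction [u] for the difference of [f] between points [h *: v]
   apart, then in direction [v] for ['D_u f]. *)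
have [s sh0 e] := MVT_line h0 dg.
have [|t th0 e'] := @MVT_line R V ('D_u f) (x + s *: u) v h h0.
  by move=> t th0; have [] := df s t sh0 th0.
exists s, t; split=> //; rewrite -e' e; congr (_ * h).
have [dfs <-] := dsh _ sh0.
exact: deriveB dfs (diff_derivable (df0 _ sh0)).
Qed.

Lemma dist_tri (e a b c c' : R) :
  c = c' -> `|a - c| < e / 2 -> `|b - c'| < e / 2 -> `|a - b| <= e.
Proof.
move=> <- ac bc; rewrite (le_trans (ler_distD c _ _))// (splitr e).
by rewrite lerD// ltW// distrC.
Qed.

(** Each mixed derivative, at some point of a small parallelogram at [x], equals the same second
    difference divided by [h * h]. By continuity at [x] their values there differ by at most any
    [e > 0]. *)
Lemma derive_swap (f : V -> R^o) (x u v : V) :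
  (\forall y \near x, differentiable f y) ->
  (\forall y \near x, differentiable ('D_u f) y) ->
  (\forall y \near x, differentiable ('D_v f) y) ->
  differentiable ('D_v ('D_u f)) x -> differentiable ('D_u ('D_v f)) x ->
  'D_u ('D_v f) x = 'D_v ('D_u f) x.
Proof.
move=> df du dv dvu duv.
set G := 'D_u ('D_v f); set H := 'D_v ('D_u f).
apply/eqP; rewrite -subr_eq0 -normr_le0; apply/ler_addgt0Pr => e e0; rewrite add0r.
have e2 : 0 < e / 2 by rewrite divr_gt0.
have cG : \forall y \near x, `|G x - G y| < e / 2.
  by have /cvgrPdist_lt := differentiable_continuous duv; apply.
have cH : \forall y \near x, `|H x - H y| < e / 2.
  by have /cvgrPdist_lt := differentiable_continuous dvu; apply.
have /nbhs_ballP[d d0 /= hd] : \forall y \near x, [/\ differentiable f y,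
    differentiable ('D_u f) y, differentiable ('D_v f) y,
    `|G x - G y| < e / 2 & `|H x - H y| < e / 2].
  apply: filterS (filterI df (filterI du (filterI dv (filterI cG cH)))).
  by move=> y [? [? [? []]]].
(* The summand 1 keeps [N] positive when [u] and [v] vanish. With [h = d / 2 / N] the whole
   parallelogram lies in the ball of radius [d]. *)
pose N := 1 + `|u| + `|v|.
have N0 : 0 < N by rewrite /N -addrA ltr_wpDr// addr_ge0.
pose h := d / 2 / N.
have h0 : 0 < h by rewrite divr_gt0// divr_gt0.
have inb s t : 0 <= s <= h -> 0 <= t <= h -> ball x d (x + s *: u + t *: v).
  move=> /andP[s0 sh] /andP[t0 th]; rewrite -ball_normE /ball_/=.
  rewrite -addrA opprD addrA subrr add0r normrN.
  apply: (le_lt_trans (ler_normD _ _)); rewrite !normrZ !ger0_norm//.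
  apply: (@le_lt_trans _ _ (h * N)).
    rewrite !mulrDr mulr1 -addrA; apply: ler_wpDl; first exact: ltW.
    by apply: lerD; apply: ler_wpM2r.
  by rewrite /h divfK ?gt_eqF// ltr_pdivrMr// ltr_pMr// ltr1n.
have inb' s t : 0 <= s <= h -> 0 <= t <= h -> ball x d (x + s *: v + t *: u).
  by move=> hs ht; rewrite addrAC; exact: inb.
have [|s [t [hs ht e1]]] := @second_difference f x u v h h0.
  by move=> s t hs ht; have [] := hd _ (inb _ _ hs ht).
have [|s' [t' [hs' ht' e1']]] := @second_difference f x v u h h0.
  by move=> s' t' hs' ht'; have [] := hd _ (inb' _ _ hs' ht').
have eGH : G (x + s' *: v + t' *: u) = H (x + s *: u + t *: v).
  have swap (a b c b' : R) : a - b - (c - b') = a - c - (b - b').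
    by rewrite !opprD !opprK !addrA; congr (_ + _); rewrite addrAC.
  move: e1'; rewrite swap [x + h *: v + _]addrAC e1 => /(mulIf (lt0r_neq0 h0)).
  by move=> /(mulIf (lt0r_neq0 h0)) eHG; exact: esym eHG.
have [_ _ _ g1 _] := hd _ (inb' _ _ hs' ht').
have [_ _ _ _ g2] := hd _ (inb _ _ hs ht).
exact: (dist_tri eGH g1 g2).
Qed.

End Schwarz.

(** * Stability of smoothness under matrix operations and composition *)

Section Smooth.
Context {R : realType} {V : normedModType R}.
Implicit Types W : normedModType R.

(** [k + 1] times differentiable on [A]; unlike [smooth_on] this is suited to
    induction, as the derivative of a product or composite is a sum of products. *)
Fixpoint diffn W (k : nat) (A : set V) (f : V -> W) : Prop :=
  (forall u, A u -> differentiable f u) /\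
  if k is k'.+1 then forall v, diffn k' A ('D_v f) else True.

(** In [iter_derive] the last vector of the list is applied first, and [diffn] also peels off the
    innermost derivative; hence lists are extended and taken apart at their right end. *)
Lemma smooth_onP W (A : set V) (f : V -> W) :
  smooth_on A f <-> forall k, diffn k A f.
Proof.
split=> [sf k | df vs].
  elim: k f sf => [|k IH] f sf /=; split=> //; try by move=> u; exact: (sf [::]).
  move=> v; apply: IH => vs u Au; have := sf (rcons vs v) u Au.
  by rewrite /iter_derive foldr_rcons.
move: vs f df; apply: last_ind => [|vs v IH] f df u Au.
  by have [+ _] := df 0; apply.
rewrite /iter_derive foldr_rcons; apply: IH => // k.
by have [_] := df k.+1; apply.
Qed.

Lemma diffnS W k A (f : V -> W) : diffn k.+1 A f -> diffn k A f.
Proof.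
elim: k f => [|k IH] f [df dk]; first by split.
by split=> // v; apply: IH; exact: dk.
Qed.

Lemma diffn0 W k A (f : V -> W) u : diffn k A f -> A u -> differentiable f u.
Proof. by case: k => [|k] [+ _]; apply. Qed.

Lemma open_near (T : topologicalType) (A : set T) (P : T -> Prop) u :
  open A -> A u -> (forall y, A y -> P y) -> \forall y \near u, P y.
Proof. by move=> oA Au AP; apply: filterS AP _; exact: open_nbhs_nbhs. Qed.

Lemma diffn_eq W k A (f g : V -> W) : open A -> (forall u, A u -> f u = g u) ->
  diffn k A f -> diffn k A g.
Proof.
move=> oA; elim: k f g => [|k IH] f g fg [df dk]; split=> //; try move=> u Au.
- apply: near_eq_differentiable (df _ Au); exact: (open_near oA Au fg).
- apply: near_eq_differentiable (df _ Au); exact: (open_near oA Au fg).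
- move=> v; apply: IH (dk v) => y Ay; apply: near_eq_derive; exact: (open_near oA Ay fg).
Qed.

Lemma diffn_cst W k A (w : W) : open A -> diffn k A (cst w).
Proof.
move=> oA; elim: k w => [|k IH] w; (split; first by move=> u _; exact: differentiable_cst) => //.
move=> v; by apply: (diffn_eq oA) (IH 0) => u Au; rewrite derive_cst.
Qed.

Lemma diffnD W k A (f g : V -> W) : open A -> diffn k A f -> diffn k A g ->
  diffn k A (fun u => f u + g u).
Proof.
move=> oA; elim: k f g => [|k IH] f g [df dkf] [dg dkg]; split=> //.
- by move=> u Au; apply: differentiableD; [exact: df|exact: dg].
- by move=> u Au; apply: differentiableD; [exact: df|exact: dg].
- move=> v; apply: (diffn_eq oA) (IH _ _ (dkf v) (dkg v)) => u Au.
  by rewrite deriveD//; apply: diff_derivable; [exact: df|exact: dg].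
Qed.

(** In the product rule the undifferentiated factor is needed to one order less, whence [diffnS]. *)
Lemma diffnM k A (f g : V -> R^o) : open A -> diffn k A f -> diffn k A g ->
  diffn k A (fun u => f u * g u : R^o).
Proof.
move=> oA; elim: k f g => [|k IH] f g df dg.
  by split=> // u Au; apply: differentiableM; [exact: diffn0 df _|exact: diffn0 dg _].
have [df0 dfk] := df; have [dg0 dgk] := dg.
split=> [u Au|v]; first by apply: differentiableM; [exact: df0|exact: dg0].
apply: (diffn_eq oA) (diffnD oA (IH _ _ (diffnS df) (dgk v)) (IH _ _ (diffnS dg) (dfk v))).
move=> u Au; rewrite deriveM//; apply: diff_derivable; [exact: df0|exact: dg0].
Qed.

Lemma diffn_sum W k A I (r : seq I) (f : I -> V -> W) : open A ->
  (forall i, diffn k A (f i)) -> diffn k A (fun u => \sum_(i <- r) f i u).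
Proof.
move=> oA df; elim: r => [|i r IH].
  by apply: (diffn_eq oA) (diffn_cst k 0 oA) => u _; rewrite big_nil.
by apply: (diffn_eq oA) (diffnD oA (df i) IH) => u _; rewrite big_cons.
Qed.

(** Induction on [k] with [f] fixed: the derivative is [- f^-1 * f^-1 * 'D_v f], and the induction
    hypothesis covers the factors [f^-1]. *)
Lemma diffnV k A (f : V -> R^o) : open A -> (forall u, A u -> f u != 0) ->
  diffn k A f -> diffn k A (fun u => (f u)^-1 : R^o).
Proof.
move=> oA f0; elim: k => [|k IH] df.
  by split=> // u Au; apply: differentiableV (f0 _ Au); exact: diffn0 df _.
have [df0 dfk] := df; have IH' := IH (diffnS df).
split=> [u Au|v]; first by apply: differentiableV (f0 _ Au); exact: df0.
have oppM := diffnM oA (diffn_cst k (-1 : R^o) oA).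
apply: (diffn_eq oA) (diffnM oA (oppM _ (diffnM oA IH' IH')) (dfk v)) => u Au.
rewrite deriveV ?f0//; last exact: diff_derivable (df0 _ Au).
by rewrite mulN1r -[RHS]/(_ * _) expr2 invfM.
Qed.

Lemma diffn_mxP m n k A (F : V -> 'M[R]_(m, n)) : open A ->
  diffn k A F <-> forall i j, diffn k A (fun u => F u i j : R^o).
Proof.
move=> oA; elim: k F => [|k IH] F.
  split=> [[dF _] i j|dF]; split=> // u Au.
    by move: (dF _ Au) => /differentiable_mxP; apply.
  by apply/differentiable_mxP => i j; have [+ _] := dF i j; apply.
split=> [[dF dFk] i j|dF].
  split=> [u Au|v]; first by move: (dF _ Au) => /differentiable_mxP; apply.
  move: (dFk v) => /IH/(_ i j); apply: (diffn_eq oA) => u Au.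
  by rewrite derive_entry//; exact: dF.
have dF0 u : A u -> differentiable F u.
  by move=> Au; apply/differentiable_mxP => i j; have [+ _] := dF i j; apply.
split=> // v; apply/IH => i j; have [_ /(_ v)] := dF i j.
by apply: (diffn_eq oA) => u Au; rewrite derive_entry//; exact: dF0.
Qed.

Lemma diffn_mulmx m n l k A (F : V -> 'M[R]_(m, n)) (G : V -> 'M[R]_(n, l)) :
  open A -> diffn k A F -> diffn k A G -> diffn k A (fun u => F u *m G u).
Proof.
move=> oA /(diffn_mxP _ _ oA) dF /(diffn_mxP _ _ oA) dG.
apply/(diffn_mxP _ _ oA) => i j.
have := diffn_sum (index_enum _) oA (fun h => diffnM oA (dF i h) (dG h j)).
by apply: (diffn_eq oA) => u _; rewrite mxE.
Qed.

End Smooth.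

Section SmoothOn.
Context {R : realType} {V : normedModType R}.
Implicit Types (W : normedModType R) (A : set V).

Lemma smooth_on_differentiable W A (f : V -> W) u :
  smooth_on A f -> A u -> differentiable f u.
Proof. by move=> sf; exact: (sf [::]). Qed.

Lemma smooth_on_derive W A (f : V -> W) v : smooth_on A f -> smooth_on A ('D_v f).
Proof. by move=> /smooth_onP df; apply/smooth_onP => k; have [_] := df k.+1; apply. Qed.

Lemma smooth_on_eq W A (f g : V -> W) : open A -> (forall u, A u -> f u = g u) ->
  smooth_on A f -> smooth_on A g.
Proof. by move=> oA fg /smooth_onP df; apply/smooth_onP => k; apply: diffn_eq (df k). Qed.

Lemma smooth_on_sub W A (B : set V) (f : V -> W) :
  A `<=` B -> smooth_on B f -> smooth_on A f.
Proof. by move=> AB sf vs u /AB Bu; exact: sf. Qed.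

Lemma smooth_on_local W A (f : V -> W) :
  (forall u, A u -> exists2 B, B u & smooth_on B f) -> smooth_on A f.
Proof. by move=> loc vs u /loc[B Bu sf]; exact: sf. Qed.

Lemma smooth_on_cst W A (w : W) : open A -> smooth_on A (cst w).
Proof. by move=> oA; apply/smooth_onP => k; exact: diffn_cst. Qed.

Lemma smooth_onD W A (f g : V -> W) : open A -> smooth_on A f -> smooth_on A g ->
  smooth_on A (fun u => f u + g u).
Proof.
by move=> oA /smooth_onP df /smooth_onP dg; apply/smooth_onP => k; exact: diffnD.
Qed.

Lemma smooth_onM A (f g : V -> R^o) : open A -> smooth_on A f -> smooth_on A g ->
  smooth_on A (fun u => f u * g u : R^o).
Proof.
by move=> oA /smooth_onP df /smooth_onP dg; apply/smooth_onP => k; exact: diffnM.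
Qed.

Lemma smooth_on_sum W A I (r : seq I) (f : I -> V -> W) : open A ->
  (forall i, smooth_on A (f i)) -> smooth_on A (fun u => \sum_(i <- r) f i u).
Proof.
move=> oA sf; apply/smooth_onP => k; apply: diffn_sum => // i.
exact: (smooth_onP _ _).1 (sf i) k.
Qed.

Lemma smooth_on_prod A I (r : seq I) (f : I -> V -> R^o) : open A ->
  (forall i, smooth_on A (f i)) -> smooth_on A (fun u => \prod_(i <- r) f i u : R^o).
Proof.
move=> oA sf; elim: r => [|i r IH].
  by apply: (smooth_on_eq oA) (smooth_on_cst (1 : R^o) oA) => u _; rewrite big_nil.
by apply: (smooth_on_eq oA) (smooth_onM oA (sf i) IH) => u _; rewrite big_cons.
Qed.

Lemma smooth_onV A (f : V -> R^o) : open A -> (forall u, A u -> f u != 0) ->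
  smooth_on A f -> smooth_on A (fun u => (f u)^-1 : R^o).
Proof.
by move=> oA f0 /smooth_onP df; apply/smooth_onP => k; exact: diffnV.
Qed.

Lemma smooth_on_mxP m n A (F : V -> 'M[R]_(m, n)) : open A ->
  smooth_on A F <-> forall i j, smooth_on A (fun u => F u i j : R^o).
Proof.
move=> oA; split=> [/smooth_onP dF i j|dF]; apply/smooth_onP => k.
  exact: (diffn_mxP _ _ oA).1 (dF k) i j.
by apply/(diffn_mxP _ _ oA) => i j; exact: (smooth_onP _ _).1 (dF i j) k.
Qed.

Lemma smooth_on_mulmx m n l A (F : V -> 'M[R]_(m, n)) (G : V -> 'M[R]_(n, l)) :
  open A -> smooth_on A F -> smooth_on A G -> smooth_on A (fun u => F u *m G u).
Proof.
by move=> oA /smooth_onP df /smooth_onP dg; apply/smooth_onP => k; exact: diffn_mulmx.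
Qed.

Lemma smooth_on_det n A (F : V -> 'M[R]_n) : open A ->
  smooth_on A F -> smooth_on A (fun u => \det (F u) : R^o).
Proof.
move=> oA /(smooth_on_mxP _ oA) sF; apply: smooth_on_sum => // s.
apply: smooth_onM => //; first exact: smooth_on_cst.
exact: smooth_on_prod.
Qed.

(** Cramer's rule: the entries of the inverse are cofactors divided by the determinant, and
    cofactors are signed determinants of minors. *)
Lemma smooth_on_invmx n A (F : V -> 'M[R]_n) : open A ->
  (forall u, A u -> F u \in unitmx) ->
  smooth_on A F -> smooth_on A (fun u => invmx (F u)).
Proof.
move=> oA uF sF; apply/(smooth_on_mxP _ oA) => i j.
have sdet := smooth_on_det oA sF.
have det0 u : A u -> \det (F u) != 0 by move=> /uF; rewrite unitmxE unitfE.
have sadj : smooth_on A (fun u => (\adj (F u)) i j : R^o).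
  have sminor : smooth_on A (fun u => row' j (col' i (F u))).
    apply/(smooth_on_mxP _ oA) => k l.
    move/(smooth_on_mxP _ oA) : sF => /(_ (lift j k) (lift i l)).
    by apply: smooth_on_eq => // u _; rewrite !mxE.
  have := smooth_onM oA (smooth_on_cst ((-1) ^+ (j + i) : R^o) oA) (smooth_on_det oA sminor).
  by apply: smooth_on_eq => // u _; rewrite mxE.
apply: (smooth_on_eq oA) (smooth_onM oA (smooth_onV oA det0 sdet) sadj) => u Au.
by rewrite /invmx (uF _ Au) [RHS]mxE.
Qed.

Lemma smooth_on_row_mx m n1 n2 A (F : V -> 'M[R]_(m, n1)) (G : V -> 'M[R]_(m, n2)) :
  open A -> smooth_on A F -> smooth_on A G -> smooth_on A (fun u => row_mx (F u) (G u)).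
Proof.
move=> oA /(smooth_on_mxP _ oA) sF /(smooth_on_mxP _ oA) sG.
apply/(smooth_on_mxP _ oA) => i j; case: (splitP j) => k jk.
  apply: smooth_on_eq (sF i k) => // u _.
  by rewrite (_ : j = lshift n2 k) ?row_mxEl//; exact: val_inj.
apply: smooth_on_eq (sG i k) => // u _.
by rewrite (_ : j = rshift n1 k) ?row_mxEr//; exact: val_inj.
Qed.

Lemma smooth_on_mxsub m n m' n' A (F : V -> 'M[R]_(m, n)) (f : 'I_m' -> 'I_m)
    (g : 'I_n' -> 'I_n) :
  open A -> smooth_on A F -> smooth_on A (fun u => mxsub f g (F u)).
Proof.
move=> oA /(smooth_on_mxP _ oA) sF; apply/(smooth_on_mxP _ oA) => i j.
by apply: smooth_on_eq (sF (f i) (g j)) => // u _; rewrite mxE.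
Qed.

Lemma smooth_on_trmx m n A (F : V -> 'M[R]_(m, n)) :
  open A -> smooth_on A F -> smooth_on A (fun u => (F u)^T).
Proof.
move=> oA /(smooth_on_mxP _ oA) sF; apply/(smooth_on_mxP _ oA) => i j.
by apply: smooth_on_eq (sF j i) => // u _; rewrite mxE.
Qed.

Lemma smooth_on_opp m n A (F : V -> 'M[R]_(m, n)) :
  open A -> smooth_on A F -> smooth_on A (fun u => - F u).
Proof.
move=> oA sF; apply: smooth_on_eq (smooth_on_mulmx oA (smooth_on_cst (- 1%:M) oA) sF) => //.
by move=> u _; rewrite mulNmx mul1mx.
Qed.

End SmoothOn.

Lemma smooth_on_block (R : realType) (V : normedModType R) m1 m2 n1 n2 (O : set V)
    (A : V -> 'M[R]_(m1, n1)) (B : V -> 'M[R]_(m1, n2)) (C : V -> 'M[R]_(m2, n1))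
    (D : V -> 'M[R]_(m2, n2)) : open O ->
  smooth_on O A -> smooth_on O B -> smooth_on O C -> smooth_on O D ->
  smooth_on O (fun w => block_mx (A w) (B w) (C w) (D w)).
Proof.
move=> oO sA sB sC sD.
have s1 := smooth_on_trmx oO (smooth_on_row_mx oO sA sB).
have s2 := smooth_on_trmx oO (smooth_on_row_mx oO sC sD).
apply: smooth_on_eq (smooth_on_trmx oO (smooth_on_row_mx oO s1 s2)) => // u _.
by rewrite /block_mx tr_row_mx !trmxK.
Qed.

Lemma smooth_on_pairing (R : realType) (V : normedModType R) m (A : set V) (f g : V -> 'rV[R]_m) :
  open A -> smooth_on A f -> smooth_on A g ->
  smooth_on A (fun u => pairing (f u) (g u) : R^o).
Proof.
move=> oA sf sg; have := smooth_on_mulmx oA sf (smooth_on_trmx oA sg).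
by move=> /(smooth_on_mxP _ oA)/(_ 0 0).
Qed.

Lemma smooth_on_id (R : realType) (V : normedModType R) (O : set V) :
  open O -> smooth_on O (fun u : V => u).
Proof.
move=> oO; apply/smooth_onP => -[|k]; split=> // v.
by apply: diffn_eq (diffn_cst k v oO) => // u _; rewrite derive_id.
Qed.

(** Meant for the three functions of a Jacobi identity, each of which comes with its own domain of
    smoothness. *)
Lemma smooth_on_common (R : realType) (V W : normedModType R) (f g h : V -> W) u :
  (exists O, [/\ open O, O u & smooth_on O f]) ->
  (exists O, [/\ open O, O u & smooth_on O g]) ->
  (exists O, [/\ open O, O u & smooth_on O h]) ->
  exists O, [/\ open O, O u & [/\ smooth_on O f, smooth_on O g & smooth_on O h]].
Proof.
move=> [Of [oof fu sf]] [Og [oog gu sg]] [Oh [ooh hu sh]].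
exists (Of `&` (Og `&` Oh)); split=> //; first by do 2?apply: openI.
split; [apply: smooth_on_sub sf|apply: smooth_on_sub sg|apply: smooth_on_sub sh];
  by move=> v [? []].
Qed.

(** Expanded in the coordinates of the middle space, ['D_v (f \o g)] is a sum of entries of ['D_v g]
    times partial derivatives of [f] composed with [g]; these composites are one order lower, so the
    induction applies to them. *)
Lemma diffn_comp (R : realType) (V : normedModType R) m (k : nat) (A : set V)
    (B : set 'rV[R]_m) (g : V -> 'rV[R]_m) (f : 'rV[R]_m -> R^o) :
  open A -> (forall u, A u -> B (g u)) ->
  diffn k A g -> diffn k B f -> diffn k A (f \o g).
Proof.
move=> oA AB; elim: k f g AB => [|k IH] f g AB dg df.
  split=> // u Au; apply: differentiable_comp (diffn0 dg Au) _.
  exact: diffn0 df (AB _ Au).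
have [dg0 dgk] := dg; have [df0 dfk] := df.
split=> [u Au|v]; first exact: differentiable_comp (dg0 _ Au) (df0 _ (AB _ Au)).
have dv i : diffn k A (fun u => ('D_v g u) 0 i : R^o).
  exact: (diffn_mxP _ _ oA).1 (dgk v) 0 i.
have df' i : diffn k A (('D_(delta_mx 0 i) f : _ -> R^o) \o g).
  by apply: IH (diffnS dg) (dfk _).
apply: (diffn_eq oA) (diffn_sum (index_enum _) oA (fun i => diffnM oA (dv i) (df' i))).
move=> u Au; rewrite (derive_comp v (dg0 _ Au) (df0 _ (AB _ Au))).
rewrite [X in 'D_X f _]row_sum_delta derive_sumr; last exact: df0 (AB _ Au).
by apply: eq_bigr => i _; rewrite deriveZr//; exact: df0 (AB _ Au).
Qed.

Section SmoothRow.
Context {R : realType} {V : normedModType R}.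
Implicit Types (A : set V).

Lemma smooth_on_comp m (A : set V) (B : set 'rV[R]_m) (g : V -> 'rV[R]_m)
    (f : 'rV[R]_m -> R^o) :
  open A -> (forall u, A u -> B (g u)) ->
  smooth_on A g -> smooth_on B f -> smooth_on A (fun u => f (g u)).
Proof.
move=> oA AB /smooth_onP dg /smooth_onP df; apply/smooth_onP => k.
exact: (diffn_comp oA AB (dg k) (df k)).
Qed.

Lemma smooth_on_compmx m k l (A : set V) (B : set 'rV[R]_m) (g : V -> 'rV[R]_m)
    (f : 'rV[R]_m -> 'M[R]_(k, l)) :
  open A -> open B -> (forall u, A u -> B (g u)) ->
  smooth_on A g -> smooth_on B f -> smooth_on A (fun u => f (g u)).
Proof.
move=> oA oB AB sg /(smooth_on_mxP _ oB) sf; apply/(smooth_on_mxP _ oA) => i j.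
exact: smooth_on_comp oA AB sg (sf i j).
Qed.

End SmoothRow.

(** * Jacobians and gradients *)

Section Jacobian.
Context {R : realType} {m n : nat}.
Implicit Types (A : set 'rV[R]_m) (f : 'rV[R]_m -> 'rV[R]_n).

Lemma jacobianE f u i j : differentiable f u ->
  ('J f u) i j = ('D_(delta_mx 0 i) f u) 0 j.
Proof. by move=> df; rewrite deriveEjacobian// -rowE [RHS]mxE. Qed.

Lemma smooth_on_jacobian A f : open A -> smooth_on A f -> smooth_on A (fun u => 'J f u).
Proof.
move=> oA sf; apply/(smooth_on_mxP _ oA) => i j.
have /(smooth_on_mxP _ oA)/(_ 0 j) := smooth_on_derive (delta_mx 0 i) sf.
apply: smooth_on_eq => // u Au.
by rewrite jacobianE//; exact: smooth_on_differentiable sf Au.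
Qed.

Lemma smooth_on_swap_scalar A (g : 'rV[R]_m -> R^o) u v w : open A -> smooth_on A g -> A u ->
  'D_v ('D_w g) u = 'D_w ('D_v g) u.
Proof.
move=> oA sg Au; have sd v' := smooth_on_derive v' sg.
have near_diff (h : 'rV[R]_m -> R^o) : smooth_on A h -> \forall x \near u, differentiable h x.
  by move=> sh; apply: (open_near oA Au) => x; exact: smooth_on_differentiable.
apply: (derive_swap (near_diff _ sg) (near_diff _ (sd v)) (near_diff _ (sd w))).
  exact: (smooth_on_differentiable (smooth_on_derive _ (sd v)) Au).
exact: (smooth_on_differentiable (smooth_on_derive _ (sd w)) Au).
Qed.

Lemma smooth_on_swap A f u v w : open A -> smooth_on A f -> A u ->
  'D_v ('D_w f) u = 'D_w ('D_v f) u.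
Proof.
move=> oA sf Au; apply/matrixP => i j.
have df x : A x -> differentiable f x by exact: smooth_on_differentiable.
have dd v' x : A x -> differentiable ('D_v' f) x.
  by apply: smooth_on_differentiable; exact: smooth_on_derive.
have se : smooth_on A (fun x => f x i j : R^o) by exact: (smooth_on_mxP f oA).1.
have DE v' w' : ('D_v' ('D_w' f) u) i j = 'D_v' ('D_w' (fun x => f x i j : R^o)) u.
  rewrite derive_entry; last exact: dd.
  apply: near_eq_derive; apply: (open_near oA Au) => x Ax.
  by rewrite derive_entry//; exact: df.
apply: (etrans (DE v w)); apply: (etrans _ (esym (DE w v))).
exact: smooth_on_swap_scalar oA se Au.
Qed.

End Jacobian.

(** Vectors are rows, so Jacobians multiply in the order in which the maps are applied. *)
Lemma jacobian_comp (R : realType) l m n (f : 'rV[R]_l -> 'rV[R]_m)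
    (g : 'rV[R]_m -> 'rV[R]_n) u :
  differentiable f u -> differentiable g (f u) ->
  'J (g \o f) u = 'J f u *m 'J g (f u).
Proof.
move=> df dg; apply: mulmx_rV_inj => v.
rewrite mulmxA -(deriveEjacobian _ df) -(deriveEjacobian _ dg).
by rewrite -(derive_comp v df dg) deriveEjacobian//; exact: differentiable_comp.
Qed.

Definition grad (R : realType) n (f : 'rV[R]_n -> R) (u : 'rV[R]_n) : 'rV[R]_n :=
  \row_i 'D_(delta_mx 0 i) (f : _ -> R^o) u.

Lemma gradE (R : realType) n (f : 'rV[R]_n -> R) u v : differentiable (f : _ -> R^o) u ->
  'D_v (f : _ -> R^o) u = pairing (grad f u) v.
Proof.
move=> df; rewrite /pairing mxE [in LHS](row_sum_delta v).
rewrite derive_sumr//; apply: eq_bigr => i _.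
by rewrite deriveZr// !mxE mulrC.
Qed.

(** * Fields in charts *)

Section Charts.
Context {R : realType} {p q : nat} {M : foliated_manifold R p q}.
Local Notation n := (p + q)%N.
Implicit Types (c : chart R n M) (U V : set M) (x y : M).

Definition img c U : set 'rV[R]_n := coord c @` (dom c `&` U).

Lemma imgP c U u : img c U u ->
  [/\ dom c (param c u), U (param c u) & coord c (param c u) = u].
Proof. by case=> y [dy Uy] <-; rewrite coordK. Qed.

Lemma img_coord c U y : dom c y -> U y -> img c U (coord c y).
Proof. by move=> dy Uy; exists y. Qed.

Lemma img_sub c U V : U `<=` V -> img c U `<=` img c V.
Proof. by move=> UV _ [y [dy /UV Vy] <-]; exists y. Qed.

Lemma open_img c U : open U -> open (img c U).
Proof.
move=> oU; have -> : img c U = coord c @` dom c `&` param c @^-1` U.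
  apply/seteqP; split=> u; first by case=> y [dy Uy] <-; split; [exists y|rewrite /= coordK].
  by case=> -[y dy <-]; rewrite /= coordK// => Uy; exists y.
have pc : {in coord c @` dom c, continuous (param c)}.
  by rewrite -continuous_open_subspace; [exact: param_continuous|exact: image_open].
rewrite openE => u [du Uu]; apply: filterI.
  by apply: open_nbhs_nbhs; split=> //; exact: image_open.
by apply: pc; [rewrite inE|exact: open_nbhs_nbhs].
Qed.

Lemma near_img c U y : open U -> dom c y -> U y ->
  \forall u \near coord c y, img c U u.
Proof. by move=> oU dy Uy; apply: open_nbhs_nbhs; split; [exact: open_img|exact: img_coord]. Qed.

Definition tmx c c' y : 'M[R]_n := 'J (coord c' \o param c) (coord c y).

(** The tangent vector [v] at [y] has components [v *m Smx c y] in the chart [c],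
    the covector [a] has components [a *m (Tmx c y)^T]. *)
Definition Smx c y := tmx (chart_at y) c y.
Definition Tmx c y := tmx c (chart_at y) y.

Lemma trans_smooth c c' : atlas c -> atlas c' ->
  smooth_on (img c (dom c')) (coord c' \o param c).
Proof. by move=> ac ac'; exact: transition_smooth. Qed.

Lemma trans_diff c c' y : atlas c -> atlas c' -> dom c y -> dom c' y ->
  differentiable (coord c' \o param c) (coord c y).
Proof.
move=> ac ac' dy dy'; apply: smooth_on_differentiable (trans_smooth ac ac') _.
exact: img_coord.
Qed.

(** The cocycle identity is the chain rule: the composite through [c'] agrees with the direct
    coordinate change at points of [dom c'], hence near [y]. *)
Lemma tmx_trans c c' c'' y : atlas c -> atlas c' -> atlas c'' ->
  dom c y -> dom c' y -> dom c'' y -> tmx c c' y *m tmx c' c'' y = tmx c c'' y.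
Proof.
move=> ac ac' ac'' dy dy' dy''.
have e : (coord c' \o param c) (coord c y) = coord c' y by rewrite /= coordK.
have d1 := trans_diff ac ac' dy dy'.
have d2 : differentiable (coord c'' \o param c') ((coord c' \o param c) (coord c y)).
  by rewrite e; exact: trans_diff.
have J := jacobian_comp d1 d2; rewrite e in J.
apply: etrans (esym J) _; apply: mulmx_rV_inj => v.
have d3 := differentiable_comp d1 d2.
apply: etrans (esym (deriveEjacobian v d3)) _.
apply: etrans _ (deriveEjacobian v (trans_diff ac ac'' dy dy'')).
apply: near_eq_derive; have := near_img (@dom_open _ _ _ c') dy dy'.
by apply: filterS => u /imgP[_ d' _] /=; rewrite coordK.
Qed.

Lemma tmx_id c y : atlas c -> dom c y -> tmx c c y = 1%:M.
Proof.
move=> ac dy; apply: mulmx_rV_inj => v.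
rewrite -deriveEjacobian; last exact: trans_diff.
rewrite mulmx1 -[RHS](@derive_id _ _ (coord c y)); apply: near_eq_derive.
by apply: filterS (near_img openT dy I) => u /imgP[].
Qed.

Lemma SmxK c y : atlas c -> dom c y -> Smx c y *m Tmx c y = 1%:M.
Proof.
by move=> ac dy; rewrite tmx_trans ?tmx_id//; do ?[exact: chart_at_atlas|exact: chart_at_dom].
Qed.

Lemma TmxK c y : atlas c -> dom c y -> Tmx c y *m Smx c y = 1%:M.
Proof.
by move=> ac dy; rewrite tmx_trans ?tmx_id//; do ?[exact: chart_at_atlas|exact: chart_at_dom].
Qed.

Lemma Smx_id x : Smx (chart_at x) x = 1%:M.
Proof. by rewrite /Smx tmx_id//; [exact: chart_at_atlas|exact: chart_at_dom]. Qed.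

Lemma Tmx_id x : Tmx (chart_at x) x = 1%:M.
Proof. by rewrite /Tmx tmx_id//; [exact: chart_at_atlas|exact: chart_at_dom]. Qed.

Lemma deriv_chart (W : normedModType R) c (f : M -> W) x v : atlas c -> dom c x ->
  differentiable (f \o param c) (coord c x) ->
  deriv x v f = 'D_(v *m Smx c x) (f \o param c) (coord c x).
Proof.
move=> ac dx df; have ax := chart_at_atlas x; have dxx := chart_at_dom x.
have e : (coord c \o param (chart_at x)) (coord (chart_at x) x) = coord c x.
  by rewrite /= coordK.
have dt := trans_diff ax ac dxx dx.
rewrite /Smx /tmx -deriveEjacobian//.
transitivity ('D_v ((f \o param c) \o (coord c \o param (chart_at x)))
   (coord (chart_at x) x)).
  apply: near_eq_derive; have := near_img (@dom_open _ _ _ c) dxx dx.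
  by apply: filterS => u /imgP[_ dcu _] /=; rewrite coordK.
by rewrite derive_comp ?e.
Qed.

Lemma act_coord c X y : atlas c -> dom c y -> act X (coord c) y = X y *m Smx c y.
Proof.
move=> ac dy; rewrite /act /deriv deriveEjacobian//.
by apply: trans_diff => //; [exact: chart_at_atlas|exact: chart_at_dom].
Qed.

Lemma const_vfE c v y : atlas c -> dom c y -> const_vf c v y = v *m Tmx c y.
Proof.
move=> ac dy; rewrite /const_vf deriveEjacobian//.
by apply: trans_diff => //; [exact: chart_at_atlas|exact: chart_at_dom].
Qed.

(** Components in a fixed chart, as functions on R^n; unlike the values of [X] they can be
    differentiated. They are meaningful on [img c setT]. *)
Definition vloc c (X : M -> 'rV[R]_n) : 'rV[R]_n -> 'rV[R]_n :=
  fun u => X (param c u) *m Smx c (param c u).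

Definition floc c (alpha : M -> 'rV[R]_n) : 'rV[R]_n -> 'rV[R]_n :=
  fun u => alpha (param c u) *m (Tmx c (param c u))^T.

Definition form2_loc c (sigma : M -> 'M[R]_n) : 'rV[R]_n -> 'M[R]_n :=
  fun u => Tmx c (param c u) *m sigma (param c u) *m (Tmx c (param c u))^T.

Definition biv_loc c (Pi : M -> 'M[R]_n) : 'rV[R]_n -> 'M[R]_n :=
  fun u => (Smx c (param c u))^T *m Pi (param c u) *m Smx c (param c u).

Lemma pairing_loc c (X alpha : M -> 'rV[R]_n) y : atlas c -> dom c y ->
  pairing (alpha y) (X y) = pairing (floc c alpha (coord c y)) (vloc c X (coord c y)).
Proof.
move=> ac dy; rewrite /pairing /floc /vloc coordK// trmx_mul mulmxA.
by rewrite -(mulmxA (alpha y)) -trmx_mul SmxK// trmx1 mulmx1.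
Qed.

Lemma dfunE (f : M -> R) y v :
  differentiable (f \o param (chart_at y) : _ -> R^o) (coord (chart_at y) y) ->
  pairing (dfun f y) v = deriv y v (f : M -> R^o).
Proof.
move=> df; rewrite /pairing mxE /deriv [in RHS](row_sum_delta v).
rewrite derive_sumr//; apply: eq_bigr => i _.
by rewrite deriveZr// !mxE mulrC.
Qed.

Lemma dfun_loc c (f : M -> R) y : atlas c -> dom c y ->
  differentiable (f \o param c : _ -> R^o) (coord c y) ->
  dfun f y = grad (f \o param c) (coord c y) *m (Smx c y)^T.
Proof.
move=> ac dy df; apply/rowP => i; rewrite mxE (deriv_chart _ ac dy df).
rewrite gradE// /pairing trmx_mul mulmxA trmx_delta.
by rewrite -colE !mxE.
Qed.

Lemma const_formE c a y : atlas c -> dom c y -> const_form c a y = a *m (Smx c y)^T.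
Proof.
move=> ac dy; rewrite /const_form.
(* In the chart [c] the function to differentiate is the linear form given by [a], but only on
   [img c setT]. *)
have e : {near coord c y, (fun u => pairing a u : R^o) =1
    ((fun z => pairing a (coord c z)) \o param c : _ -> R^o)}.
  by apply: filterS (near_img openT dy I) => u /imgP[_ _] /= ->.
have dp u : differentiable (fun u => pairing a u : R^o) u.
  have -> : (fun u => pairing a u : R^o) = fun u => (u *m a^T) 0 0.
    by apply/funext => w; rewrite pairingC.
  have /differentiable_mxP : differentiable (fun u : 'rV[R]_n => u *m a^T) u.
    by apply: differentiable_mulmx => //; exact: differentiable_cst.
  exact.
rewrite (dfun_loc ac dy); last exact: (near_eq_differentiable (W := R^o) e (dp _)).
congr (_ *m _); apply/rowP => i; rewrite mxE.
apply: etrans (esym (near_eq_derive (W := R^o) _ e)) _.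
have dm : differentiable (fun u : 'rV[R]_n => u *m a^T) (coord c y).
  by apply: differentiable_mulmx => //; exact: differentiable_cst.
transitivity (('D_(delta_mx 0 i) (fun u : 'rV[R]_n => u *m a^T) (coord c y)) 0 0).
  apply: etrans _ (esym (derive_entry _ _ _ dm)).
  have E : (fun u => pairing a u : R^o) = fun u => (u *m a^T) 0 0.
    by apply/funext => w; rewrite pairingC.
  exact: (congr1 (fun g : 'rV[R]_n -> R^o => 'D_(delta_mx 0 i) g (coord c y)) E).
have dI : differentiable (fun u : 'rV[R]_n => u) (coord c y) by [].
have -> : 'D_(delta_mx 0 i) (fun u : 'rV[R]_n => u *m a^T) (coord c y) = delta_mx 0 i *m a^T.
  apply: etrans (derive_mulmx (G := cst a^T) _ dI (differentiable_cst _ _)) _.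
  by rewrite derive_id derive_cst mulmx0 addr0.
by rewrite -rowE !mxE.
Qed.

End Charts.

Lemma derive_mulmxl (R : realType) (V : normedModType R) l m n (x : 'M[R]_(l, m))
    (G : V -> 'M[R]_(m, n)) u v : differentiable G u ->
  'D_v (fun w => x *m G w) u = x *m 'D_v G u.
Proof.
move=> dG; apply: etrans (derive_mulmx v (differentiable_cst x u) dG) _.
by rewrite derive_cst mul0mx add0r.
Qed.

(** Both sides are the second differential of [f] at [u], applied to [v] and [w]. *)
Lemma jacobian_swap (R : realType) m n (A : set 'rV[R]_m) (f : 'rV[R]_m -> 'rV[R]_n)
    u v w : open A -> smooth_on A f -> A u ->
  v *m 'D_w (fun x => 'J f x) u = w *m 'D_v (fun x => 'J f x) u.
Proof.
move=> oA sf Au.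
have dJ : differentiable (fun x => 'J f x) u.
  exact: smooth_on_differentiable (smooth_on_jacobian oA sf) Au.
have DJ a b : 'D_b ('D_a f) u = a *m 'D_b (fun x => 'J f x) u.
  rewrite -derive_mulmxl//; apply: near_eq_derive.
  apply: (open_near oA Au) => x Ax; rewrite deriveEjacobian//.
  exact: smooth_on_differentiable sf Ax.
by rewrite -!DJ; exact: smooth_on_swap oA sf Au.
Qed.

(** * Smoothness of fields tested in single charts *)

Section Localization.
Context {R : realType} {p q : nat} {M : foliated_manifold R p q}.
Local Notation n := (p + q)%N.
Implicit Types (c : chart R n M) (U V : set M) (x y : M).
Implicit Types (X Y alpha beta : M -> 'rV[R]_n).

(** Transition maps are smooth, so one chart around each point suffices. The composition rule is a
    hypothesis in order to serve both scalar values (forms) and rows of components (vector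
    fields). *)
Lemma smooth_fun_local (W : normedModType R) :
  (forall (A B : set 'rV[R]_n) (g : 'rV[R]_n -> 'rV[R]_n) (f : 'rV[R]_n -> W),
     open A -> open B -> (forall u, A u -> B (g u)) ->
     smooth_on A g -> smooth_on B f -> smooth_on A (fun u => f (g u))) ->
  forall U (f : M -> W), open U ->
  (forall x, U x -> exists c V,
     [/\ atlas c, dom c x, open V, V x & smooth_on (img c V) (f \o param c)]) ->
  smooth_fun U f.
Proof.
move=> comp U f oU loc c' ac'; apply: smooth_on_local => u /imgP[du Uu eu].
have [c [V [ac dc oV Vu sf]]] := loc _ Uu.
have oVc : open (V `&` dom c) by apply: openI => //; exact: dom_open.
exists (img c' (V `&` dom c)); first by rewrite -eu; exact: img_coord.
have sub : img c' (V `&` dom c) `<=` img c' (dom c) by apply: img_sub => z [].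
have im w : img c' (V `&` dom c) w -> img c V ((coord c \o param c') w).
  by move=> /imgP[dw [Vw cw] _]; exact: img_coord.
have := comp _ _ _ _ (open_img oVc) (open_img oV) im
  (smooth_on_sub sub (trans_smooth ac' ac)) sf.
apply: smooth_on_eq; first exact: open_img.
by move=> w /imgP[dw [Vw cw] _] /=; rewrite coordK.
Qed.

Lemma vloc_trans c c' X u : atlas c -> atlas c' -> img c (dom c') u ->
  vloc c' X (coord c' (param c u)) = vloc c X u *m 'J (coord c' \o param c) u.
Proof.
move=> ac ac' /imgP[du d'u eu].
have -> : 'J (coord c' \o param c) u = tmx c c' (param c u) by rewrite /tmx eu.
rewrite /vloc (coordK d'u) -mulmxA /Smx tmx_trans//; first exact: chart_at_atlas.
exact: chart_at_dom.
Qed.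

Lemma smooth_vf_local U X : open U ->
  (forall x, U x -> exists c V,
     [/\ atlas c, dom c x, open V, V x & smooth_on (img c V) (vloc c X)]) ->
  smooth_vf U X.
Proof.
move=> oU loc c1 ac1; apply: smooth_fun_local.
- by move=> *; apply: smooth_on_compmx; eassumption.
- by apply: openI => //; exact: dom_open.
move=> x [dx Ux]; have [c [V [ac dc oV Vx sX]]] := loc _ Ux.
have oV1 : open (V `&` dom c1) by apply: openI => //; exact: dom_open.
exists c, (V `&` dom c1); split=> //.
have s1 : smooth_on (img c (V `&` dom c1)) (vloc c X).
  by apply: smooth_on_sub sX; apply: img_sub => z [].
have s2 : smooth_on (img c (V `&` dom c1)) (fun u => 'J (coord c1 \o param c) u).
  apply: smooth_on_jacobian; first exact: open_img.
  by apply: smooth_on_sub (trans_smooth ac ac1); apply: img_sub => z [].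
apply: smooth_on_eq (smooth_on_mulmx (open_img oV1) s1 s2); first exact: open_img.
move=> u /imgP[du [Vu d1u] eu]; rewrite -vloc_trans//; last by rewrite -eu; exact: img_coord.
by rewrite /vloc /= coordK// act_coord.
Qed.

(** The definition views the components in one chart as functions in another; here both charts are
    the same. *)
Lemma smooth_vfP U X : open U ->
  smooth_vf U X <-> forall c, atlas c -> smooth_on (img c U) (vloc c X).
Proof.
move=> oU; split=> [sX c ac | sX].
  have := sX c ac c ac; rewrite -/(img c (dom c `&` U)) => /smooth_on_sub.
  move=> /(_ (img c U)) sX'.
  apply: smooth_on_eq (sX' _); first exact: open_img.
    by move=> u /imgP[du Uu eu] /=; rewrite act_coord.
  by move=> _ [y [dy Uy] <-]; exact: img_coord.
apply: smooth_vf_local => // x Ux; exists (chart_at x), U; split=> //.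
- exact: chart_at_atlas.
- exact: chart_at_dom.
- by apply: sX; exact: chart_at_atlas.
Qed.

Lemma pairing_const_vf c alpha v y : atlas c -> dom c y ->
  pairing (alpha y) (const_vf c v y) = (floc c alpha (coord c y) *m v^T) 0 0.
Proof.
by move=> ac dy; rewrite /pairing const_vfE// /floc coordK// trmx_mul mulmxA.
Qed.

Lemma smooth_form_local U alpha : open U ->
  (forall x, U x -> exists c V,
     [/\ atlas c, dom c x, open V, V x & smooth_on (img c V) (floc c alpha)]) ->
  smooth_form U alpha.
Proof.
move=> oU loc v c1 ac1; apply: smooth_fun_local.
- by move=> A B g f oA oB; apply: smooth_on_comp.
- by apply: openI => //; exact: dom_open.
move=> x [dx Ux]; have [c [V [ac dc oV Vx sX]]] := loc _ Ux.
have oV1 : open (V `&` dom c1) by apply: openI => //; exact: dom_open.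
exists c, (V `&` dom c1); split=> //; set A := img c _.
have oA : open A by exact: open_img.
have s1 : smooth_on A (floc c alpha).
  by apply: smooth_on_sub sX; apply: img_sub => z [].
have st : smooth_on A (coord c1 \o param c).
  by apply: smooth_on_sub (trans_smooth ac ac1); apply: img_sub => z [].
have od : open (img c1 (dom c)) by apply: open_img; exact: dom_open.
(* Covectors transform by the Jacobian of the change back from [c1] to [c], taken at the image
   point; hence the composition. *)
have s2 : smooth_on A (fun u => 'J (coord c \o param c1) (coord c1 (param c u))).
  apply: (smooth_on_compmx oA od) st (smooth_on_jacobian od (trans_smooth ac1 ac)).
  by move=> u /imgP[du [Vu d1u] eu]; exact: img_coord.
have s3 := smooth_on_mulmx oA (smooth_on_mulmx oA s1 (smooth_on_trmx oA s2))
  (smooth_on_cst v^T oA).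
apply: smooth_on_eq ((smooth_on_mxP _ oA).1 s3 0 0) => // u /imgP[du [Vu d1u] eu].
have E := tmx_trans ac1 ac (chart_at_atlas (param c u)) d1u du (chart_at_dom _).
by rewrite /= (pairing_const_vf _ _ ac1 d1u) /floc (coordK d1u) /Tmx -E trmx_mul mulmxA.
Qed.

Lemma smooth_formP U alpha : open U ->
  smooth_form U alpha <-> forall c, atlas c -> smooth_on (img c U) (floc c alpha).
Proof.
move=> oU; split=> [sa c ac | sa].
  have oA := @open_img _ _ _ _ c _ oU.
  apply/(smooth_on_mxP _ oA) => i j; have := sa (delta_mx 0 j) c ac c ac.
  rewrite -/(img c (dom c `&` U)) => sa'.
  have sub : img c U `<=` img c (dom c `&` U).
    by move=> _ [y [dy Uy] <-]; exact: img_coord.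
  apply: smooth_on_eq (smooth_on_sub sub sa') => // u /imgP[du Uu eu] /=.
  by rewrite pairing_const_vf// eu trmx_delta -colE mxE ord1.
apply: smooth_form_local => // x Ux; exists (chart_at x), U; split=> //.
- exact: chart_at_atlas.
- exact: chart_at_dom.
- by apply: sa; exact: chart_at_atlas.
Qed.

Lemma smooth_form2_loc sigma c : smooth_form2 setT sigma -> atlas c ->
  smooth_on (img c setT) (form2_loc c sigma).
Proof.
move=> ss ac; have oA := @open_img _ _ _ _ c _ openT.
apply/(smooth_on_mxP _ oA) => i j.
have := ss (delta_mx 0 i) (delta_mx 0 j) c ac c ac.
rewrite -/(img c (dom c `&` setT)) => ss'.
have sub : img c setT `<=` img c (dom c `&` setT).
  by move=> _ [y [dy Uy] <-]; exact: img_coord.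
apply: smooth_on_eq (smooth_on_sub sub ss') => // u /imgP[du Uu eu] /=.
by rewrite !const_vfE// bil_delta.
Qed.

Lemma smooth_biv_loc Pi c : smooth_bivector setT Pi -> atlas c ->
  smooth_on (img c setT) (biv_loc c Pi).
Proof.
move=> ss ac; have oA := @open_img _ _ _ _ c _ openT.
apply/(smooth_on_mxP _ oA) => i j.
have := ss (delta_mx 0 i) (delta_mx 0 j) c ac c ac.
rewrite -/(img c (dom c `&` setT)) => ss'.
have sub : img c setT `<=` img c (dom c `&` setT).
  by move=> _ [y [dy Uy] <-]; exact: img_coord.
apply: smooth_on_eq (smooth_on_sub sub ss') => // u /imgP[du Uu eu] /=.
by rewrite !const_formE// bil_delta trmxK.
Qed.

(* The second derivative of the coordinate change appears here; it drops out of
   [bracket_loc] and [lie_form_loc] by [jacobian_swap]. *)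
Lemma jacobian_vloc c c' U X y : atlas c -> atlas c' -> dom c y -> dom c' y ->
  open U -> U y -> smooth_vf U X ->
  tmx c c' y *m 'J (vloc c' X) (coord c' y) =
  'J (vloc c X) (coord c y) *m tmx c c' y +
  'D_(vloc c X (coord c y)) (fun w => 'J (coord c' \o param c) w) (coord c y).
Proof.
move=> ac ac' dy dy' oU Uy /(smooth_vfP _ oU) sX.
set phi := coord c' \o param c; set w0 := coord c y.
have dphi := trans_diff ac ac' dy dy'.
have od' := @dom_open _ _ _ c'.
have sphi := trans_smooth ac ac'.
have phiw : phi w0 = coord c' y by rewrite /phi /= coordK.
have dX : differentiable (vloc c X) w0.
  exact: smooth_on_differentiable (sX _ ac) (img_coord dy Uy).
have dX' : differentiable (vloc c' X) (phi w0).
  by rewrite phiw; exact: smooth_on_differentiable (sX _ ac') (img_coord dy' Uy).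
have dJ : differentiable (fun w => 'J phi w) w0.
  apply: smooth_on_differentiable (smooth_on_jacobian _ sphi) (img_coord dy dy').
  exact: open_img.
(* The derivative of [vloc c' X \o phi] is computed twice: by the chain rule, and by the product
   rule after the transformation law of components. *)
have E1 v : 'D_v (vloc c' X \o phi) w0 = v *m tmx c c' y *m 'J (vloc c' X) (coord c' y).
  apply: etrans (derive_comp v dphi dX') _; apply: etrans (deriveEjacobian _ dX') _.
  by rewrite phiw; congr (_ *m _); exact: deriveEjacobian v dphi.
have E2 v : 'D_v (vloc c' X \o phi) w0 = 'D_v (fun w => vloc c X w *m 'J phi w) w0.
  apply: near_eq_derive; have := near_img od' dy dy'.
  by apply: filterS => w cw; exact: vloc_trans.
have E3 v : 'D_v (fun w => vloc c X w *m 'J phi w) w0 =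
    v *m 'J (vloc c X) w0 *m tmx c c' y + v *m 'D_(vloc c X w0) (fun w => 'J phi w) w0.
  apply: etrans (derive_mulmx v dX dJ) _.
  apply: (congr2 (fun A B : 'rV[R]_n => A + B)).
    exact: (congr1 (fun A : 'rV[R]_n => A *m tmx c c' y) (deriveEjacobian v dX)).
  exact: jacobian_swap (open_img od') sphi (img_coord dy dy').
apply: mulmx_rV_inj => v; apply: etrans (mulmxA _ _ _) _.
apply: etrans (esym (E1 v)) _; apply: etrans (E2 v) _; apply: etrans (E3 v) _.
apply: etrans _ (esym (mulmxDr _ _ _)).
exact: (congr1 (fun A : 'rV[R]_n => A + _) (esym (mulmxA _ _ _))).
Qed.

(** Both sides are limits of the same difference quotients along the first [p] coordinate lines, so
    that no differentiability enters. *)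
Lemma leaf_dfunE (f : M -> R) y : leaf_dfun f y = lsubmx (dfun f y).
Proof.
apply/rowP => i; rewrite mxE [RHS]mxE mxE /deriv /derive.
set u := coord (chart_at y) y.
have E h : row_mx (h *: delta_mx 0 i + leaf_coord y) (rsubmx u) =
    h *: delta_mx 0 (lshift q i) + u :> 'rV[R]_n.
  rewrite -{2}[u]hsubmxK (_ : delta_mx 0 (lshift q i) = row_mx (delta_mx 0 i) 0).
    by rewrite scale_row_mx add_row_mx scaler0 add0r.
  apply/rowP => j; rewrite [LHS]mxE eqxx /=; case: (splitP j) => k jk.
    have -> : j = lshift q k by exact: val_inj.
    by rewrite row_mxEl mxE eqxx /= (inj_eq (@lshift_inj p q)).
  have -> : j = rshift p k by exact: val_inj.
  by rewrite row_mxEr mxE eq_rlshift.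
apply: (congr1 (fun G : R -> R^o => lim (G @ 0^'))); apply/funext => h /=.
rewrite /leaf_param -/u E; congr (_ *: (_ - _)).
by rewrite -[leaf_coord y]add0r -[X in row_mx (X + _)](scale0r (delta_mx 0 i)) E scale0r add0r.
Qed.

End Localization.

(* Keeps unification from unfolding derivatives when rewriting matrix products. *)
Opaque derive jacobian.

(** * Coordinate formulas for brackets and Lie derivatives *)

Lemma bil_derive (R : realType) (V : normedModType R) n (B : V -> 'M[R]_n)
    (u v : 'rV[R]_n) x w : differentiable B x ->
  'D_w (fun y => bil (B y) u v : R^o) x = bil ('D_w B x) u v.
Proof.
move=> dB; have d1 : differentiable (fun y => u *m B y) x.
  exact: differentiable_mulmx (differentiable_cst u x) dB.
have d2 : differentiable (fun y => u *m B y *m v^T) x.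
  exact: differentiable_mulmx d1 (differentiable_cst _ x).
apply: etrans (esym (derive_entry w 0 0 d2)) _.
have -> : 'D_w (fun y => u *m B y *m v^T) x = 'D_w (fun y => u *m B y) x *m v^T.
  apply: etrans (derive_mulmx w d1 (differentiable_cst _ x)) _.
  by rewrite derive_cst mulmx0 addr0.
by rewrite derive_mulmxl.
Qed.

(** Here [S] is the Jacobian of the coordinate change, [DX] and [DY] are its derivatives along the
    two fields, and the last hypothesis is the symmetry of second derivatives, by which they
    cancel. *)
Lemma bracket_algebra (R : realType) n (x y : 'rV[R]_n) (S JX JY JX' JY' DX DY : 'M_n) :
  S *m JX' = JX *m S + DX -> S *m JY' = JY *m S + DY -> x *m DY = y *m DX ->
  (x *m JY - y *m JX) *m S = x *m S *m JY' - y *m S *m JX'.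
Proof.
move=> eX eY e; rewrite mulmxBl -!mulmxA eX eY !mulmxDr e opprD addrACA subrr.
by rewrite addr0.
Qed.

(** The derivative [D] of the Jacobian, produced by the product rule on the covector, is absorbed by
    the same [D] in the transformation law of the Jacobian of the field. *)
Lemma lie_form_algebra (R : realType) n (a b : 'rV[R]_n) (S T J J' D : 'M_n) :
  S *m J' = J *m S + D -> T *m S = 1%:M ->
  (a *m S^T + b *m D^T + b *m S^T *m J^T) *m T^T = a + b *m J'^T.
Proof.
move=> eJ TS; rewrite -addrA -mulmxA -mulmxDr -trmx_mul -linearD/= [D + _]addrC -eJ.
by rewrite trmx_mul mulmxA -mulmxDl -mulmxA -trmx_mul TS trmx1 mulmx1.
Qed.

Lemma derive_trmx (R : realType) (V : normedModType R) m n (F : V -> 'M[R]_(m, n)) u v :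
  differentiable F u ->
  differentiable (fun w => (F w)^T) u /\ 'D_v (fun w => (F w)^T) u = ('D_v F u)^T.
Proof.
move=> dF; have E i j : (fun w => (F w)^T i j : R^o) = fun w => F w j i.
  by apply/funext => w; rewrite mxE.
have dT : differentiable (fun w => (F w)^T) u.
  by apply/differentiable_mxP => i j; rewrite E; exact: (differentiable_mxP _ _).1 dF j i.
split=> //; apply/matrixP => i j; apply: etrans (derive_entry v i j dT) _.
rewrite [RHS]mxE; apply: etrans _ (esym (derive_entry v j i dF)).
exact: (congr1 (fun g : V -> R^o => 'D_v g u) (E i j)).
Qed.

Section LocalFormulas.
Context {R : realType} {p q : nat} {M : foliated_manifold R p q}.
Local Notation n := (p + q)%N.
Implicit Types (c : chart R n M) (U V : set M) (x y : M).
Implicit Types (X Y alpha beta : M -> 'rV[R]_n).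

Lemma vloc_coord c X y : dom c y -> vloc c X (coord c y) = X y *m Smx c y.
Proof. by move=> dy; rewrite /vloc coordK. Qed.

Lemma floc_coord c alpha y : dom c y ->
  floc c alpha (coord c y) = alpha y *m (Tmx c y)^T.
Proof. by move=> dy; rewrite /floc coordK. Qed.

Lemma vloc_id X x : vloc (chart_at x) X (coord (chart_at x) x) = X x.
Proof. by rewrite vloc_coord ?Smx_id ?mulmx1//; exact: chart_at_dom. Qed.

Lemma floc_id alpha x : floc (chart_at x) alpha (coord (chart_at x) x) = alpha x.
Proof. by rewrite floc_coord ?Tmx_id ?trmx1 ?mulmx1//; exact: chart_at_dom. Qed.

Lemma act_act_coord X Y x : act X (act Y (coord (chart_at x))) x =
  'D_(X x) (vloc (chart_at x) Y) (coord (chart_at x) x).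
Proof.
have ax := chart_at_atlas x; have dx := chart_at_dom x.
apply: near_eq_derive; apply: filterS (near_img openT dx I) => u /imgP[du _ _].
exact: act_coord.
Qed.

Lemma bracketE X Y x : bracket X Y x =
  'D_(X x) (vloc (chart_at x) Y) (coord (chart_at x) x) -
  'D_(Y x) (vloc (chart_at x) X) (coord (chart_at x) x).
Proof. by rewrite /bracket !act_act_coord. Qed.

Lemma smooth_vf_diff c U X y : atlas c -> open U -> smooth_vf U X -> dom c y -> U y ->
  differentiable (vloc c X) (coord c y).
Proof.
move=> ac oU /(smooth_vfP _ oU) sX dy Uy.
exact: smooth_on_differentiable (sX c ac) (img_coord dy Uy).
Qed.

Lemma smooth_form_diff c U alpha y : atlas c -> open U -> smooth_form U alpha ->
  dom c y -> U y -> differentiable (floc c alpha) (coord c y).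
Proof.
move=> ac oU /(smooth_formP _ oU) sX dy Uy.
exact: smooth_on_differentiable (sX c ac) (img_coord dy Uy).
Qed.

(** The bracket is defined at each [y] through [chart_at y]; its smoothness and its transverse part
    have to be studied in one chart around [y], and there it has the usual coordinate expression. *)
Lemma bracket_loc c U X Y y : atlas c -> dom c y -> open U -> U y ->
  smooth_vf U X -> smooth_vf U Y ->
  bracket X Y y *m Smx c y =
  vloc c X (coord c y) *m 'J (vloc c Y) (coord c y) -
  vloc c Y (coord c y) *m 'J (vloc c X) (coord c y).
Proof.
move=> ac dy oU Uy sX sY; have a0 := chart_at_atlas y; have d0 := chart_at_dom y.
have dX := smooth_vf_diff a0 oU sX d0 Uy; have dY := smooth_vf_diff a0 oU sY d0 Uy.
have jX := jacobian_vloc a0 ac d0 dy oU Uy sX.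
have jY := jacobian_vloc a0 ac d0 dy oU Uy sY.
have sw := jacobian_swap (X y) (Y y) (open_img (@dom_open _ _ _ c))
  (trans_smooth a0 ac) (img_coord d0 dy).
rewrite !vloc_id -!/(Smx c y) in jX jY.
rewrite bracketE (deriveEjacobian (X y) dY) (deriveEjacobian (Y y) dX).
by rewrite !(vloc_coord _ dy); exact: bracket_algebra jX jY sw.
Qed.

Lemma vloc_const_vf c v u : atlas c -> img c setT u -> vloc c (const_vf c v) u = v.
Proof.
move=> ac /imgP[du _ eu]; rewrite /vloc const_vfE// -mulmxA TmxK//.
by rewrite mulmx1.
Qed.

Lemma floc_const_form c a u : atlas c -> img c setT u ->
  floc c (const_form c a) u = a.
Proof.
move=> ac /imgP[du _ eu]; rewrite /floc const_formE// -mulmxA -trmx_mul TmxK//.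
by rewrite trmx1 mulmx1.
Qed.

Lemma lie_formE X beta x :
  differentiable (vloc (chart_at x) X) (coord (chart_at x) x) ->
  differentiable (floc (chart_at x) beta) (coord (chart_at x) x) ->
  lie_form X beta x = 'D_(X x) (floc (chart_at x) beta) (coord (chart_at x) x) +
    beta x *m ('J (vloc (chart_at x) X) (coord (chart_at x) x))^T.
Proof.
set c := chart_at x => dX db; have ac := chart_at_atlas x; have dx := chart_at_dom x.
apply/rowP => i; rewrite mxE [RHS]mxE; congr (_ + _).
  apply: etrans _ (esym (derive_entry (X x) 0 i db)).
  apply: near_eq_derive; apply: filterS (near_img openT dx I) => u /imgP[du _ eu].
  rewrite /= pairing_const_vf// eu trmx_delta -colE mxE; congr (floc _ _ _ _ _).
rewrite bracketE -/c.
(* The coordinate field has constant components, so its bracket with [X] reduces to minus the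
   derivative of [X] along it. *)
have -> : 'D_(X x) (vloc c (const_vf c (delta_mx 0 i))) (coord c x) = 0.
  apply: etrans (derive_cst (delta_mx 0 i : 'rV[R]_n) (coord c x) (X x)).
  apply: near_eq_derive; apply: filterS (near_img openT dx I) => u iu.
  exact: vloc_const_vf.
have -> : const_vf c (delta_mx 0 i) x = delta_mx 0 i.
  by rewrite const_vfE// Tmx_id mulmx1.
rewrite deriveEjacobian// sub0r /pairing linearN/= mulmxN mxE opprK.
by rewrite trmx_mul mulmxA trmx_delta -colE mxE.
Qed.

Lemma floc_trans c c' beta u : atlas c -> atlas c' -> img c (dom c') u ->
  floc c beta u = floc c' beta (coord c' (param c u)) *m ('J (coord c' \o param c) u)^T.
Proof.
move=> ac ac' /imgP[du d'u eu].
have -> : 'J (coord c' \o param c) u = tmx c c' (param c u) by rewrite /tmx eu.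
rewrite (floc_coord _ d'u) -mulmxA -trmx_mul /Tmx tmx_trans//.
  exact: chart_at_atlas.
exact: chart_at_dom.
Qed.

Lemma lie_form_loc c U X beta y : atlas c -> dom c y -> open U -> U y ->
  smooth_vf U X -> smooth_form U beta ->
  lie_form X beta y *m (Tmx c y)^T =
  vloc c X (coord c y) *m 'J (floc c beta) (coord c y) +
  floc c beta (coord c y) *m ('J (vloc c X) (coord c y))^T.
Proof.
move=> ac dy oU Uy sX sb; have a0 := chart_at_atlas y; have d0 := chart_at_dom y.
set c0 := chart_at y in a0 d0 *; set S := Smx c y.
have dX := smooth_vf_diff a0 oU sX d0 Uy; have db0 := smooth_form_diff a0 oU sb d0 Uy.
have db := smooth_form_diff ac oU sb dy Uy.
have jX := jacobian_vloc a0 ac d0 dy oU Uy sX.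
rewrite !vloc_id -!/(Smx c y) -/S in jX.
have dphi := trans_diff a0 ac d0 dy.
have phiw : (coord c \o param c0) (coord c0 y) = coord c y by rewrite /= coordK.
have dJ : differentiable (fun w => 'J (coord c \o param c0) w) (coord c0 y).
  apply: smooth_on_differentiable (smooth_on_jacobian _ (trans_smooth a0 ac)) (img_coord d0 dy).
  apply: open_img; exact: dom_open.
have dbp : differentiable (floc c beta) ((coord c \o param c0) (coord c0 y)).
  by rewrite phiw.
have [dJT DJT] := derive_trmx (X y) dJ.
(* Near [y], the components in [c0] are those in [c] times the transposed Jacobian; the product rule
   adds a term with the derivative of that Jacobian. *)
have Dfl : 'D_(X y) (floc c0 beta) (coord c0 y) =
    vloc c X (coord c y) *m 'J (floc c beta) (coord c y) *m S^T +
    floc c beta (coord c y) *m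
      ('D_(X y) (fun w => 'J (coord c \o param c0) w) (coord c0 y))^T.
  transitivity ('D_(X y) (fun w => (floc c beta \o (coord c \o param c0)) w *m
     ('J (coord c \o param c0) w)^T) (coord c0 y)).
    apply: near_eq_derive; have := near_img (@dom_open _ _ _ c) d0 dy.
    by apply: filterS => w cw; exact: floc_trans.
  apply: etrans (derive_mulmx _ (differentiable_comp dphi dbp) dJT) _.
  have D1 : 'D_(X y) (floc c beta \o (coord c \o param c0)) (coord c0 y) =
      vloc c X (coord c y) *m 'J (floc c beta) (coord c y).
    apply: etrans (derive_comp _ dphi dbp) _; apply: etrans (deriveEjacobian _ dbp) _.
    rewrite phiw (vloc_coord _ dy).
    exact: (congr1 (fun A : 'rV[R]_n => A *m _) (deriveEjacobian (X y) dphi)).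
  have D2 : (floc c beta \o (coord c \o param c0)) (coord c0 y) = floc c beta (coord c y).
    exact: (congr1 (floc c beta) phiw).
  apply: (congr2 (fun A B : 'rV[R]_n => A + B)).
    exact: (congr1 (fun A : 'rV[R]_n => A *m S^T) D1).
  exact: (congr2 (fun (A : 'rV[R]_n) (B : 'M[R]_n) => A *m B) D2 DJT).
have b0 : beta y = floc c beta (coord c y) *m S^T.
  by rewrite floc_coord// -mulmxA -trmx_mul SmxK// trmx1 mulmx1.
rewrite (lie_formE dX db0) -/c0 Dfl {1}b0.
by apply: lie_form_algebra jX _; exact: TmxK.
Qed.

End LocalFormulas.

(** * Smoothness of the Courant bracket; bivectors and 2-forms in coordinates *)

Section SmoothFields.
Context {R : realType} {p q : nat} {M : foliated_manifold R p q}.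
Local Notation n := (p + q)%N.
Implicit Types (c : chart R n M) (U V : set M) (x y : M).
Implicit Types (X Y alpha beta : M -> 'rV[R]_n).

Lemma smooth_vf_bracket U X Y : open U -> smooth_vf U X -> smooth_vf U Y ->
  smooth_vf U (bracket X Y).
Proof.
move=> oU sX sY; apply/(smooth_vfP _ oU) => c ac.
have oA := @open_img _ _ _ _ c _ oU.
have sX' := (smooth_vfP _ oU).1 sX c ac; have sY' := (smooth_vfP _ oU).1 sY c ac.
have sXY Z Z' : smooth_on (img c U) (vloc c Z) -> smooth_on (img c U) (vloc c Z') ->
    smooth_on (img c U) (fun u => vloc c Z u *m 'J (vloc c Z') u).
  by move=> sZ sZ'; exact: smooth_on_mulmx oA sZ (smooth_on_jacobian oA sZ').
apply: smooth_on_eq (smooth_onD oA (sXY _ _ sX' sY') (smooth_on_opp oA (sXY _ _ sY' sX'))).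
  by [].
move=> u /imgP[du Uu eu]; rewrite /= /vloc (bracket_loc ac du oU Uu sX sY).
by rewrite !(vloc_coord _ du) eu.
Qed.

Lemma smooth_form_lie U X beta : open U -> smooth_vf U X -> smooth_form U beta ->
  smooth_form U (lie_form X beta).
Proof.
move=> oU sX sb; apply/(smooth_formP _ oU) => c ac.
have oA := @open_img _ _ _ _ c _ oU.
have sX' := (smooth_vfP _ oU).1 sX c ac; have sb' := (smooth_formP _ oU).1 sb c ac.
have s1 := smooth_on_mulmx oA sX' (smooth_on_jacobian oA sb').
have s2 := smooth_on_mulmx oA sb' (smooth_on_trmx oA (smooth_on_jacobian oA sX')).
apply: smooth_on_eq (smooth_onD oA s1 s2) => // u /imgP[du Uu eu].
rewrite /= [RHS]/floc (lie_form_loc ac du oU Uu sX sb).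
by rewrite !(vloc_coord _ du) !(floc_coord _ du) eu.
Qed.

Lemma smooth_pairing_loc c U alpha X : atlas c -> open U ->
  smooth_form U alpha -> smooth_vf U X ->
  smooth_on (img c U) ((fun y => pairing (alpha y) (X y)) \o param c : _ -> R^o).
Proof.
move=> ac oU sa sX; have oA := @open_img _ _ _ _ c _ oU.
have sX' := (smooth_vfP _ oU).1 sX c ac; have sa' := (smooth_formP _ oU).1 sa c ac.
apply: smooth_on_eq (smooth_on_pairing oA sa' sX') => // u /imgP[du Uu eu].
by rewrite /= (pairing_loc _ _ ac du) eu.
Qed.

Lemma floc_dfun c U (f : M -> R) u : atlas c -> img c U u ->
  smooth_on (img c U) (f \o param c : _ -> R^o) ->
  floc c (dfun f) u = grad (f \o param c) u.
Proof.
move=> ac iu sf; have [du Uu eu] := imgP iu.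
have df := smooth_on_differentiable sf iu.
rewrite /floc (dfun_loc (f := f) ac du) ?eu// -mulmxA -trmx_mul TmxK//.
by rewrite trmx1 mulmx1.
Qed.

Lemma smooth_form_dfun U (f : M -> R) : open U ->
  (forall c, atlas c -> smooth_on (img c U) (f \o param c : _ -> R^o)) ->
  smooth_form U (dfun f).
Proof.
move=> oU sf; apply/(smooth_formP _ oU) => c ac.
have oA := @open_img _ _ _ _ c _ oU.
apply/(smooth_on_mxP _ oA) => i j.
apply: smooth_on_eq (smooth_on_derive (delta_mx 0 j) (sf c ac)) => // u iu.
by rewrite (floc_dfun ac iu (sf c ac)) mxE.
Qed.

Lemma smooth_form_lin U (k : R) alpha beta : open U ->
  smooth_form U alpha -> smooth_form U beta ->
  smooth_form U (fun x => alpha x + k *: beta x).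
Proof.
move=> oU sa sb; apply/(smooth_formP _ oU) => c ac.
have oA := @open_img _ _ _ _ c _ oU.
have sa' := (smooth_formP _ oU).1 sa c ac; have sb' := (smooth_formP _ oU).1 sb c ac.
have sk := smooth_on_mulmx oA sb' (smooth_on_cst (k%:M : 'M[R]_n) oA).
apply: smooth_on_eq (smooth_onD oA sa' sk) => // u _.
by rewrite /floc /= mul_mx_scalar mulmxDl scalemxAl.
Qed.

(** Settles the smoothness half of the closedness of L under the bracket. *)
Lemma smooth_section_courant U (s t : M -> 'rV[R]_n * 'rV[R]_n) : open U ->
  smooth_section U s -> smooth_section U t -> smooth_section U (courant s t).
Proof.
move=> oU [sX sa] [sY sb]; split; first exact: smooth_vf_bracket.
pose f := fun y => pairing ((snd \o s) y) ((fst \o t) y) - pairing ((snd \o t) y) ((fst \o s) y).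
have sf c : atlas c -> smooth_on (img c U) (f \o param c : _ -> R^o).
  move=> ac; have oA := @open_img _ _ _ _ c _ oU.
  have s1 := smooth_pairing_loc ac oU sa sY; have s2 := smooth_pairing_loc ac oU sb sX.
  apply: smooth_on_eq (smooth_onD oA s1 (smooth_onM oA (smooth_on_cst (-1 : R^o) oA) s2)) => //.
  by move=> u _; rewrite /f /= mulN1r.
have s1 := smooth_form_lie oU sX sb; have s2 := smooth_form_lie oU sY sa.
have := smooth_form_lin (2^-1) oU (smooth_form_lin (-1) oU s1 s2) (smooth_form_dfun oU sf).
by rewrite [X in smooth_form U X -> _](_ : _ = snd \o courant s t)//;
  apply/funext => x; rewrite /= scaleN1r.
Qed.

Lemma smooth_vf_const c v U : atlas c -> open U -> U `<=` dom c ->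
  smooth_vf U (const_vf c v).
Proof.
move=> ac oU Uc; apply: smooth_vf_local => // x Ux; exists c, U; split=> //; first exact: Uc.
apply: smooth_on_eq (smooth_on_cst v (open_img oU)) => [|u iu]; first exact: open_img.
by rewrite vloc_const_vf//; exact: img_sub iu.
Qed.

Lemma lie_bivectorE X (Pi : M -> 'M[R]_n) x a b :
  differentiable (vloc (chart_at x) X) (coord (chart_at x) x) ->
  differentiable (biv_loc (chart_at x) Pi) (coord (chart_at x) x) ->
  let J := 'J (vloc (chart_at x) X) (coord (chart_at x) x) in
  lie_bivector X Pi x a b =
  bil ('D_(X x) (biv_loc (chart_at x) Pi) (coord (chart_at x) x)) a b
  - bil (Pi x) (a *m J^T) b - bil (Pi x) a (b *m J^T).
Proof.
set c := chart_at x => dX dP /=; have ac := chart_at_atlas x; have dx := chart_at_dom x.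
have nimg := near_img openT dx I.
(* For a form with constant components, the Lie derivative retains only the Jacobian of [X]. *)
have lie0 a' : lie_form X (const_form c a') x = a' *m ('J (vloc c X) (coord c x))^T.
  have near_cst : {near coord c x, cst a' =1 floc c (const_form c a')}.
    by apply: filterS nimg => u iu; rewrite floc_const_form.
  rewrite lie_formE//; last first.
    exact: near_eq_differentiable near_cst (differentiable_cst _ _).
  rewrite const_formE// Smx_id trmx1 mulmx1.
  rewrite (_ : 'D_(X x) _ _ = 0) ?add0r//.
  apply: etrans (derive_cst a' (coord c x) (X x)); apply: esym.
  exact: near_eq_derive near_cst.
rewrite /lie_bivector -/c !lie0; congr (_ - _ - _).
apply: etrans _ (bil_derive a b (X x) dP).
apply: near_eq_derive; apply: filterS nimg => u /imgP[du _ eu].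
by rewrite /= !const_formE// bil_mulmx trmxK.
Qed.

Lemma dform2E (sigma : M -> 'M[R]_n) x u v w :
  let S := form2_loc (chart_at x) sigma in let u0 := coord (chart_at x) x in
  differentiable S u0 ->
  dform2 sigma x u v w =
  bil ('D_u S u0) v w + bil ('D_v S u0) w u + bil ('D_w S u0) u v.
Proof.
move=> S u0 dS; have ac := chart_at_atlas x; have dx := chart_at_dom x.
have D a b d : deriv x a (fun y => bil (sigma y) (const_vf (chart_at x) b y)
    (const_vf (chart_at x) d y) : R^o) = bil ('D_a S u0) b d.
  apply: etrans _ (bil_derive b d a dS).
  apply: near_eq_derive; apply: filterS (near_img openT dx I) => z /imgP[dz _ ez].
  by rewrite /= !const_vfE// bil_mulmx.
by rewrite /dform2 !D.
Qed.

End SmoothFields.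

(** * Local form of a coupling almost Dirac structure *)

Section Foliation.
Context {R : realType} {p q : nat} {M : foliated_manifold R p q}.
Local Notation n := (p + q)%N.
Implicit Types (c : chart R n M) (U V : set M) (x y : M).

Lemma coord_continuous_at c x : dom c x -> coord c @ x --> coord c x.
Proof.
have : {in dom c, continuous (coord c)}.
  by rewrite -continuous_open_subspace; [exact: coord_continuous|exact: dom_open].
by move=> cc dx; apply: cc; rewrite inE.
Qed.

(** Differentiates [transition_foliated]: near [u0] the transverse part of the coordinate change is
    not affected by precomposition with [proj], which resets the leaf coordinates to those of [u0],
    and the derivative of [proj] kills leaf directions. *)
Lemma leaf_tmx c c' y (v : 'rV[R]_n) : atlas c -> atlas c' -> dom c y -> dom c' y ->
  rsubmx v = 0 -> rsubmx (v *m tmx c c' y) = 0.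
Proof.
move=> ac ac' dy dy' v0; set u0 := coord c y; set phi := coord c' \o param c.
have dphi : differentiable phi u0 := trans_diff ac ac' dy dy'.
have [|B nB fol] := @transition_foliated _ _ _ M c c' ac ac' u0; first exact: img_coord.
pose E : 'M[R]_n := block_mx 0 0 0 1%:M.
pose proj := fun u : 'rV[R]_n => row_mx (lsubmx u0) 0 + u *m E.
have projE u : proj u = row_mx (lsubmx u0) (rsubmx u).
  rewrite /proj -{1}[u]hsubmxK mul_row_block !mulmx0 !addr0 mulmx1 add0r.
  by rewrite add_row_mx addr0 add0r.
have proj0 : proj u0 = u0 by rewrite projE hsubmxK.
have dE : differentiable (fun u : 'rV[R]_n => u *m E) u0.
  have dI : differentiable (fun u : 'rV[R]_n => u) u0 by [].
  exact: differentiable_mulmx dI (differentiable_cst E u0).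
have DE : 'D_v (fun u : 'rV[R]_n => u *m E) u0 = v *m E.
  have dI : differentiable (fun u : 'rV[R]_n => u) u0 by [].
  apply: etrans (derive_mulmx v dI (differentiable_cst E u0)) _.
  by rewrite derive_cst mulmx0 addr0 derive_id.
have dproj : differentiable proj u0.
  exact: differentiableD (differentiable_cst _ _) dE.
have Dproj : 'D_v proj u0 = 0.
  apply: etrans (deriveD (derivable_cst _ _ _) (diff_derivable dE)) _.
  rewrite derive_cst add0r DE -[v]hsubmxK v0 mul_row_block.
  by rewrite !mulmx0 mul0mx !addr0 row_mx0.
have crs := @continuous_rsubmx R 1 p q.
have [drp Drp] := derive_linear v crs dphi.
rewrite /tmx -/phi -/u0 -(deriveEjacobian v dphi) -Drp.
transitivity ('D_v ((rsubmx \o phi) \o proj) u0).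
  apply: near_eq_derive.
  have nproj : \forall u \near u0, B (proj u).
    by apply: (differentiable_continuous dproj); rewrite [nbhs _ _]/(nbhs (proj u0) B) proj0.
  apply: filterS (filterI nB nproj) => u [Bu Bpu]; apply: fol => //.
  by rewrite projE row_mxKr.
have drp' : differentiable (rsubmx \o phi) (proj u0) by rewrite proj0.
by apply: etrans (derive_comp v dproj drp') _; rewrite Dproj derive0.
Qed.

Lemma leaf_Smx c y (v : 'rV[R]_n) : atlas c -> dom c y ->
  (v \in tangF R p q) = (rsubmx (v *m Smx c y) == 0).
Proof.
move=> ac dy; have ay := chart_at_atlas y; have dy0 := chart_at_dom y.
rewrite memv_tangF; apply/eqP/eqP => v0; first exact: leaf_tmx.
rewrite -[v]mulmx1 -(SmxK ac dy) mulmxA.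
exact: leaf_tmx.
Qed.

Lemma tangFP (v : 'rV[R]_n) : v \in tangF R p q <-> v = row_mx (lsubmx v) 0.
Proof.
rewrite memv_tangF; split=> [/eqP v0|->]; last by rewrite row_mxKr.
by rewrite -[LHS]hsubmxK v0.
Qed.

Lemma ann_tangF c y (a : 'rV[R]_n) : atlas c -> dom c y ->
  (a \in annv (tangF R p q)) <-> lsubmx (a *m (Tmx c y)^T) = 0.
Proof.
move=> ac dy; have pairT v : pairing a (v *m Tmx c y) = pairing (a *m (Tmx c y)^T) v.
  by rewrite /pairing trmx_mul mulmxA.
split=> [/memv_ann aF | a0].
  apply/rowP => j; rewrite [LHS]mxE [RHS]mxE.
  have := aF (delta_mx 0 (lshift q j) *m Tmx c y) _; rewrite pairT /pairing.
  rewrite trmx_delta -colE mxE => -> //.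
  rewrite (leaf_Smx _ ac dy) -mulmxA TmxK// mulmx1; apply/eqP/rowP => k.
  by rewrite !mxE eqxx/= eq_rlshift.
apply/memv_ann => v; rewrite (leaf_Smx _ ac dy) => /eqP v0.
rewrite -[v]mulmx1 -(SmxK ac dy) mulmxA pairT /pairing.
rewrite -[a *m _]hsubmxK -[v *m _]hsubmxK a0 v0 tr_row_mx mul_row_col.
by rewrite trmx0 mulmx0 mul0mx addr0 mxE.
Qed.

End Foliation.

Lemma anti_block_ul (R : realType) m1 m2 (B : 'M[R]_(m1 + m2)) :
  B^T = - B -> rsubmx B = 0 -> B = block_mx (ulsubmx B) 0 0 0.
Proof.
move=> anti B0; have E i j : B i (rshift m1 j) = 0.
  by have := congr1 (fun A : 'M_(_, _) => A i j) B0; rewrite !mxE.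
have E' i j : B (rshift m1 i) j = 0.
  have := congr1 (fun A : 'M_(_, _) => A j (rshift m1 i)) anti.
  by rewrite !mxE E oppr0.
rewrite -[LHS]submxK; congr block_mx; apply/matrixP => i j; by rewrite !mxE ?E ?E'.
Qed.

Lemma anti_block_dr (R : realType) m1 m2 (B : 'M[R]_(m1 + m2)) :
  B^T = - B -> lsubmx B = 0 -> B = block_mx 0 0 0 (drsubmx B).
Proof.
move=> anti B0; have E i j : B i (lshift m2 j) = 0.
  by have := congr1 (fun A : 'M_(_, _) => A i j) B0; rewrite !mxE.
have E' i j : B (lshift m2 i) j = 0.
  have := congr1 (fun A : 'M_(_, _) => A j (lshift m2 i)) anti.
  by rewrite !mxE E oppr0.
rewrite -[LHS]submxK; congr block_mx; apply/matrixP => i j; by rewrite !mxE ?E ?E'.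
Qed.

Lemma sharp_algebra (R : realType) n (z a : 'rV[R]_n) (P S T : 'M_n) : S *m T = 1%:M ->
  (z - a *m P) *m S = z *m S - a *m T^T *m (S^T *m P *m S).
Proof.
move=> ST; rewrite mulmxBl; congr (_ - _).
by rewrite !mulmxA -(mulmxA a) -trmx_mul ST trmx1 mulmx1.
Qed.

Section Frame.
Context {R : realType} {p q : nat} {M : foliated_manifold R p q}.
Local Notation n := (p + q)%N.
Local Notation fibre := ('rV[R]_n * 'rV[R]_n)%type.
Context (L : M -> {vspace fibre}) (sigma Pi : M -> 'M[R]_n).
Implicit Types (c : chart R n M) (U V : set M) (x y : M).
Hypotheses (HL : almost_dirac L) (Hc : coupling L) (Hg : geometric_data L sigma Pi).
Local Notation F := (tangF R p q).

Definition Ploc c (u : 'rV[R]_n) : 'M[R]_p := ulsubmx (biv_loc c Pi u).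
Definition Sloc c (u : 'rV[R]_n) : 'M[R]_q := drsubmx (form2_loc c sigma u).

Lemma biv_locE c u : atlas c -> img c setT u ->
  biv_loc c Pi u = block_mx (Ploc c u) 0 0 0.
Proof.
move=> ac /imgP[du _ eu]; have [_ _ /(_ (param c u)) [anti sh] _] := Hg.
apply: anti_block_ul.
- by rewrite /biv_loc !trmx_mul trmxK anti mulNmx mulmxN mulmxA.
apply: mulmx_rV_inj => v; rewrite mulmx0 mulmx_rsub !mulmxA; apply/eqP.
by rewrite -(leaf_Smx _ ac du); exact: sh.
Qed.

Lemma form2_locE c u : atlas c -> img c setT u ->
  form2_loc c sigma u = block_mx 0 0 0 (Sloc c u).
Proof.
move=> ac /imgP[du _ eu]; have [_ /(_ (param c u)) [anti fl] _ _] := Hg.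
apply: anti_block_dr.
- by rewrite /form2_loc !trmx_mul trmxK anti mulNmx mulmxN mulmxA.
apply: mulmx_rV_inj => v; rewrite mulmx0 mulmx_lsub !mulmxA.
by apply/(ann_tangF _ ac du); exact: fl.
Qed.

(** By antisymmetry the components of [sharp Pi x a] are, up to sign, values of [a] on vectors in
    the image of [sharp], which lies in F. *)
Lemma sharp_ann x a : a \in annv F -> sharp Pi x a = 0.
Proof.
move=> /memv_ann aF; have [_ _ /(_ x) [anti sh] _] := Hg.
apply/rowP => i; have := aF _ (sh (delta_mx 0 i)).
rewrite /pairing trmx_mul mulmxA anti mulmxN mulNmx mxE trmx_delta -colE mxE.
by move=> /eqP; rewrite oppr_eq0 => /eqP e; rewrite [RHS]mxE.
Qed.

(** Over [U], H is the graph of [A] from transverse to leaf directions; smoothness of [A] expresses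
    that H is a differentiable bundle. *)
Definition represents c U (A : 'rV[R]_n -> 'M[R]_(q, p)) : Prop :=
  [/\ open U, U `<=` dom c, smooth_on (img c U) A &
   forall y v, U y -> (v \in normalH L y <->
     v *m Smx c y = rsubmx (v *m Smx c y) *m row_mx (A (coord c y)) 1%:M)].

Lemma normalH_disjoint x v : v \in normalH L x -> v \in F -> v = 0.
Proof.
move=> vH vF; have [_ HF] := Hc x.
by apply/eqP; rewrite -memv0 -HF memv_cap vH.
Qed.

(** Subtracting the sharp of the form part maps L onto H: on [(v + sharp a, flat v + a)] it returns
    [v], because [flat v] annihilates F and is killed by [sharp]. A frame of L thus yields
    generators of H, in general not independent. *)
Lemma normalH_span c U r (s : 'I_r -> M -> fibre) y : atlas c -> dom c y -> U y ->
  basis_of (L y) [seq s i y | i <- enum 'I_r] ->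
  let w i := (s i y).1 - sharp Pi y (s i y).2 in
  (forall i, w i \in normalH L y) /\
  forall v, v \in normalH L y -> exists k : 'I_r -> R, v = \sum_i k i *: w i.
Proof.
move=> ac dy Uy bs w; have [_ _ _ Lz] := Hg; split=> [i|v vH].
  have : s i y \in L y by apply: (basis_mem bs); apply: map_f; rewrite mem_enum.
  move=> /Lz[v vH [a aH e]]; rewrite /w e /= /sharp mulmxDl.
  have /sharp_ann : flat sigma y v \in annv F by have [_ /(_ y) [_ fl] _ _] := Hg.
  by rewrite /sharp => ->; rewrite add0r addrK.
have [alpha aF vaL] := (memv_normalH _ _ _).1 vH.
have [k ek] : exists k : 'I_r -> R, (v, alpha) = \sum_i k i *: s i y.
  have := vaL; rewrite -(span_basis bs) span_def big_map big_enum.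
  move=> /memv_sumP[vs vsi ->].
  have /choice[k ek] : forall i, exists k, vs i = k *: s i y.
    by move=> i; apply/vlineP; exact: vsi.
  by exists k; apply: eq_bigr => i _.
exists k; rewrite /w.
have e1 : v = \sum_i k i *: (s i y).1 by have := congr1 fst ek; rewrite /= raddf_sum.
have e2 : alpha = \sum_i k i *: (s i y).2 by have := congr1 snd ek; rewrite /= raddf_sum.
have : v = v - sharp Pi y alpha by rewrite sharp_ann ?subr0.
rewrite {2}e1 {1}e2 /sharp mulmx_suml -sumrB => ->; apply: eq_bigr => i _.
by rewrite scalerBr scalemxAl.
Qed.

Lemma normalH_decomp x (v : 'rV[R]_n) : exists h f, [/\ h \in normalH L x, f \in F & v = h + f].
Proof.
have [HF _] := Hc x; have : v \in (normalH L x + F)%VS by rewrite HF memvf.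
by move=> /memv_addP[h hH [f fF ->]]; exists h, f.
Qed.

(** A smooth frame of L gives smooth fields [w i] spanning H. Combinations of them with independent
    transverse parts at [x] keep this property nearby, and once normalized they are the rows of
    [(A, 1)]. *)
Lemma exists_represents c x : atlas c -> dom c x ->
  exists U A, U x /\ represents c U A.
Proof.
move=> ac dx; have [sub _ _] := HL; have [U0 [oU0 U0x [r [s [ss bs]]]]] := sub x.
pose U1 := U0 `&` dom c; have oU1 : open U1 by apply: openI => //; exact: dom_open.
have U1x : U1 x by [].
have oA := @open_img _ _ _ _ c _ oU1; set O := img c U1 in oA.
have subO : O `<=` img c U0 by apply: img_sub => z [].
have subOT : O `<=` img c setT by apply: img_sub.
pose w i y := (s i y).1 - sharp Pi y (s i y).2.
have wloc i y : dom c y -> vloc c (w i) (coord c y) =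
    vloc c (fst \o s i) (coord c y) -
    floc c (snd \o s i) (coord c y) *m biv_loc c Pi (coord c y).
  move=> dy; rewrite !(vloc_coord _ dy) (floc_coord _ dy) /biv_loc (coordK dy).
  by apply: sharp_algebra; exact: SmxK.
have sw i : smooth_on O (vloc c (w i)).
  have [sX sa] := ss i.
  have sX' := smooth_on_sub subO ((smooth_vfP _ oU0).1 sX c ac).
  have sa' := smooth_on_sub subO ((smooth_formP _ oU0).1 sa c ac).
  have [[_ sPi] _ _ _] := Hg.
  have sP := smooth_on_sub subOT (smooth_biv_loc sPi ac).
  apply: smooth_on_eq (smooth_onD oA sX' (smooth_on_opp oA (smooth_on_mulmx oA sa' sP))) => //.
  by move=> u /imgP[du _ eu]; rewrite -eu wloc.
pose W u : 'M[R]_(r, n) := \matrix_i vloc c (w i) u.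
have sW : smooth_on O W.
  apply/(smooth_on_mxP _ oA) => i j.
  apply: smooth_on_eq ((smooth_on_mxP _ oA).1 (sw i) 0 j) => // u _.
  by rewrite [RHS]mxE.
have wH y : U1 y -> forall i, w i y \in normalH L y.
  by move=> [U0y dy]; have [wH _] := normalH_span ac dy U0y (bs y U0y).
have WH y (k : 'rV_r) : U1 y -> k *m W (coord c y) *m Tmx c y \in normalH L y.
  move=> U1y; have [U0y dy] := U1y.
  have -> : k *m W (coord c y) *m Tmx c y = \sum_i k 0 i *: w i y.
    rewrite (mulmx_sum_row k) mulmx_suml; apply: eq_bigr => i _.
    by rewrite rowK -scalemxAl (vloc_coord _ dy) -mulmxA SmxK// mulmx1.
  by apply: memv_suml => i _; apply: memvZ; exact: wH.
(* As H and F together span, the transverse parts of H at [x], hence those of the [w i], fill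
   R^q. *)
have full (kap : 'rV_q) : exists k : 'rV_r, k *m rsubmx (W (coord c x)) = kap.
  have [h [f [hH fF e]]] := normalH_decomp x (row_mx 0 kap *m Tmx c x).
  have [_ /(_ _ hH)[k ek]] := normalH_span ac dx U0x (bs x U0x).
  exists (\row_i k i).
  have -> : kap = rsubmx (h *m Smx c x).
    have -> : h = row_mx 0 kap *m Tmx c x - f by rewrite e addrK.
    rewrite mulmxBl -mulmxA TmxK// mulmx1 linearB/= row_mxKr.
    by move: fF; rewrite (leaf_Smx _ ac dx) => /eqP ->; rewrite subr0.
  rewrite ek mulmx_rsub (mulmx_sum_row (\row_i k i)) mulmx_suml; congr rsubmx.
  by apply: eq_bigr => i _; rewrite rowK mxE (vloc_coord _ dx) scalemxAl.
have /choice[C0 eC0] := fun i : 'I_q => full (delta_mx 0 i).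
pose C : 'M[R]_(q, r) := \matrix_i C0 i.
have C1 : C *m rsubmx (W (coord c x)) = 1%:M.
  by apply/row_matrixP => i; rewrite row_mul rowK eC0 row1.
(* [C] makes [B] the identity at [x]. The determinant of [B] stays nonzero nearby, and the inverse
   of [B] normalizes the transverse parts to unit rows. *)
pose B u : 'M[R]_q := C *m rsubmx (W u).
have sB : smooth_on O B.
  apply: smooth_on_mulmx (smooth_on_cst C oA) _ => //.
  by apply: smooth_on_eq (smooth_on_mxsub id (@rshift p q) oA sW) => // u _; rewrite rsubmxEsub.
have Ox : O (coord c x) by exact: img_coord.
have ndet : \forall u \near coord c x, B u \in unitmx.
  have /differentiable_continuous cdet := smooth_on_differentiable (smooth_on_det oA sB) Ox.
  have nd0 : \forall t \near (\det (B (coord c x)) : R^o), t != 0.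
    apply: open_nbhs_nbhs; split; last by rewrite /B C1 det1 /= oner_neq0.
    exact: open_neq.
  have nd : \forall u \near coord c x, \det (B u) != 0 by exact: (cdet _ nd0).
  by apply: filterS nd => u; rewrite unitmxE unitfE.
have ndet' : \forall y \near x, B (coord c y) \in unitmx.
  exact: (coord_continuous_at dx ndet).
have [U2 [oU2 U2x] U2B] : exists2 U2, open_nbhs x U2 & U2 `<=` [set y | B (coord c y) \in unitmx].
  have nB : nbhs x [set y | B (coord c y) \in unitmx] := ndet'.
  by move: nB; rewrite nbhsE.
pose U := U1 `&` U2; have oU : open U by exact: openI.
have oU' := @open_img _ _ _ _ c _ oU.
have subU : img c U `<=` O by apply: img_sub => z [].
have uB u : img c U u -> B u \in unitmx by move=> /imgP[_ [_ /U2B] /= + eu]; rewrite eu.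
pose A u := invmx (B u) *m C *m lsubmx (W u).
have AW u : img c U u -> invmx (B u) *m C *m W u = row_mx (A u) 1%:M.
  move=> iu; rewrite -[LHS]hsubmxK -mulmx_lsub -mulmx_rsub -(mulmxA _ C (rsubmx _)).
  by rewrite mulVmx ?uB.
exists U, A; split=> //; split=> //.
- by move=> z [[]].
- have sB' := smooth_on_sub subU sB.
  have si := smooth_on_invmx oU' uB sB'.
  apply: smooth_on_mulmx (smooth_on_mulmx oU' si (smooth_on_cst C oU')) _ => //.
  apply: smooth_on_eq (smooth_on_mxsub id (@lshift p q) oU' (smooth_on_sub subU sW)) => // u _.
  by rewrite lsubmxEsub.
move=> y v Uy; have [[U0y dy] U2y] := Uy; have iy : img c U (coord c y) by exact: img_coord.
have rowH (k : 'rV_q) : k *m row_mx (A (coord c y)) 1%:M *m Tmx c y \in normalH L y.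
  by rewrite -AW// !mulmxA; apply: WH.
split=> [vH|e]; last first.
  by have := rowH (rsubmx (v *m Smx c y)); rewrite -e -mulmxA SmxK// mulmx1.
(* [v] and [v'] are both in H with the same transverse part, so their difference is in the
   intersection of H and F. *)
set k := rsubmx (v *m Smx c y); pose v' := k *m row_mx (A (coord c y)) 1%:M *m Tmx c y.
have v0 : v - v' = 0.
  apply: (@normalH_disjoint y); first by apply: memvB => //; exact: rowH.
  rewrite (leaf_Smx _ ac dy) mulmxBl linearB/= -/k /v' -(mulmxA _ (Tmx c y)) TmxK//.
  by rewrite mulmx1 mul_mx_row row_mxKr mulmx1 subrr.
have -> : v *m Smx c y = v' *m Smx c y by rewrite (subr0_eq v0).
by rewrite /v' -mulmxA TmxK// mulmx1.
Qed.

End Frame.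

(** * Matrix algebra of the local frame of L *)

Section FrameMatrices.
Context {R : realType} {p q : nat}.
Implicit Types (A DA : 'M[R]_(q, p)) (P DP : 'M[R]_p) (S DS : 'M[R]_q).

(** The rows of [frameV] and [frameF] are the vector and form parts of a frame of
    L, when H is spanned by the rows of [(A, 1)], Pi = [diag (P, 0)] and
    sigma = [diag (0, S)]. *)
Definition frameV A P : 'M[R]_(q + p, p + q) := block_mx A 1%:M P 0.
Definition frameF A S : 'M[R]_(q + p, p + q) := block_mx 0 S 1%:M (- A^T).

(** The entries are twice the values of [pair_g] on pairs of frame elements. *)
Lemma frame_isotropic A P S : P^T = - P -> S^T = - S ->
  frameV A P *m (frameF A S)^T + frameF A S *m (frameV A P)^T = 0.
Proof.
move=> aP aS; rewrite /frameV /frameF !tr_block_mx !mulmx_block !trmx0 !trmx1 aP aS.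
rewrite !(mulmx0, mul0mx, mul1mx, mulmx1, addr0, add0r) linearN/= trmxK.
by rewrite !subrr add_block_mx addNr !addr0 subrr block_mx0.
Qed.

(** The coefficients can be read off: [s] is the transverse part of [Z] and [l] the leaf part of
    [g]. Orthogonality to the frame determines the other two components. *)
Lemma frame_maximal A P S (Z g : 'rV[R]_(p + q)) : P^T = - P -> S^T = - S ->
  (forall k : 'rV_(q + p), pairing g (k *m frameV A P) + pairing (k *m frameF A S) Z = 0) ->
  exists k, Z = k *m frameV A P /\ g = k *m frameF A S.
Proof.
move=> aP aS orth; exists (row_mx (rsubmx Z) (lsubmx g)).
have : g *m (frameV A P)^T + Z *m (frameF A S)^T = 0.
  apply/rowP => i; have := orth (delta_mx 0 i).
  rewrite (pairingC _ Z) /pairing !trmx_mul !mulmxA trmx_delta -!colE mxE [X in _ + X]mxE => e.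
  by rewrite mxE [RHS]mxE.
rewrite /frameV /frameF !tr_block_mx !trmx0 !trmx1 aP aS linearN/= trmxK.
rewrite -{1}[g]hsubmxK -{1}[Z]hsubmxK !mul_row_block !(mulmx0, mulmx1, addr0, add0r).
rewrite add_row_mx -[RHS]row_mx0 => /eq_row_mx[e1 e2].
split.
  rewrite -[LHS]hsubmxK; congr row_mx; move: e2.
  by rewrite !mulmxN addrCA -opprD => /subr0_eq ->; rewrite addrC.
rewrite -[LHS]hsubmxK; congr row_mx; move: e1.
by rewrite !mulmxN => /subr0_eq <-; rewrite addrAC subrr add0r.
Qed.

(** The matrix of [(k, k') |-> <D_v e_k, e_k'>] for the frame [e] given by
    [frameV] and [frameF]. *)
Definition Qblock DA DP DS : 'M[R]_(q + p) := block_mx DS DA (- DA^T) DP.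

Lemma QblockE A P S DA DP DS : P^T = - P -> S^T = - S ->
  block_mx DA 0 DP 0 *m (frameF A S)^T + block_mx 0 DS 0 (- DA^T) *m (frameV A P)^T =
  Qblock DA DP DS.
Proof.
move=> aP aS; rewrite /frameV /frameF !tr_block_mx !mulmx_block !trmx0 !trmx1.
by rewrite !(mulmx0, mul0mx, mul1mx, mulmx1, addr0, add0r) add_block_mx !(addr0, add0r).
Qed.

Lemma Qblock_anti DA DP DS : DP^T = - DP -> DS^T = - DS ->
  (Qblock DA DP DS)^T = - Qblock DA DP DS.
Proof.
by move=> aP aS; rewrite /Qblock tr_block_mx opp_block_mx linearN/= trmxK opprK aP aS.
Qed.

(** The left-hand side is the pairing with a section [kr e] of the Courant
    bracket of two sections [ks e] and [kt e], all derivatives being expanded. *)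
Lemma courant_algebra n m (V F DVX DVY DVZ DFX DFY DFZ : 'M[R]_(m, n))
    (QX QY QZ : 'M[R]_m) (ks kt kr DXt DYs DZs : 'rV_m) (w : 'rV_n) :
  V *m F^T + F *m V^T = 0 ->
  DVX *m F^T + DFX *m V^T = QX -> DVY *m F^T + DFY *m V^T = QY ->
  DVZ *m F^T + DFZ *m V^T = QZ -> QY^T = - QY ->
  pairing (kr *m F) (DXt *m V + kt *m DVX - (DYs *m V + ks *m DVY)) +
  (pairing (DXt *m F + kt *m DFX) (kr *m V)
   + pairing (kt *m F) (DZs *m V + ks *m DVZ)
   - (pairing (DYs *m F + ks *m DFY) (kr *m V) + pairing (ks *m F) w)
   + (pairing (DZs *m F + ks *m DFZ) (kt *m V) + pairing (ks *m F) w)) =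
  bil QX kt kr + bil QY kr ks + bil QZ ks kt.
Proof.
move=> iso eX eY eZ antiY.
(* By isotropy of the frame the derivatives of the coefficients cancel in pairs, which is
   tensoriality. The vector [w] stands for the derivative of the second field along the third; it
   cancels between the Lie derivative and the exact term. *)
have cancel a b : pairing (a *m F) (b *m V) + pairing (b *m F) (a *m V) = 0.
  rewrite [X in _ + X]pairingC !pairing_mulmx -bilDm addrC iso.
  by rewrite /bil mulmx0 mul0mx mxE.
have main a b D D' : pairing (a *m F) (b *m D) + pairing (b *m D') (a *m V) =
    bil (D *m F^T + D' *m V^T) b a.
  by rewrite [X in X + _]pairingC !pairing_mulmx -bilDm.
have QY' : bil QY kr ks = - bil QY ks kr.
  by rewrite -bil_tr antiY /bil mulmxN mulNmx mxE.
rewrite QY' -eX -eY -eZ -!main pairingDr pairingNr !pairingDr !pairingDl opprD.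
have c1 := cancel kr DXt; have c2 := cancel kr DYs; have c3 := cancel kt DZs.
lra.
Qed.

End FrameMatrices.

Lemma differentiable_block (R : realType) (V : normedModType R) m1 m2 n1 n2
    (A : V -> 'M[R]_(m1, n1)) (B : V -> 'M[R]_(m1, n2)) (C : V -> 'M[R]_(m2, n1))
    (D : V -> 'M[R]_(m2, n2)) u v :
  differentiable A u -> differentiable B u -> differentiable C u -> differentiable D u ->
  differentiable (fun w => block_mx (A w) (B w) (C w) (D w)) u /\
  'D_v (fun w => block_mx (A w) (B w) (C w) (D w)) u =
  block_mx ('D_v A u) ('D_v B u) ('D_v C u) ('D_v D u).
Proof.
move=> dA dB dC dD; set G := fun w => _.
have GE i j : (fun w => G w i j : R^o) = match fintype.split i, fintype.split j with
    | inl i, inl j => fun w => A w i j | inl i, inr j => fun w => B w i j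
    | inr i, inl j => fun w => C w i j | inr i, inr j => fun w => D w i j end.
  apply/funext => w; rewrite /G; case: (splitP i) => i' ei; case: (splitP j) => j' ej.
  - have -> : i = lshift m2 i' by exact: val_inj.
    have -> : j = lshift n2 j' by exact: val_inj.
    by rewrite block_mxEul.
  - have -> : i = lshift m2 i' by exact: val_inj.
    have -> : j = rshift n1 j' by exact: val_inj.
    by rewrite block_mxEur.
  - have -> : i = rshift m1 i' by exact: val_inj.
    have -> : j = lshift n2 j' by exact: val_inj.
    by rewrite block_mxEdl.
  - have -> : i = rshift m1 i' by exact: val_inj.
    have -> : j = rshift n1 j' by exact: val_inj.
    by rewrite block_mxEdr.
have dG : differentiable G u.
  apply/differentiable_mxP => i j; rewrite GE.
  case: (fintype.split i) => i'; case: (fintype.split j) => j'.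
  - exact: (differentiable_mxP _ _).1 dA i' j'.
  - exact: (differentiable_mxP _ _).1 dB i' j'.
  - exact: (differentiable_mxP _ _).1 dC i' j'.
  - exact: (differentiable_mxP _ _).1 dD i' j'.
split=> //; apply/matrixP => i j; apply: etrans (derive_entry v i j dG) _.
rewrite GE; case: (splitP i) => i' ei; case: (splitP j) => j' ej.
- have -> : i = lshift m2 i' by exact: val_inj.
  have -> : j = lshift n2 j' by exact: val_inj.
  by rewrite block_mxEul; exact: esym (derive_entry v i' j' dA).
- have -> : i = lshift m2 i' by exact: val_inj.
  have -> : j = rshift n1 j' by exact: val_inj.
  by rewrite block_mxEur; exact: esym (derive_entry v i' j' dB).
- have -> : i = rshift m1 i' by exact: val_inj.
  have -> : j = lshift n2 j' by exact: val_inj.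
  by rewrite block_mxEdl; exact: esym (derive_entry v i' j' dC).
- have -> : i = rshift m1 i' by exact: val_inj.
  have -> : j = rshift n1 j' by exact: val_inj.
  by rewrite block_mxEdr; exact: esym (derive_entry v i' j' dD).
Qed.

Lemma conjugate_inv (R : realType) m n k (a : 'M[R]_(m, n)) (P S T : 'M_n) (B : 'M_(n, k)) :
  S *m T = 1%:M -> a *m P *m B = a *m S *m (T *m P *m B).
Proof. by move=> ST; rewrite !mulmxA -(mulmxA a S T) ST mulmx1. Qed.

Lemma mulmx_right_inj (R : realType) m n (a b : 'M[R]_(m, n)) (S T : 'M_n) :
  S *m T = 1%:M -> a *m S = b *m S -> a = b.
Proof. by move=> ST e; rewrite -[a]mulmx1 -[b]mulmx1 -ST !mulmxA e. Qed.

Lemma mulmx_cancel (R : realType) m n (a : 'M[R]_(m, n)) (S T : 'M_n) :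
  S *m T = 1%:M -> a *m S *m T = a.
Proof. by move=> ST; rewrite -mulmxA ST mulmx1. Qed.

(** * Membership in L through frame coefficients *)

Section LocalFrame.
Context {R : realType} {p q : nat} {M : foliated_manifold R p q}.
Local Notation n := (p + q)%N.
Local Notation fibre := ('rV[R]_n * 'rV[R]_n)%type.
Context (L : M -> {vspace fibre}) (sigma Pi : M -> 'M[R]_n).
Implicit Types (c : chart R n M) (U V : set M) (x y : M).
Hypotheses (Hg : geometric_data L sigma Pi).
Local Notation F := (tangF R p q).

Lemma Ploc_anti c u : (Ploc Pi c u)^T = - Ploc Pi c u.
Proof.
have [_ _ /(_ (param c u)) [anti _] _] := Hg.
rewrite /Ploc trmx_ulsub /biv_loc !trmx_mul trmxK anti mulNmx mulmxN mulmxA.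
by apply/matrixP => i j; rewrite !mxE.
Qed.

Lemma Sloc_anti c u : (Sloc sigma c u)^T = - Sloc sigma c u.
Proof.
have [_ /(_ (param c u)) [anti _] _ _] := Hg.
rewrite /Sloc trmx_drsub /form2_loc !trmx_mul trmxK anti mulNmx mulmxN mulmxA.
by apply/matrixP => i j; rewrite !mxE.
Qed.

Lemma smooth_Ploc c : atlas c -> smooth_on (img c setT) (Ploc Pi c).
Proof.
move=> ac; have [[_ sPi] _ _ _] := Hg; have oA := @open_img _ _ _ _ c _ openT.
apply: smooth_on_eq (smooth_on_mxsub (@lshift p q) (@lshift p q) oA (smooth_biv_loc sPi ac)) => //.
by move=> u _; rewrite /Ploc ulsubmxEsub.
Qed.

Lemma smooth_Sloc c : atlas c -> smooth_on (img c setT) (Sloc sigma c).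
Proof.
move=> ac; have [[ss _] _ _ _] := Hg; have oA := @open_img _ _ _ _ c _ openT.
apply: smooth_on_eq (smooth_on_mxsub (@rshift p q) (@rshift p q) oA (smooth_form2_loc ss ac)) => //.
by move=> u _; rewrite /Sloc drsubmxEsub.
Qed.

Lemma sharp_loc c y (a : 'rV[R]_n) : atlas c -> dom c y ->
  sharp Pi y a *m Smx c y = a *m (Tmx c y)^T *m biv_loc c Pi (coord c y).
Proof.
move=> ac dy; rewrite /sharp /biv_loc (coordK dy).
by apply: conjugate_inv; rewrite -trmx_mul SmxK// trmx1.
Qed.

Lemma flat_loc c y (v : 'rV[R]_n) : atlas c -> dom c y ->
  flat sigma y v *m (Tmx c y)^T = v *m Smx c y *m form2_loc c sigma (coord c y).
Proof.
move=> ac dy; rewrite /flat /form2_loc (coordK dy).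
by apply: conjugate_inv; exact: SmxK.
Qed.

Section Represented.
Context (c : chart R n M) (U : set M) (A : 'rV[R]_n -> 'M[R]_(q, p)).
Hypotheses (ac : atlas c) (rep : represents L c U A).
Local Notation fV u := (frameV (A u) (Ploc Pi c u)).
Local Notation fF u := (frameF (A u) (Sloc sigma c u)).

Lemma represents_dom y : U y -> dom c y.
Proof. by have [_ sub _ _] := rep; exact: sub. Qed.

Lemma represents_mem y (k : 'rV_q) : U y ->
  k *m row_mx (A (coord c y)) 1%:M *m Tmx c y \in normalH L y.
Proof.
move=> Uy; have [_ _ _ r] := rep; have dy := represents_dom Uy.
apply/r => //; set w := k *m _; have -> : w *m Tmx c y *m Smx c y = w.
  by rewrite -mulmxA TmxK// mulmx1.
by rewrite /w mul_mx_row row_mxKr !mulmx1 mul_mx_row mulmx1.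
Qed.

Lemma annH_loc y (a : 'rV[R]_n) : U y -> a \in annv (normalH L y) <->
  rsubmx (a *m (Tmx c y)^T) = - lsubmx (a *m (Tmx c y)^T) *m (A (coord c y))^T.
Proof.
move=> Uy; have dy := represents_dom Uy; set a' := a *m _.
have pairT (v : 'rV[R]_n) : pairing a (v *m Tmx c y) = pairing a' v.
  by rewrite /pairing trmx_mul mulmxA.
have pk (k : 'rV_q) : pairing a' (k *m row_mx (A (coord c y)) 1%:M) =
    pairing (lsubmx a' *m (A (coord c y))^T + rsubmx a') k.
  rewrite /pairing trmx_mul mulmxA tr_row_mx trmx1 -{1}[a']hsubmxK.
  by rewrite mul_row_col mulmx1.
split=> [/memv_ann aH|e].
  rewrite mulNmx; apply/eqP; rewrite -addr_eq0 addrC; apply/eqP/rowP => i.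
  have := aH _ (represents_mem (delta_mx 0 i) Uy); rewrite pairT pk /pairing.
  by rewrite trmx_delta -colE mxE => ->; rewrite mxE.
apply/memv_ann => v vH; have [_ _ _ r] := rep.
have -> : v = v *m Smx c y *m Tmx c y by rewrite -mulmxA SmxK// mulmx1.
rewrite (r _ _ Uy).1// pairT pk e mulNmx subrr /pairing mul0mx mxE.
by [].
Qed.

Lemma mem_L y (z : fibre) : U y -> z \in L y <->
  exists k : 'rV_(q + p), z.1 *m Smx c y = k *m fV (coord c y) /\
    z.2 *m (Tmx c y)^T = k *m fF (coord c y).
Proof.
move=> Uy; have dy := represents_dom Uy; have iy := img_coord dy I.
have [_ _ _ Lz] := Hg; have [_ _ _ r] := rep.
split=> [/Lz[v vH [a aH ->]]|[k [e1 e2]]].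
  (* The first half of [k] is the transverse part of the component in H, the second half the leaf
     part of the component in ann H. *)
  exists (row_mx (rsubmx (v *m Smx c y)) (lsubmx (a *m (Tmx c y)^T))); split.
    rewrite /= mulmxDl (sharp_loc _ ac dy) (biv_locE Hg ac iy).
    rewrite {1}((r _ _ Uy).1 vH) -{1}[a *m _]hsubmxK !mul_row_block mul_mx_row.
    by rewrite !(mulmx0, mulmx1, addr0, add0r) add_row_mx addr0.
  rewrite /= mulmxDl (flat_loc _ ac dy) (form2_locE Hg ac iy).
  rewrite -{1}[a *m _]hsubmxK ((annH_loc _ Uy).1 aH) -{1}[v *m _]hsubmxK.
  rewrite !mul_row_block !(mulmx0, mulmx1, addr0, add0r) add_row_mx add0r.
  by rewrite mulNmx mulmxN.
have [v vH vS] : exists2 v, v \in normalH L y &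
    v *m Smx c y = lsubmx k *m row_mx (A (coord c y)) 1%:M.
  exists (lsubmx k *m row_mx (A (coord c y)) 1%:M *m Tmx c y).
    exact: represents_mem.
  exact: mulmx_cancel (TmxK ac dy).
have [a aT] : exists a, a *m (Tmx c y)^T =
    row_mx (rsubmx k) (- rsubmx k *m (A (coord c y))^T).
  exists (row_mx (rsubmx k) (- rsubmx k *m (A (coord c y))^T) *m (Smx c y)^T).
  by apply: mulmx_cancel; rewrite -trmx_mul TmxK// trmx1.
apply/Lz; exists v => //.
exists a; first by apply/(annH_loc _ Uy); rewrite aT row_mxKr row_mxKl.
rewrite [LHS]surjective_pairing; congr pair.
  apply: (mulmx_right_inj (SmxK ac dy)).
  apply: etrans e1 _; apply: etrans _ (esym (mulmxDl _ _ _)).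
  rewrite (sharp_loc _ ac dy) (biv_locE Hg ac iy) vS aT.
  rewrite -{1}[k]hsubmxK !mul_row_block mul_mx_row.
  by rewrite !(mulmx0, mulmx1, addr0, add0r) add_row_mx addr0.
have TS : (Tmx c y)^T *m (Smx c y)^T = 1%:M by rewrite -trmx_mul SmxK// trmx1.
apply: (mulmx_right_inj TS).
apply: etrans e2 _; apply: etrans _ (esym (mulmxDl _ _ _)).
rewrite (flat_loc _ ac dy) (form2_locE Hg ac iy) vS aT.
rewrite -{1}[k]hsubmxK mul_mx_row !mul_row_block.
by rewrite !(mulmx0, mulmx1, addr0, add0r) add_row_mx add0r mulNmx mulmxN.
Qed.

End Represented.

End LocalFrame.

(** * The Courant tensor *)

Lemma derive_pairing (R : realType) (V : normedModType R) n (f g : V -> 'rV[R]_n) u v :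
  differentiable f u -> differentiable g u ->
  differentiable (fun w => pairing (f w) (g w) : R^o) u /\
  'D_v (fun w => pairing (f w) (g w) : R^o) u =
  pairing ('D_v f u) (g u) + pairing (f u) ('D_v g u).
Proof.
move=> df dg; have [dgT DgT] := derive_trmx v dg.
have dfg := differentiable_mulmx df dgT.
split; first exact: (differentiable_mxP _ _).1 dfg 0 0.
apply: etrans (esym (derive_entry v 0 0 dfg)) _.
apply: etrans (congr1 (fun B : 'M[R]_1 => B 0 0) (derive_mulmx v df dgT)) _.
by rewrite DgT mxE.
Qed.

Lemma bil_derive_const (R : realType) (V : normedModType R) n (B : V -> 'M[R]_n)
    (a b : V -> 'rV[R]_n) u v :
  differentiable B u -> differentiable a u -> differentiable b u ->
  'D_v a u = 0 -> 'D_v b u = 0 ->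
  differentiable (fun w => bil (B w) (a w) (b w) : R^o) u /\
  'D_v (fun w => bil (B w) (a w) (b w) : R^o) u = bil ('D_v B u) (a u) (b u).
Proof.
move=> dB da db a0 b0; have daB := differentiable_mulmx da dB.
have [d D] := derive_pairing v daB db; split; first exact: d.
apply: etrans D _; rewrite b0 pairing0r addr0 (derive_mulmx v da dB) a0 mul0mx add0r.
by [].
Qed.

Section CourantAt.
Context {R : realType} {p q : nat} {M : foliated_manifold R p q}.
Local Notation n := (p + q)%N.
Local Notation fibre := ('rV[R]_n * 'rV[R]_n)%type.
Context (L : M -> {vspace fibre}) (sigma Pi : M -> 'M[R]_n).
Hypotheses (Hg : geometric_data L sigma Pi).
Context (x : M) (U : set M) (A : 'rV[R]_n -> 'M[R]_(q, p)).
Local Notation c := (chart_at x).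
Local Notation u0 := (coord c x).
Hypotheses (rep : represents L c U A) (Ux : U x).
Local Notation P := (Ploc Pi c).
Local Notation S := (Sloc sigma c).
Local Notation fV := (fun u => frameV (A u) (P u)).
Local Notation fF := (fun u => frameF (A u) (S u)).

Let ac : atlas c := chart_at_atlas x.
Let dx : dom c x := chart_at_dom x.
Let oU : open U. Proof. by case: rep. Qed.

Lemma frame_diff : [/\ differentiable A u0, differentiable P u0 & differentiable S u0].
Proof.
have [_ _ sA _] := rep; split.
- exact: smooth_on_differentiable sA (img_coord dx Ux).
- exact: smooth_on_differentiable (smooth_Ploc Hg ac) (img_coord dx I).
- exact: smooth_on_differentiable (smooth_Sloc Hg ac) (img_coord dx I).
Qed.

Lemma frameV_diff v : differentiable fV u0 /\
  'D_v fV u0 = block_mx ('D_v A u0) 0 ('D_v P u0) 0.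
Proof.
have [dA dP _] := frame_diff.
have [d D] := differentiable_block v dA (differentiable_cst (1%:M : 'M[R]_q) u0) dP
  (differentiable_cst (0 : 'M[R]_(p, q)) u0).
by split=> //; apply: etrans D _; rewrite !derive_cst.
Qed.

Lemma frameF_diff v : differentiable fF u0 /\
  'D_v fF u0 = block_mx 0 ('D_v S u0) 0 (- ('D_v A u0)^T).
Proof.
have [dA _ dS] := frame_diff; have [dAT DAT] := derive_trmx v dA.
have dN : differentiable (fun u => - (A u)^T) u0 by exact: differentiableN dAT.
have DN : 'D_v (fun u => - (A u)^T) u0 = - ('D_v A u0)^T.
  by rewrite -DAT; exact: deriveN (diff_derivable dAT).
have [d D] := differentiable_block v (differentiable_cst (0 : 'M[R]_(q, p)) u0) dS
  (differentiable_cst (1%:M : 'M[R]_p) u0) dN.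
by split=> //; apply: etrans D _; rewrite !derive_cst DN.
Qed.

(** Because of the identity blocks of the frame, the coefficients of a section of L are among its
    components, so they inherit its smoothness without inverting the frame. *)
Definition coeffs (s : M -> fibre) (u : 'rV[R]_n) : 'rV[R]_(q + p) :=
  row_mx (rsubmx (vloc c (fst \o s) u)) (lsubmx (floc c (snd \o s) u)).

Lemma section_coeffs U' (s : M -> fibre) : open U' -> U' x -> section_of L U' s ->
  [/\ differentiable (coeffs s) u0,
      {near u0, (fun u => coeffs s u *m fV u) =1 vloc c (fst \o s)} &
      {near u0, (fun u => coeffs s u *m fF u) =1 floc c (snd \o s)}].
Proof.
move=> oU' U'x [[sX sa] sL].
have oA' := @open_img _ _ _ _ c _ oU'.
have dk : differentiable (coeffs s) u0.
  have sX' := (smooth_vfP _ oU').1 sX c ac; have sa' := (smooth_formP _ oU').1 sa c ac.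
  have s1 := smooth_on_mxsub id (@rshift p q) oA' sX'.
  have s2 := smooth_on_mxsub id (@lshift p q) oA' sa'.
  apply: smooth_on_differentiable (img_coord dx U'x).
  apply: smooth_on_eq (smooth_on_row_mx oA' s1 s2) => // u _.
  by rewrite /coeffs rsubmxEsub lsubmxEsub.
have near_k : \forall u \near u0, coeffs s u *m fV u = vloc c (fst \o s) u /\
    coeffs s u *m fF u = floc c (snd \o s) u.
  have := near_img (openI oU oU') dx (conj Ux U'x).
  apply: filterS => u /imgP[du [Uu U'u] eu].
  have [k [e1 e2]] := (mem_L Hg ac rep _ Uu).1 (sL _ U'u).
  rewrite eu in e1 e2.
  have -> : coeffs s u = k.
    rewrite /coeffs /vloc /floc /= e1 e2 -[k in RHS]hsubmxK -{1 2}[k]hsubmxK.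
    rewrite !mul_row_block !(mulmx0, mulmx1, addr0, add0r).
    by rewrite row_mxKr row_mxKl.
  by split; apply: esym; [exact: e1|exact: e2].
by split=> //; apply: filterS near_k => u [].
Qed.

Definition Qx (v : 'rV[R]_n) : 'M[R]_(q + p) := Qblock ('D_v A u0) ('D_v P u0) ('D_v S u0).

(** The value at [x] of the Courant tensor [<[a, b], d>] of [L]. *)
Definition tens (a b d : 'rV[R]_(q + p)) : R :=
  bil (Qx (a *m fV u0)) b d + bil (Qx (b *m fV u0)) d a + bil (Qx (d *m fV u0)) a b.

Lemma Qx_anti v : (Qx v)^T = - Qx v.
Proof.
have [_ dP dS] := frame_diff.
apply: Qblock_anti.
- have [_ <-] := derive_trmx v dP; rewrite -deriveN; last exact: diff_derivable.
  by apply: near_eq_derive; apply: filterE => u; rewrite (Ploc_anti Hg).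
- have [_ <-] := derive_trmx v dS; rewrite -deriveN; last exact: diff_derivable.
  by apply: near_eq_derive; apply: filterE => u; rewrite (Sloc_anti Hg).
Qed.

Lemma courant_pairing U' (s t : M -> fibre) (kr : 'rV_(q + p)) :
  open U' -> U' x -> section_of L U' s -> section_of L U' t ->
  pairing (kr *m fF u0) (courant s t x).1 + pairing (courant s t x).2 (kr *m fV u0) =
  tens (coeffs s u0) (coeffs t u0) kr.
Proof.
move=> oU' U'x Ls Lt.
have [dks nXs nas] := section_coeffs oU' U'x Ls.
have [dkt nXt nat] := section_coeffs oU' U'x Lt.
have [[sX sa] _] := Ls; have [[sY sb] _] := Lt.
set X := fst \o s in nXs sX; set a := snd \o s in nas sa.
set Y := fst \o t in nXt sY; set b := snd \o t in nat sb.
have dX := smooth_vf_diff ac oU' sX dx U'x; have dY := smooth_vf_diff ac oU' sY dx U'x.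
have da := smooth_form_diff ac oU' sa dx U'x; have db := smooth_form_diff ac oU' sb dx U'x.
have [dV _] := frameV_diff 0; have [dF _] := frameF_diff 0.
have DX v : 'D_v (vloc c X) u0 = 'D_v (coeffs s) u0 *m fV u0 + coeffs s u0 *m 'D_v fV u0.
  rewrite -(near_eq_derive v nXs); exact: (derive_mulmx v dks dV).
have DY v : 'D_v (vloc c Y) u0 = 'D_v (coeffs t) u0 *m fV u0 + coeffs t u0 *m 'D_v fV u0.
  rewrite -(near_eq_derive v nXt); exact: (derive_mulmx v dkt dV).
have Da v : 'D_v (floc c a) u0 = 'D_v (coeffs s) u0 *m fF u0 + coeffs s u0 *m 'D_v fF u0.
  rewrite -(near_eq_derive v nas); exact: (derive_mulmx v dks dF).
have Db v : 'D_v (floc c b) u0 = 'D_v (coeffs t) u0 *m fF u0 + coeffs t u0 *m 'D_v fF u0.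
  rewrite -(near_eq_derive v nat); exact: (derive_mulmx v dkt dF).
have X0 : X x = coeffs s u0 *m fV u0 by rewrite -vloc_id -(nbhs_singleton nXs).
have Y0 : Y x = coeffs t u0 *m fV u0 by rewrite -vloc_id -(nbhs_singleton nXt).
have a0 : a x = coeffs s u0 *m fF u0 by rewrite -floc_id -(nbhs_singleton nas).
have b0 : b x = coeffs t u0 *m fF u0 by rewrite -floc_id -(nbhs_singleton nat).
pose f := fun y => pairing (a y) (Y y) - pairing (b y) (X y).
have iso u : fV u *m (fF u)^T + fF u *m (fV u)^T = 0.
  exact: frame_isotropic (Ploc_anti Hg _ _) (Sloc_anti Hg _ _).
(* Isotropy of L near [x] gives beta(X) = - alpha(Y), so the function under the differential is
   twice alpha(Y), which absorbs the factor 1/2. *)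
have nf : {near u0, (fun u => 2 *: (pairing (floc c a u) (vloc c Y u) : R^o)) =1
    (f \o param c : _ -> R^o)}.
  have nim := near_img (openI oU oU') dx (conj Ux U'x).
  apply: filterS (filterI (filterI nXs nas) (filterI (filterI nXt nat) nim)).
  move=> u [[eX ea] [[eY eb] iu]]; have [du _ eu] := imgP iu.
  have e0 : pairing (floc c a u) (vloc c Y u) + pairing (floc c b u) (vloc c X u) = 0.
    apply: etrans (congr2 (fun r r' : R => r + r') (congr2 (@pairing R n) (esym ea) (esym eY))
      (congr2 (@pairing R n) (esym eb) (esym eX))) _.
    rewrite [X in _ + X]pairingC !pairing_mulmx -bilDm addrC iso.
    by rewrite /bil mulmx0 mul0mx mxE.
  rewrite /= /f !(pairing_loc _ _ ac du) eu scaler_nat mulr2n.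
  by congr (_ + _); apply/eqP; rewrite -addr_eq0 e0.
have [dp Dp] : differentiable (fun u => 2 *: (pairing (floc c a u) (vloc c Y u) : R^o)) u0 /\
    forall v, 'D_v (fun u => 2 *: (pairing (floc c a u) (vloc c Y u) : R^o)) u0 =
    2 * (pairing ('D_v (floc c a) u0) (Y x) + pairing (a x) ('D_v (vloc c Y) u0)).
  split; first by apply: differentiableZ; have [] := derive_pairing 0 da dY.
  move=> v; have [d D] := derive_pairing v da dY.
  apply: etrans (deriveZ 2 (diff_derivable d)) _.
  by rewrite D vloc_id floc_id.
have Df v : pairing (dfun f x) v =
    2 * (pairing ('D_v (floc c a) u0) (Y x) + pairing (a x) ('D_v (vloc c Y) u0)).
  apply: etrans (dfunE _ (near_eq_differentiable nf dp)) _.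
  by apply: etrans (esym (near_eq_derive v nf)) (Dp v).
have Lie Z b' v : differentiable (vloc c Z) u0 -> differentiable (floc c b') u0 ->
    pairing (lie_form Z b' x) v =
    pairing ('D_(Z x) (floc c b') u0) v + pairing (b' x) ('D_v (vloc c Z) u0).
  move=> dZ db'; rewrite (lie_formE dZ db') pairingDl (deriveEjacobian v dZ).
  by rewrite /pairing trmx_mul mulmxA.
set Z := kr *m fV u0.
have -> : pairing (courant s t x).2 Z =
    (pairing ('D_(X x) (floc c b) u0) Z + pairing (b x) ('D_Z (vloc c X) u0)) -
    (pairing ('D_(Y x) (floc c a) u0) Z + pairing (a x) ('D_Z (vloc c Y) u0)) +
    (pairing ('D_Z (floc c a) u0) (Y x) + pairing (a x) ('D_Z (vloc c Y) u0)).
  rewrite -(Lie _ _ _ dX db) -(Lie _ _ _ dY da) /= pairingDl pairingDl pairingNl pairingZl.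
  by rewrite Df mulKf// pnatr_eq0.
have -> : (courant s t x).1 = 'D_(X x) (vloc c Y) u0 - 'D_(Y x) (vloc c X) u0.
  exact: bracketE.
rewrite !DX !DY !Da !Db X0 Y0 a0 b0 /tens.
have QE v : 'D_v fV u0 *m (fF u0)^T + 'D_v fF u0 *m (fV u0)^T = Qx v.
  have [_ ->] := frameV_diff v; have [_ ->] := frameF_diff v.
  exact: QblockE (Ploc_anti Hg _ _) (Sloc_anti Hg _ _).
exact: (courant_algebra _ _ _ _ _ _ _ (iso u0) (QE _) (QE _) (QE _) (Qx_anti _)).
Qed.

End CourantAt.

Section DiracTensor.
Context {R : realType} {p q : nat} {M : foliated_manifold R p q}.
Local Notation n := (p + q)%N.
Local Notation fibre := ('rV[R]_n * 'rV[R]_n)%type.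
Context (L : M -> {vspace fibre}) (sigma Pi : M -> 'M[R]_n).
Hypotheses (Hg : geometric_data L sigma Pi).
Implicit Types (c : chart R n M) (U V : set M) (x y : M).

Definition frame_section c (A : 'rV[R]_n -> 'M[R]_(q, p)) (k : 'rV[R]_(q + p)) : M -> fibre :=
  fun y => (k *m frameV (A (coord c y)) (Ploc Pi c (coord c y)) *m Tmx c y,
            k *m frameF (A (coord c y)) (Sloc sigma c (coord c y)) *m (Smx c y)^T).

Lemma frame_section_vloc c U A k u : atlas c -> represents L c U A -> img c U u ->
  vloc c (fst \o frame_section c A k) u = k *m frameV (A u) (Ploc Pi c u).
Proof.
move=> ac rep /imgP[du Uu eu]; rewrite /vloc /= eu.
exact: mulmx_cancel (TmxK ac du).
Qed.

Lemma frame_section_floc c U A k u : atlas c -> represents L c U A -> img c U u ->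
  floc c (snd \o frame_section c A k) u = k *m frameF (A u) (Sloc sigma c u).
Proof.
move=> ac rep /imgP[du Uu eu]; rewrite /floc /= eu.
by apply: mulmx_cancel; rewrite -trmx_mul TmxK// trmx1.
Qed.

Lemma section_frame c U A k : atlas c -> represents L c U A ->
  section_of L U (frame_section c A k).
Proof.
move=> ac rep; have [oU Uc sA r] := rep; have oO := @open_img _ _ _ _ c _ oU.
have sub : img c U `<=` img c setT by exact: img_sub.
have sP := smooth_on_sub sub (smooth_Ploc Hg ac).
have sS := smooth_on_sub sub (smooth_Sloc Hg ac).
have sV := smooth_on_block oO sA (smooth_on_cst (1%:M : 'M[R]_q) oO) sP
  (smooth_on_cst (0 : 'M[R]_(p, q)) oO).
have sF := smooth_on_block oO (smooth_on_cst (0 : 'M[R]_(q, p)) oO) sS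
  (smooth_on_cst (1%:M : 'M[R]_p) oO) (smooth_on_opp oO (smooth_on_trmx oO sA)).
split; first split.
- apply: smooth_vf_local => // x Ux; exists c, U; split=> //; first exact: Uc.
  apply: smooth_on_eq (smooth_on_mulmx oO (smooth_on_cst k oO) sV) => // u iu.
  by rewrite (frame_section_vloc _ ac rep iu).
- apply: smooth_form_local => // x Ux; exists c, U; split=> //; first exact: Uc.
  apply: smooth_on_eq (smooth_on_mulmx oO (smooth_on_cst k oO) sF) => // u iu.
  by rewrite (frame_section_floc _ ac rep iu).
move=> y Uy; have dy := Uc _ Uy; apply/(mem_L Hg ac rep) => //; exists k; split.
  exact: mulmx_cancel (TmxK ac dy).
by apply: mulmx_cancel; rewrite -trmx_mul TmxK// trmx1.
Qed.

Lemma coeffs_frame_section x U A k : represents L (chart_at x) U A -> U x ->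
  coeffs x (frame_section (chart_at x) A k) (coord (chart_at x) x) = k.
Proof.
move=> rep Ux; have ac := chart_at_atlas x.
have iu : img (chart_at x) U (coord (chart_at x) x) by exact: img_coord (chart_at_dom x) Ux.
rewrite /coeffs (frame_section_vloc _ ac rep iu) (frame_section_floc _ ac rep iu).
rewrite -[k in RHS]hsubmxK -{1 2}[k]hsubmxK.
rewrite !mul_row_block !(mulmx0, mulmx1, addr0, add0r).
by rewrite row_mxKr row_mxKl.
Qed.

Lemma mem_L_center x U A (z : fibre) : represents L (chart_at x) U A -> U x ->
  z \in L x <-> exists k : 'rV_(q + p),
    z = (k *m frameV (A (coord (chart_at x) x)) (Ploc Pi (chart_at x) (coord (chart_at x) x)),
         k *m frameF (A (coord (chart_at x) x)) (Sloc sigma (chart_at x) (coord (chart_at x) x))).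
Proof.
move=> rep Ux; split=> [/(mem_L Hg (chart_at_atlas x) rep _ Ux)|] [k].
  rewrite Smx_id Tmx_id trmx1 !mulmx1 => -[e1 e2]; exists k.
  by rewrite [LHS]surjective_pairing e1 e2.
move=> ->; apply/(mem_L Hg (chart_at_atlas x) rep _ Ux); exists k.
by rewrite Smx_id Tmx_id trmx1 !mulmx1.
Qed.

Definition tensor_vanishes : Prop :=
  forall x U A, represents L (chart_at x) U A -> U x ->
  forall a b d, tens sigma Pi x A a b d = 0.

Lemma dirac_tensor : almost_dirac L -> coupling L -> dirac L <-> tensor_vanishes.
Proof.
move=> HL Hc; split=> [[_ closed] x U A rep Ux a b d|tens0].
  have [oU _ _ _] := rep; have ac := chart_at_atlas x.
  (* Sections with constant coefficients take any prescribed values in L at [x]. *)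
  have Ls := section_frame a ac rep; have Lt := section_frame b ac rep.
  have [_ Lc] := closed U oU _ _ Ls Lt.
  have := courant_pairing Hg rep Ux d oU Ux Ls Lt.
  rewrite !(coeffs_frame_section _ rep Ux) => <-.
  have rL := (mem_L_center _ rep Ux).2 (ex_intro _ d erefl).
  have [_ iso _] := HL; have := iso x _ _ (Lc _ Ux) rL.
  by move=> /eqP; rewrite mulf_eq0 invr_eq0 pnatr_eq0/= => /eqP.
split=> // U' oU' s t Ls Lt; split.
  by apply: smooth_section_courant => //; [case: Ls|case: Lt].
move=> x U'x; have [U [A [Ux rep]]] := exists_represents HL Hc Hg
  (chart_at_atlas x) (chart_at_dom x).
apply/(mem_L_center _ rep Ux).
have [k|k [e1 e2]] := frame_maximal (A := A (coord (chart_at x) x))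
    (Z := (courant s t x).1) (g := (courant s t x).2)
    (Ploc_anti Hg (chart_at x) (coord (chart_at x) x))
    (Sloc_anti Hg (chart_at x) (coord (chart_at x) x)).
  by rewrite addrC (courant_pairing Hg rep Ux k oU' U'x Ls Lt) (tens0 _ _ _ rep Ux).
by exists k; rewrite [LHS]surjective_pairing e1 e2.
Qed.

End DiracTensor.

Lemma add3_eq (R : realType) (a a' b b' d d' : R) : a = a' -> b = b' -> d = d' ->
  a + b + d = a' + b' + d'.
Proof. by move=> -> -> ->. Qed.

Lemma cyclic_sumD (R : realType) m n (f : 'rV[R]_n -> 'M[R]_m) (W : 'M[R]_(m, n)) a b d d' :
  (forall v w, f (v + w) = f v + f w) ->
  bil (f (a *m W)) b (d + d') + bil (f (b *m W)) (d + d') a + bil (f ((d + d') *m W)) a b =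
  bil (f (a *m W)) b d + bil (f (b *m W)) d a + bil (f (d *m W)) a b +
  (bil (f (a *m W)) b d' + bil (f (b *m W)) d' a + bil (f (d' *m W)) a b).
Proof.
move=> fD; rewrite mulmxDl fD bilDm bilDl bilDr.
by rewrite [RHS]addrACA; congr (_ + _); rewrite [RHS]addrACA.
Qed.

(** * Components of the tensor on the two halves of the frame *)

Section TensorParts.
Context {R : realType} {p q : nat} {M : foliated_manifold R p q}.
Local Notation n := (p + q)%N.
Local Notation fibre := ('rV[R]_n * 'rV[R]_n)%type.
Context (L : M -> {vspace fibre}) (sigma Pi : M -> 'M[R]_n).
Hypotheses (Hg : geometric_data L sigma Pi).
Context (x : M) (U : set M) (A : 'rV[R]_n -> 'M[R]_(q, p)).
Local Notation c := (chart_at x).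
Local Notation u0 := (coord c x).
Hypotheses (rep : represents L c U A) (Ux : U x).
Local Notation P := (Ploc Pi c).
Local Notation S := (Sloc sigma c).
Local Notation T := (tens sigma Pi x A).
Implicit Types (s t r : 'rV[R]_q) (l m k : 'rV[R]_p).

(** In the chart at [x], H is spanned by the fields [(s A, s)] for constant [s];
    [hvec s] is the value of such a field at [x]. *)
Definition hvec s : 'rV[R]_n := row_mx (s *m A u0) s.
Definition lvec l : 'rV[R]_n := row_mx l 0.
Definition Epart s : 'rV[R]_(q + p) := row_mx s 0.
Definition Gpart l : 'rV[R]_(q + p) := row_mx 0 l.

Lemma Epart_frameV s : Epart s *m frameV (A u0) (P u0) = hvec s.
Proof. by rewrite mul_row_block !(mulmx0, mulmx1, mul0mx, addr0). Qed.

Lemma Gpart_frameV l : Gpart l *m frameV (A u0) (P u0) = lvec (l *m P u0).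
Proof. by rewrite mul_row_block !(mulmx0, mulmx1, mul0mx, addr0, add0r). Qed.

Let bil0 := (mul0mx, @bil0l R, @bil0r R, @pairing0l R, @pairing0r R, addr0, add0r).

Lemma Qx_EE v s t : bil (Qx sigma Pi x A v) (Epart s) (Epart t) = bil ('D_v S u0) s t.
Proof. by rewrite bil_block !bil0. Qed.

Lemma Qx_EG v s l : bil (Qx sigma Pi x A v) (Epart s) (Gpart l) = pairing (s *m 'D_v A u0) l.
Proof. by rewrite bil_block !bil0. Qed.

Lemma Qx_GE v s l : bil (Qx sigma Pi x A v) (Gpart l) (Epart s) = - pairing (s *m 'D_v A u0) l.
Proof.
rewrite bil_block !bil0 mulmxN pairingNl; congr (- _).
by rewrite [RHS]pairingC /pairing trmx_mul mulmxA.
Qed.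

Lemma Qx_GG v l m : bil (Qx sigma Pi x A v) (Gpart l) (Gpart m) = bil ('D_v P u0) l m.
Proof. by rewrite bil_block !bil0. Qed.

Lemma tens_EEE s t r : T (Epart s) (Epart t) (Epart r) =
  bil ('D_(hvec s) S u0) t r + bil ('D_(hvec t) S u0) r s + bil ('D_(hvec r) S u0) s t.
Proof.
rewrite /tens (Epart_frameV s) (Epart_frameV t) (Epart_frameV r).
exact: (add3_eq (Qx_EE _ t r) (Qx_EE _ r s) (Qx_EE _ s t)).
Qed.

Lemma tens_EEG s t l : T (Epart s) (Epart t) (Gpart l) =
  pairing (t *m 'D_(hvec s) A u0) l - pairing (s *m 'D_(hvec t) A u0) l
  + bil ('D_(lvec (l *m P u0)) S u0) s t.
Proof.
rewrite /tens (Epart_frameV s) (Epart_frameV t) (Gpart_frameV l).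
exact: (add3_eq (Qx_EG _ t l) (Qx_GE _ s l) (Qx_EE _ s t)).
Qed.

Lemma tens_EGG s l m : T (Epart s) (Gpart l) (Gpart m) =
  bil ('D_(hvec s) P u0) l m - pairing (s *m 'D_(lvec (l *m P u0)) A u0) m
  + pairing (s *m 'D_(lvec (m *m P u0)) A u0) l.
Proof.
rewrite /tens (Epart_frameV s) (Gpart_frameV l) (Gpart_frameV m).
exact: (add3_eq (Qx_GG _ l m) (Qx_GE _ s m) (Qx_EG _ s l)).
Qed.

Lemma tens_GGG k l m : T (Gpart k) (Gpart l) (Gpart m) =
  bil ('D_(lvec (k *m P u0)) P u0) l m + bil ('D_(lvec (l *m P u0)) P u0) m k
  + bil ('D_(lvec (m *m P u0)) P u0) k l.
Proof.
rewrite /tens (Gpart_frameV k) (Gpart_frameV l) (Gpart_frameV m).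
exact: (add3_eq (Qx_GG _ l m) (Qx_GG _ m k) (Qx_GG _ k l)).
Qed.

(** Transfers additivity from the last argument to the other two. *)
Lemma tens_cycle a b d : T a b d = T b d a.
Proof. by rewrite /tens [RHS]addrC addrA. Qed.

Lemma QxD v w : Qx sigma Pi x A (v + w) = Qx sigma Pi x A v + Qx sigma Pi x A w.
Proof.
have [dA dP dS] := frame_diff Hg rep Ux.
by rewrite /Qx !deriveDr// /Qblock add_block_mx linearD/= opprD.
Qed.

Lemma tensD a b d d' : T a b (d + d') = T a b d + T a b d'.
Proof.
exact: (cyclic_sumD _ _ _ _ _ QxD).
Qed.

(** Splitting every argument by additivity leaves eight kinds of components, which form four orbits
    under cyclic permutation. *)
Lemma tens_parts :
  (forall s t r, T (Epart s) (Epart t) (Epart r) = 0) ->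
  (forall s t l, T (Epart s) (Epart t) (Gpart l) = 0) ->
  (forall s l m, T (Epart s) (Gpart l) (Gpart m) = 0) ->
  (forall k l m, T (Gpart k) (Gpart l) (Gpart m) = 0) ->
  forall a b d, T a b d = 0.
Proof.
move=> EEE EEG EGG GGG.
have split_row (a : 'rV[R]_(q + p)) : a = Epart (lsubmx a) + Gpart (rsubmx a).
  by rewrite add_row_mx addr0 add0r hsubmxK.
have H3 a b : (forall r, T a b (Epart r) = 0) -> (forall l, T a b (Gpart l) = 0) ->
    forall d, T a b d = 0.
  by move=> eE eG d; rewrite (split_row d) tensD eE eG addr0.
have H1 b d : (forall r, T (Epart r) b d = 0) -> (forall l, T (Gpart l) b d = 0) ->
    forall a, T a b d = 0.
  move=> eE eG a; rewrite tens_cycle; apply: H3 => [r|l]; rewrite -tens_cycle //.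
have H2 a d : (forall r, T a (Epart r) d = 0) -> (forall l, T a (Gpart l) d = 0) ->
    forall b, T a b d = 0.
  move=> eE eG b; rewrite -tens_cycle; apply: H3 => [r|l]; by rewrite tens_cycle.
move=> a b d; apply: H1 => [s|k]; apply: H2 => [t|l]; apply: H3 => [r|m] //.
- by rewrite -tens_cycle.
- by rewrite tens_cycle.
- by rewrite tens_cycle.
- by rewrite -tens_cycle.
Qed.

End TensorParts.

Lemma conjugate_inv2 (R : realType) m (B S T : 'M[R]_m) :
  S *m T = 1%:M -> S *m (T *m B *m T^T) *m S^T = B.
Proof.
by move=> ST; rewrite !mulmxA ST mul1mx -mulmxA -trmx_mul ST trmx1 mulmx1.
Qed.

(** * Projectable fields and the Poisson condition *)

Section Conditions.
Context {R : realType} {p q : nat} {M : foliated_manifold R p q}.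
Local Notation n := (p + q)%N.
Local Notation fibre := ('rV[R]_n * 'rV[R]_n)%type.
Context (L : M -> {vspace fibre}) (sigma Pi : M -> 'M[R]_n).
Hypotheses (Hc : coupling L) (Hg : geometric_data L sigma Pi).
Context (x : M) (U : set M) (A : 'rV[R]_n -> 'M[R]_(q, p)).
Local Notation c := (chart_at x).
Local Notation u0 := (coord c x).
Hypotheses (rep : represents L c U A) (Ux : U x).
Local Notation P := (Ploc Pi c).
Local Notation S := (Sloc sigma c).
Local Notation T := (tens sigma Pi x A).
Local Notation hvec := (hvec x A).
Local Notation F := (tangF R p q).

Let ac : atlas c := chart_at_atlas x.
Let dx : dom c x := chart_at_dom x.
Let oU : open U. Proof. by case: rep. Qed.
Let dA : differentiable A u0. Proof. by have [] := frame_diff Hg rep Ux. Qed.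
Let dP : differentiable P u0. Proof. by have [] := frame_diff Hg rep Ux. Qed.
Let dS : differentiable S u0. Proof. by have [] := frame_diff Hg rep Ux. Qed.

Lemma normalH_center (v : 'rV[R]_n) : v \in normalH L x <-> v = hvec (rsubmx v).
Proof.
have [_ _ _ r] := rep; have := r x v Ux; rewrite Smx_id mulmx1.
by rewrite mul_mx_row mulmx1.
Qed.

Lemma prHE (v : 'rV[R]_n) : prH L x v = hvec (rsubmx v).
Proof.
have [HF H0] := Hc x.
have vHF : v \in (normalH L x + F)%VS by rewrite HF memvf.
have vE := daddv_pi_add H0 vHF.
have hH : daddv_pi (normalH L x) F v \in normalH L x by exact: memv_pi.
have fF : daddv_pi F (normalH L x) v \in F by exact: memv_pi.
rewrite /prH [LHS](normalH_center _).1//; congr (hvec _).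
by rewrite -[in RHS]vE linearD/=; move/tangFP: fF => ->; rewrite row_mxKr addr0.
Qed.

Lemma prFE (v : 'rV[R]_n) : prF L x v = row_mx (lsubmx v - rsubmx v *m A u0) 0.
Proof.
have [HF H0] := Hc x.
have vHF : v \in (normalH L x + F)%VS by rewrite HF memvf.
have vE := daddv_pi_add H0 vHF.
have -> : prF L x v = v - prH L x v by rewrite -[X in X - _]vE addrAC subrr add0r.
rewrite prHE -{1}[v]hsubmxK; apply/rowP => i; rewrite -[i]splitK.
by case: (fintype.split i) => j; rewrite mxE [X in _ + X]mxE ?row_mxEl ?row_mxEr ?subrr mxE ?mxE.
Qed.

Lemma form2_loc_near : {near u0, (fun u => block_mx 0 0 0 (S u)) =1 form2_loc c sigma}.
Proof. by apply: filterS (near_img openT dx I) => u iu; rewrite (form2_locE Hg ac iu). Qed.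

Lemma biv_loc_near : {near u0, (fun u => block_mx (P u) 0 0 0) =1 biv_loc c Pi}.
Proof. by apply: filterS (near_img openT dx I) => u iu; rewrite (biv_locE Hg ac iu). Qed.

Lemma form2_loc_diff v : differentiable (form2_loc c sigma) u0 /\
  'D_v (form2_loc c sigma) u0 = block_mx 0 0 0 ('D_v S u0).
Proof.
have [d D] := differentiable_block v (differentiable_cst (0 : 'M[R]_(p, p)) u0)
  (differentiable_cst (0 : 'M[R]_(p, q)) u0) (differentiable_cst (0 : 'M[R]_(q, p)) u0) dS.
split; first exact: near_eq_differentiable form2_loc_near d.
by rewrite -(near_eq_derive v form2_loc_near); apply: etrans D _; rewrite !derive_cst.
Qed.

Lemma biv_loc_diff v : differentiable (biv_loc c Pi) u0 /\
  'D_v (biv_loc c Pi) u0 = block_mx ('D_v P u0) 0 0 0.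
Proof.
have [d D] := differentiable_block v dP (differentiable_cst (0 : 'M[R]_(p, q)) u0)
  (differentiable_cst (0 : 'M[R]_(q, p)) u0) (differentiable_cst (0 : 'M[R]_(q, q)) u0).
split; first exact: near_eq_differentiable biv_loc_near d.
by rewrite -(near_eq_derive v biv_loc_near); apply: etrans D _; rewrite !derive_cst.
Qed.

Lemma d'form2_tens u v w : d'form2 L sigma x u v w =
  T (Epart (rsubmx u)) (Epart (rsubmx v)) (Epart (rsubmx w)).
Proof.
rewrite /d'form2 !prHE tens_EEE dform2E; last by have [] := form2_loc_diff 0.
have D a b d : bil ('D_(hvec a) (form2_loc c sigma) u0) (hvec b) (hvec d) =
    bil ('D_(hvec a) S u0) b d.
  by have [_ ->] := form2_loc_diff (hvec a); rewrite bil_dr !row_mxKr.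
exact: (add3_eq (D _ _ _) (D _ _ _) (D _ _ _)).
Qed.

Lemma rsubmx_derive (f : 'rV[R]_n -> 'rV[R]_n) u v : differentiable f u ->
  differentiable (fun w => rsubmx (f w)) u /\
  'D_v (fun w => rsubmx (f w)) u = rsubmx ('D_v f u).
Proof. exact: derive_linear (@continuous_rsubmx R 1 p q). Qed.

Lemma lsubmx_derive (f : 'rV[R]_n -> 'rV[R]_n) u v : differentiable f u ->
  differentiable (fun w => lsubmx (f w)) u /\
  'D_v (fun w => lsubmx (f w)) u = lsubmx ('D_v f u).
Proof. exact: derive_linear (@continuous_lsubmx R 1 p q). Qed.

Lemma rsubmx_derive0 (f : 'rV[R]_n -> 'rV[R]_n) (s : 'rV[R]_q) u v :
  differentiable f u -> {near u, cst s =1 (fun w => rsubmx (f w))} ->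
  rsubmx ('D_v f u) = 0.
Proof.
move=> df ns; have [_ <-] := rsubmx_derive v df.
by rewrite -(near_eq_derive v ns) derive_cst.
Qed.

Lemma pairing_lvec (a : 'rV[R]_n) (l : 'rV[R]_p) : pairing a (lvec l) = pairing (lsubmx a) l.
Proof.
by rewrite /pairing -{1}[a]hsubmxK tr_row_mx mul_row_col trmx0 mulmx0 addr0.
Qed.

Section HField.
Context (U' : set M) (X : M -> 'rV[R]_n).
Hypotheses (oU' : open U') (U'x : U' x) (HX : sectionH_pr L U' X).

Lemma vlocX_diff : differentiable (vloc c X) u0.
Proof. by have [[sX _] _] := HX; exact: smooth_vf_diff ac oU' sX dx U'x. Qed.

(** Projectability is tested on the field [Y] with constant components [lvec l]: its bracket with
    [X] at [x] is the derivative of [X] along [l], and this must be tangent to F. *)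
Lemma projectable_derive (l : 'rV[R]_p) : rsubmx ('D_(lvec l) (vloc c X) u0) = 0.
Proof.
have [[sX _] pX] := HX; set V := U' `&` dom c; set Y := const_vf c (lvec l).
have oV : open V by apply: openI => //; exact: dom_open.
have sY : smooth_vf V Y by apply: smooth_vf_const => // y [].
have FY : sectionF V Y.
  split=> // y [_ dy]; rewrite (leaf_Smx _ ac dy) /Y const_vfE//.
  by rewrite (mulmx_cancel _ (TmxK ac dy)) row_mxKr.
have VU : V `<=` U' by move=> y [].
have [_ /(_ x (conj U'x dx))] := pX V Y oV VU FY.
have -> : bracket Y X x = 'D_(lvec l) (vloc c X) u0.
  rewrite bracketE {1}/Y const_vfE// Tmx_id mulmx1.
  rewrite (_ : 'D_(X x) (vloc c Y) u0 = 0) ?subr0//.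
  apply: etrans (derive_cst (lvec l) u0 (X x)); apply: near_eq_derive.
  by apply: filterS (near_img openT dx I) => u iu; exact: vloc_const_vf.
by rewrite memv_tangF => /eqP.
Qed.

Lemma vlocX_near : {near u0, (fun u => rsubmx (vloc c X u) *m A u) =1
  (fun u => lsubmx (vloc c X u))}.
Proof.
have [_ _ _ r] := rep; have [[_ XH] _] := HX.
apply: filterS (near_img (openI oU oU') dx (conj Ux U'x)) => u /imgP[du [Uu U'u] eu].
have := (r _ _ Uu).1 (XH _ U'u); rewrite eu -/(vloc c X u).
by rewrite mul_mx_row mulmx1 => {2}->; rewrite row_mxKl.
Qed.

Lemma lsubmx_vlocX v : lsubmx ('D_v (vloc c X) u0) =
  rsubmx ('D_v (vloc c X) u0) *m A u0 + rsubmx (X x) *m 'D_v A u0.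
Proof.
have dX := vlocX_diff; have [_ <-] := lsubmx_derive v dX.
rewrite -(near_eq_derive v vlocX_near); have [dr Dr] := rsubmx_derive v dX.
by apply: etrans (derive_mulmx v dr dA) _; rewrite Dr vloc_id.
Qed.

Lemma XxE : X x = hvec (rsubmx (X x)).
Proof. by apply/normalH_center; have [[_ XH] _] := HX; exact: XH. Qed.

Lemma Pi_center : Pi x = block_mx (P u0) 0 0 0.
Proof.
rewrite -(biv_locE Hg ac (img_coord dx I)) /biv_loc (coordK dx) Smx_id.
by rewrite trmx1 mul1mx mulmx1.
Qed.

Lemma lie_bivector_tens a b : lie_bivector X Pi x a b =
  T (Epart (rsubmx (X x))) (Gpart (lsubmx a)) (Gpart (lsubmx b)).
Proof.
have dX := vlocX_diff; have [dB DB] := biv_loc_diff (X x).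
rewrite (lie_bivectorE _ _ dX dB) DB Pi_center !bil_ul tens_EGG -XxE.
(* By projectability the derivative of [X] along a leaf vector [l] is a leaf vector, given by the
   derivative of [A] alone; [J] is the transpose of this. *)
have J a' l : pairing (lsubmx (a' *m ('J (vloc c X) u0)^T)) l =
    pairing (rsubmx (X x) *m 'D_(lvec l) A u0) (lsubmx a').
  have eD : lvec l *m 'J (vloc c X) u0 = lvec (rsubmx (X x) *m 'D_(lvec l) A u0).
    apply: etrans (esym (deriveEjacobian _ dX)) _.
    rewrite -[LHS]hsubmxK projectable_derive lsubmx_vlocX projectable_derive.
    by rewrite mul0mx add0r.
  by rewrite -pairing_lvec pairing_trmx eD pairing_lvec pairingC.
have e1 : bil (P u0) (lsubmx (a *m ('J (vloc c X) u0)^T)) (lsubmx b) =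
    - pairing (rsubmx (X x) *m 'D_(lvec (lsubmx b *m P u0)) A u0) (lsubmx a).
  by rewrite (bil_anti _ _ (Ploc_anti Hg c u0)) J.
have e2 : bil (P u0) (lsubmx a) (lsubmx (b *m ('J (vloc c X) u0)^T)) =
    pairing (rsubmx (X x) *m 'D_(lvec (lsubmx a *m P u0)) A u0) (lsubmx b).
  by rewrite -J pairingC.
rewrite e1 e2 opprK.
by rewrite [LHS]addrAC.
Qed.

End HField.

Lemma d''fun_pairing (f : M -> R) (v : 'rV[R]_n) :
  pairing (d''fun L f x) v = pairing (dfun f x) (prF L x v).
Proof.
rewrite [in RHS](row_sum_delta v) linear_sum /pairing linear_sum/= mulmx_sumr summxE mxE.
apply: eq_bigr => i _; rewrite linearZ [X in _ = X]/=.
have -> : (v 0 i *: prF L x (delta_mx 0 i))^T = v 0 i *: (prF L x (delta_mx 0 i))^T.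
  by rewrite linearZ.
by rewrite -scalemxAr [RHS]mxE mxE [v^T i 0]mxE mulrC.
Qed.

(** Both sides lie in F. Paired with a leaf covector [l], their difference is the mixed component of
    the tensor, [P] being moved from one factor to the other by antisymmetry. *)
Lemma cond3_tens U' X1 X2 : open U' -> U' x ->
  sectionH_pr L U' X1 -> sectionH_pr L U' X2 ->
  prF L x (bracket X1 X2 x) =
    sharp Pi x (d''fun L (fun y => bil (sigma y) (X1 y) (X2 y)) x) <->
  forall l, T (Epart (rsubmx (X1 x))) (Epart (rsubmx (X2 x))) (Gpart l) = 0.
Proof.
move=> oU' U'x H1 H2; set f := fun y => bil _ _ _.
set s1 := rsubmx (X1 x); set s2 := rsubmx (X2 x).
have d1 := vlocX_diff oU' U'x H1; have d2 := vlocX_diff oU' U'x H2.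
have r1 v := rsubmx_derive v d1; have r2 v := rsubmx_derive v d2.
(* Projection along H removes the derivatives of the transverse parts and leaves those of [A]. *)
have lhs : prF L x (bracket X1 X2 x) =
    lvec (s2 *m 'D_(hvec s1) A u0 - s1 *m 'D_(hvec s2) A u0).
  rewrite prFE bracketE !linearB/= (lsubmx_vlocX oU' U'x H2) (lsubmx_vlocX oU' U'x H1).
  rewrite -(XxE U'x H1) -(XxE U'x H2) -/s1 -/s2; congr row_mx.
  by rewrite mulmxBl opprD addrACA [LHS]addrAC subrr add0r.
have nf : {near u0, (fun u => bil (S u) (rsubmx (vloc c X1 u)) (rsubmx (vloc c X2 u)) : R^o) =1
    (f \o param c : _ -> R^o)}.
  apply: filterS (near_img openT dx I) => u iu; have [du _ eu] := imgP iu.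
  rewrite -bil_dr -(form2_locE Hg ac iu) /f /= /form2_loc /vloc bil_mulmx.
  by rewrite (conjugate_inv2 _ (SmxK ac du)).
(* On leaf vectors [d''] is the full differential, and the transverse parts of [X1] and [X2] have
   zero leafwise derivative, so only [S] is differentiated. *)
have rhs k : pairing (lsubmx (d''fun L f x)) k = bil ('D_(lvec k) S u0) s1 s2.
  rewrite -pairing_lvec d''fun_pairing prFE row_mxKl row_mxKr mul0mx subr0.
  have [] := bil_derive_const dS (r1 (lvec k)).1 (r2 (lvec k)).1
    (etrans (r1 _).2 (projectable_derive oU' U'x H1 k))
    (etrans (r2 _).2 (projectable_derive oU' U'x H2 k)).
  rewrite !vloc_id -/s1 -/s2 => d D.
  apply: etrans (dfunE _ (near_eq_differentiable nf d)) _.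
  have E := near_eq_derive (lvec k) nf.
  apply: etrans (esym E) _.
  apply: etrans D _.
  by [].
set w := s2 *m _ - _ in lhs; set d := lsubmx _ in rhs.
have shE : sharp Pi x (d''fun L f x) = lvec (d *m P u0).
  rewrite /sharp Pi_center -[d''fun L f x]hsubmxK mul_row_block.
  by rewrite !mulmx0 !addr0.
have TE l : T (Epart s1) (Epart s2) (Gpart l) = pairing (w - d *m P u0) l.
  rewrite tens_EEG -rhs /w !pairingDl !pairingNl; congr (_ + _).
  by have := bil_anti d l (Ploc_anti Hg c u0);
    rewrite -[bil _ _ _]/(pairing (d *m P u0) l) => ->; rewrite opprK.
rewrite lhs shE; split=> [/eq_row_mx[e _] l|T0].
  by rewrite TE e subrr pairing0l.
congr row_mx; apply/eqP; rewrite -subr_eq0; apply/eqP/rowP => i.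
have := T0 (delta_mx 0 i); rewrite TE /pairing trmx_delta -colE mxE => ->.
by rewrite mxE.
Qed.

Lemma projectable_frame s : let X := fst \o frame_section sigma Pi c A (Epart s) in
  sectionH_pr L U X /\ rsubmx (X x) = s.
Proof.
move=> X; have [sXL XL] := section_frame Hg (Epart s) ac rep; have [sX _] := sXL.
have Xloc u : img c U u -> vloc c X u = row_mx (s *m A u) s.
  move=> iu; rewrite (frame_section_vloc sigma Pi (Epart s) ac rep iu) mul_row_block.
  by rewrite !(mulmx0, mulmx1, mul0mx, addr0).
have Xr u : img c U u -> rsubmx (vloc c X u) = s by move=> iu; rewrite Xloc// row_mxKr.
have [_ Uc _ r] := rep.
split; last by rewrite -(vloc_id X x) Xr//; exact: img_coord.
split.
  split=> // y Uy; apply/r => //; have dy := Uc _ Uy.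
  rewrite -(vloc_coord X dy) Xloc ?row_mxKr ?mul_mx_row ?mulmx1//.
  exact: img_coord.
move=> V Y oV VU [sY FY]; have sXV : smooth_vf V X.
  apply/(smooth_vfP _ oV) => c' ac'.
  exact: smooth_on_sub (img_sub VU) ((smooth_vfP _ oU).1 sX c' ac').
split; first exact: smooth_vf_bracket.
move=> y Vy; have dy := Uc _ (VU _ Vy).
rewrite (leaf_Smx _ ac dy) (bracket_loc ac dy oV Vy sY sXV) linearB/=.
have dX := smooth_vf_diff ac oV sXV dy Vy; have dY := smooth_vf_diff ac oV sY dy Vy.
(* In the chart the transverse part of [X] is the constant [s] and that of [Y] is 0, so neither
   derivative in the bracket has a transverse part. *)
have nX : {near coord c y, cst s =1 (fun u => rsubmx (vloc c X u))}.
  by apply: filterS (near_img oV dy Vy) => u iu; rewrite Xr//; exact: img_sub iu.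
have nY : {near coord c y, cst (0 : 'rV[R]_q) =1 (fun u => rsubmx (vloc c Y u))}.
  apply: filterS (near_img oV dy Vy) => u /imgP[du Vu eu].
  by have := FY _ Vu; rewrite (leaf_Smx _ ac du) => /eqP.
have eX := rsubmx_derive0 (vloc c Y (coord c y)) dX nX.
have eY := rsubmx_derive0 (vloc c X (coord c y)) dY nY.
rewrite -(deriveEjacobian _ dX) -(deriveEjacobian _ dY).
by rewrite eX eY subrr.
Qed.

End Conditions.

(** * The Jacobi identity along the leaves *)

Lemma near_eq_grad (R : realType) n (f g : 'rV[R]_n -> R^o) u :
  {near u, f =1 g} -> grad f u = grad g u.
Proof. by move=> fg; apply/rowP => i; rewrite !mxE; exact: near_eq_derive. Qed.

Lemma smooth_on_grad (R : realType) n (A : set 'rV[R]_n) (f : 'rV[R]_n -> R^o) : open A ->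
  smooth_on A f -> smooth_on A (grad f).
Proof.
move=> oA sf; apply/(smooth_on_mxP _ oA) => i j.
by apply: smooth_on_eq (smooth_on_derive (delta_mx 0 j) sf) => // u _; rewrite mxE.
Qed.

Lemma hessian_sym (R : realType) n (A : set 'rV[R]_n) (f : 'rV[R]_n -> R^o) u v w : open A ->
  smooth_on A f -> A u -> pairing ('D_v (grad f) u) w = pairing ('D_w (grad f) u) v.
Proof.
move=> oA sf Au; have dg := smooth_on_differentiable (smooth_on_grad oA sf) Au.
have H v' w' : pairing ('D_v' (grad f) u) w' = 'D_v' ('D_w' f) u.
  have [_ D] := derive_pairing v' dg (differentiable_cst w' u).
  rewrite derive_cst pairing0r addr0 in D; rewrite -D.
  apply: near_eq_derive; apply: (open_near oA Au) => y Ay.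
  by rewrite -gradE//; exact: smooth_on_differentiable sf Ay.
apply: etrans (H v w) (etrans _ (esym (H w v))).
exact: smooth_on_swap_scalar oA sf Au.
Qed.

(** The [p] and [q] are Hessian terms: that of each function occurs twice, with opposite signs. *)
Lemma cyclic_cancel (R : realType) (x1 x2 x3 p1 p2 p3 q1 q2 q3 : R) :
  p1 = q3 -> q1 = p2 -> q2 = p3 ->
  x1 - p1 + q1 + (x2 - p2 + q2) + (x3 - p3 + q3) = x1 + x2 + x3.
Proof. by move=> -> -> ->; lra. Qed.

(* The second derivatives of [f], [g], [h] cancel by symmetry of the Hessians. *)
Lemma jacobiator_algebra (R : realType) n (O : set 'rV[R]_n) (P : 'rV[R]_n -> 'M[R]_n)
    (f g h : 'rV[R]_n -> R^o) t : open O -> O t -> (forall u, (P u)^T = - P u) ->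
  differentiable P t -> smooth_on O f -> smooth_on O g -> smooth_on O h ->
  let br a b u := bil (P u) (grad a u) (grad b u) : R^o in
  let a := grad f t in let b := grad g t in let d := grad h t in
  br f (br g h) t + br g (br h f) t + br h (br f g) t =
  bil ('D_(a *m P t) P t) b d + bil ('D_(b *m P t) P t) d a + bil ('D_(d *m P t) P t) a b.
Proof.
move=> oO Ot anti dP sf sg sh br a b d.
have dgr k : smooth_on O k -> differentiable (grad k) t.
  by move=> sk; exact: smooth_on_differentiable (smooth_on_grad oO sk) Ot.
have main k l : smooth_on O k -> smooth_on O l -> forall v,
    differentiable (br k l) t /\ 'D_v (br k l) t =
    bil ('D_v P t) (grad k t) (grad l t) - pairing ('D_v (grad k) t) (grad l t *m P t)
    + pairing ('D_v (grad l) t) (grad k t *m P t).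
  move=> sk sl v; have dk := dgr _ sk; have dl := dgr _ sl.
  have dkP := differentiable_mulmx dk dP.
  have [D1 D2] := derive_pairing v dkP dl; split; first exact: D1.
  apply: etrans D2 _; rewrite (derive_mulmx v dk dP) pairingDl.
  rewrite [X in X + _ + _](bil_anti _ _ (anti t)) [X in _ + X]pairingC.
  by congr (_ + _); rewrite addrC.
have brE k l m : smooth_on O l -> smooth_on O m ->
    br k (br l m) t = 'D_(grad k t *m P t) (br l m) t.
  by move=> sl sm; have [dlm _] := main _ _ sl sm 0; rewrite (gradE _ dlm) pairingC.
have e1 := etrans (brE f g h sg sh) (main g h sg sh (a *m P t)).2.
have e2 := etrans (brE g h f sh sf) (main h f sh sf (b *m P t)).2.
have e3 := etrans (brE h f g sf sg) (main f g sf sg (d *m P t)).2.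
apply: etrans (add3_eq e1 e2 e3) _.
have ef := hessian_sym (b *m P t) (d *m P t) oO sf Ot.
have eg := hessian_sym (a *m P t) (d *m P t) oO sg Ot.
have eh := hessian_sym (a *m P t) (b *m P t) oO sh Ot.
exact: cyclic_cancel eg eh ef.
Qed.

Section LeafPoisson.
Context {R : realType} {p q : nat} {M : foliated_manifold R p q}.
Local Notation n := (p + q)%N.
Local Notation fibre := ('rV[R]_n * 'rV[R]_n)%type.
Context (L : M -> {vspace fibre}) (sigma Pi : M -> 'M[R]_n).
Hypotheses (Hg : geometric_data L sigma Pi).
Implicit Types (c : chart R n M) (x y : M) (f g h : M -> R).

Definition slice_at (s : 'rV[R]_q) (t : 'rV[R]_p) : 'rV[R]_n := row_mx t s.

Lemma slice_at_diff s t v : differentiable (slice_at s) t /\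
  'D_v (slice_at s) t = lvec v.
Proof.
have E : slice_at s = fun t => t *m row_mx 1%:M 0 + row_mx 0 s.
  apply/funext => t'; rewrite mul_mx_row mulmx1 mulmx0 add_row_mx.
  by rewrite addr0 add0r.
have dI : differentiable (fun t : 'rV[R]_p => t) t by [].
have dC := differentiable_cst (row_mx 1%:M 0 : 'M[R]_(p, p + q)) t.
have dM := differentiable_mulmx dI dC.
have DM : 'D_v (fun t : 'rV[R]_p => t *m row_mx 1%:M 0) t = lvec v :> 'rV[R]_n.
  apply: etrans (derive_mulmx v dI dC) _.
  by rewrite derive_cst mulmx0 addr0 derive_id mul_mx_row mulmx1 mulmx0.
rewrite E; split; first exact: differentiableD dM (differentiable_cst _ t).
apply: etrans (deriveD (diff_derivable dM) (derivable_cst _ t v)) _.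
by rewrite DM derive_cst addr0.
Qed.

Lemma slice_at_near s t (B : set 'rV[R]_n) : nbhs (slice_at s t) B ->
  \forall t' \near t, B (slice_at s t').
Proof.
have [d _] := slice_at_diff s t 0 => nB.
exact: (differentiable_continuous d nB).
Qed.

Lemma Pi_block y : Pi y = block_mx (ulsubmx (Pi y)) 0 0 0.
Proof.
have ay := chart_at_atlas y; have dy := chart_at_dom y.
have := biv_locE Hg ay (img_coord dy I).
rewrite /biv_loc (coordK dy) Smx_id trmx1 mul1mx mulmx1 => e.
by rewrite {2}e block_mxKul.
Qed.

Section AtPoint.
Context (x : M).
Local Notation c := (chart_at x).
Local Notation u0 := (coord c x).
Local Notation t0 := (leaf_coord x).
Local Notation s0 := (rsubmx u0).
Let ac : atlas c := chart_at_atlas x.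
Let dx : dom c x := chart_at_dom x.

Lemma slice_at0 : slice_at s0 t0 = u0.
Proof. by rewrite /slice_at hsubmxK. Qed.

(** The restriction of [f] to the leaf of [x], extended constantly across the
    plaques of [chart_at x]; this makes the invariance of [dfun] available. *)
Definition leaf_ext f : M -> R := fun z => f (leaf_param x (lsubmx (coord c z))).

(** Along the slice of [chart_at y], the transverse coordinates in [chart_at x] keep the value [s0]
    by [transition_foliated], so [f] and its extension agree there near [y]. *)
Lemma leaf_dfun_ext f t : img c setT (slice_at s0 t) ->
  leaf_dfun f (leaf_param x t) = leaf_dfun (leaf_ext f) (leaf_param x t).
Proof.
move=> /imgP; set y := leaf_param x t; rewrite -/(leaf_param x t) -/y => -[dy _ ey].
have ay := chart_at_atlas y; have dyy := chart_at_dom y; set cy := chart_at y in ay dyy *.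
have [|B nB fol] := @transition_foliated _ _ _ M cy c ay ac (coord cy y).
  exact: img_coord.
apply/rowP => i; rewrite !mxE; apply: near_eq_derive.
set sy := rsubmx (coord cy y).
have ey' : slice_at sy (leaf_coord y) = coord cy y by rewrite /slice_at hsubmxK.
have nB' : \forall t' \near leaf_coord y, B (slice_at sy t').
  by apply: slice_at_near; rewrite ey'.
have nI : \forall t' \near leaf_coord y, img cy (dom c) (slice_at sy t').
  by apply: slice_at_near; rewrite ey'; exact: near_img (@dom_open _ _ _ c) dyy dy.
apply: filterS (filterI nB' nI) => t' [Bt' /imgP[_ dz _]].
have rz : rsubmx (coord c (leaf_param y t')) = s0.
  have := fol _ _ Bt' (nbhs_singleton nB); rewrite row_mxKr => /(_ erefl) ->.
  by rewrite (coordK dyy) ey row_mxKr.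
rewrite /= /leaf_ext {2}/leaf_param -rz hsubmxK coordK//.
Qed.

(** [G] is the gradient of the extension in [chart_at x]. The extension depends on the leaf
    coordinates alone, through [f \o leaf_param x]. *)
Lemma leaf_ext_loc f (O : set 'rV[R]_p) t : open O -> O t ->
  smooth_on O (f \o leaf_param x : _ -> R^o) -> img c setT (slice_at s0 t) ->
  exists2 G : 'rV[R]_n, dfun (leaf_ext f) (leaf_param x t) =
      G *m (Smx c (leaf_param x t))^T &
    lsubmx G = grad (f \o leaf_param x) t.
Proof.
move=> oO Ot sf iu; have [dy _ ey] := imgP iu.
set y := param c _ in dy ey; set fx := f \o leaf_param x in sf *.
have ne : {near slice_at s0 t, (fun u => fx (lsubmx u) : R^o) =1
    (leaf_ext f \o param c : _ -> R^o)}.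
  have nim := near_img openT dy I; rewrite ey in nim.
  by apply: filterS nim => u /imgP[_ _ eu]; rewrite /= /leaf_ext eu.
have dl : differentiable (lsubmx : 'rV[R]_n -> 'rV[R]_p) (slice_at s0 t).
  exact: differentiable_lsubmx.
have df : differentiable (fx : _ -> R^o) (lsubmx (slice_at s0 t)).
  by rewrite row_mxKl; exact: smooth_on_differentiable sf Ot.
have dc := differentiable_comp dl df.
have dext := near_eq_differentiable (W := R^o) ne dc.
exists (grad (leaf_ext f \o param c) (slice_at s0 t)).
  by rewrite -[leaf_param x t]/y (dfun_loc (f := leaf_ext f) ac dy) ey.
apply/rowP => i; rewrite mxE [RHS]mxE mxE.
apply: etrans (esym (near_eq_derive (W := R^o) _ ne)) _.
apply: etrans (derive_comp _ dl df) _; rewrite row_mxKl.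
have [_ Dl] := derive_linear (delta_mx 0 (lshift q i)) (@continuous_lsubmx R 1 p q)
  (ex_diff (is_diff_def := is_diff_id (slice_at s0 t))).
have El : lsubmx (delta_mx 0 (lshift q i) : 'rV[R]_n) = delta_mx 0 i.
  by apply/rowP => j; rewrite !mxE eqxx /= (inj_eq (@lshift_inj p q)).
have -> : 'D_(delta_mx 0 (lshift q i)) (lsubmx : 'rV[R]_n -> 'rV[R]_p) (slice_at s0 t) =
    delta_mx 0 i.
  by apply: etrans Dl _; rewrite derive_id; exact: El.
by [].
Qed.

(** The bracket is defined point by point through [chart_at]; to be differentiated again it must be
    expressed along the leaf in the one chart [chart_at x]. Only the leaf parts of the gradients
    survive, as Pi is supported on F. *)
Lemma leaf_bracket_local f g (O : set 'rV[R]_p) : open O -> O t0 ->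
  smooth_on O (f \o leaf_param x : _ -> R^o) ->
  smooth_on O (g \o leaf_param x : _ -> R^o) ->
  {near t0, (fun t => bil (Ploc Pi c (slice_at s0 t)) (grad (f \o leaf_param x) t)
                          (grad (g \o leaf_param x) t) : R^o) =1
            (leaf_poisson_bracket Pi f g \o leaf_param x : _ -> R^o)}.
Proof.
move=> oO Ot sf sg.
have nI : \forall t \near t0, img c setT (slice_at s0 t).
  by apply: slice_at_near; rewrite slice_at0; exact: near_img openT dx I.
have nO : \forall t \near t0, O t by exact: open_nbhs_nbhs.
apply: filterS (filterI nI nO) => t [iu Oxt]; have [dy _ ey] := imgP iu.
set y := leaf_param x t.
have Ef := etrans (leaf_dfun_ext f iu) (leaf_dfunE _ _).
have Eg := etrans (leaf_dfun_ext g iu) (leaf_dfunE _ _).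
have [Gf ef lf] := leaf_ext_loc oO Oxt sf iu; have [Gg eg lg] := leaf_ext_loc oO Oxt sg iu.
have E : leaf_poisson_bracket Pi f g y = bil (ulsubmx (Pi y))
    (lsubmx (Gf *m (Smx c y)^T)) (lsubmx (Gg *m (Smx c y)^T)).
  by rewrite /leaf_poisson_bracket Ef Eg ef eg.
apply: etrans _ (esym E); rewrite -lf -lg -[RHS]bil_ul -Pi_block bil_mulmx trmxK.
have -> : (Smx c y)^T *m Pi y *m Smx c y = biv_loc c Pi (slice_at s0 t) by [].
by rewrite (biv_locE Hg ac iu) bil_ul.
Qed.

Context (U : set M) (A : 'rV[R]_n -> 'M[R]_(q, p)).
Hypotheses (rep : represents L c U A) (Ux : U x).

Lemma leaf_jacobi f g h (O : set 'rV[R]_p) : open O -> O t0 ->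
  smooth_on O (f \o leaf_param x : _ -> R^o) ->
  smooth_on O (g \o leaf_param x : _ -> R^o) ->
  smooth_on O (h \o leaf_param x : _ -> R^o) ->
  let br := leaf_poisson_bracket Pi in
  br f (br g h) x + br g (br h f) x + br h (br f g) x =
  tens sigma Pi x A (Gpart (leaf_dfun f x)) (Gpart (leaf_dfun g x)) (Gpart (leaf_dfun h x)).
Proof.
move=> oO Ot sf sg sh br; set Pl := fun t => Ploc Pi c (slice_at s0 t).
have [_ dP _] := frame_diff Hg rep Ux.
have [ds _] := slice_at_diff s0 t0 0.
have dP' : differentiable (Ploc Pi c) (slice_at s0 t0) by rewrite slice_at0.
have dPl : differentiable Pl t0 := differentiable_comp ds dP'.
have DPl v : 'D_v Pl t0 = 'D_(lvec v) (Ploc Pi c) u0.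
  have [_ D] := slice_at_diff s0 t0 v.
  by apply: etrans (derive_comp v ds dP') _; rewrite D slice_at0.
have P0 : Pl t0 = Ploc Pi c u0 by rewrite /Pl slice_at0.
have uP : ulsubmx (Pi x) = Ploc Pi c u0.
  by rewrite /Ploc /biv_loc (coordK dx) Smx_id trmx1 mul1mx mulmx1.
pose brl a b t := bil (Pl t) (grad a t) (grad b t) : R^o.
have step a b d : smooth_on O (b \o leaf_param x : _ -> R^o) ->
    smooth_on O (d \o leaf_param x : _ -> R^o) ->
    br a (br b d) x = brl (a \o leaf_param x) (brl (b \o leaf_param x) (d \o leaf_param x)) t0.
  move=> sb sd; have E : leaf_dfun (br b d) x =
      grad (brl (b \o leaf_param x) (d \o leaf_param x)) t0.
    exact: esym (near_eq_grad (leaf_bracket_local oO Ot sb sd)).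
  exact: (congr2 (fun B w => bil B (leaf_dfun a x) w) (etrans uP (esym P0)) E).
apply: etrans (add3_eq (step f g h sg sh) (step g h f sh sf) (step h f g sf sg)) _.
apply: etrans (jacobiator_algebra oO Ot _ dPl sf sg sh) _.
  by move=> t; exact: Ploc_anti Hg _ _.
rewrite tens_GGG !DPl P0.
by [].
Qed.

End AtPoint.
End LeafPoisson.

(** * Leaf topology and test functions on leaves *)

Section LeafFunctions.
Context {R : realType} {p q : nat} {M : foliated_manifold R p q}.
Local Notation n := (p + q)%N.
Implicit Types (c : chart R n M) (x y : M).

(** A nearby point of the slice of [chart_at y] is joined to [y] by a segment of that slice inside
    the chart; it is therefore on the plaque through [y], and so on the leaf. *)
Lemma leaf_open_chart x c : atlas c -> leaf_open (leaf x) (leaf x `&` dom c).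
Proof.
move=> ac; split=> [y []//|y [lxy dy]].
have ay := chart_at_atlas y; have dyy := chart_at_dom y; set cy := chart_at y in ay dyy.
set sy := rsubmx (coord cy y).
have ey : slice_at sy (leaf_coord y) = coord cy y by rewrite /slice_at hsubmxK.
have nI : \forall t \near leaf_coord y, img cy (dom c) (slice_at sy t).
  by apply: slice_at_near; rewrite ey; exact: near_img (@dom_open _ _ _ c) dyy dy.
have /nbhs_ballP[e e0 be] := nI.
apply/nbhs_ballP; exists e => // t te; have /imgP[dz dcz ez] := be _ te.
split; last exact: dcz.
move=> S Sx Spl; apply: (Spl cy y ay dyy (lxy S Sx Spl)); split; first exact: dz.
pose l (r : R) := leaf_coord y + r *: (t - leaf_coord y).
have l0 : slice_at sy (l 0) = coord cy y by rewrite /l scale0r addr0.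
have l1 : slice_at sy (l 1) = slice_at sy t by rewrite /l scale1r addrC subrK.
have lc : continuous (fun r => slice_at sy (l r)).
  move=> r; apply: (@continuous_comp _ _ _ l (slice_at sy)); last first.
    by have [/differentiable_continuous] := slice_at_diff sy (l r) 0.
  have dZ : differentiable (fun r : R => r *: (t - leaf_coord y)) r.
    exact: differentiableZl.
  exact: differentiable_continuous (differentiableD (differentiable_cst (leaf_coord y) r) dZ).
have in01 (r : R) : r = 0 \/ r = 1 -> `[0, 1]%classic r.
  by case=> ->; rewrite /= in_itv /= lexx ler01.
exists ((fun r => slice_at sy (l r)) @` `[0, 1]%classic).
  split.
  - by exists 0; [exact: in01 (or_introl erefl)|].
  - move=> u [r]; rewrite /= in_itv /= => /andP[r0 r1] <-.
    (* Balls are convex, so the segment stays in the image of the chart. *)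
    have blr : ball (leaf_coord y) e (l r).
      have := te; rewrite -!ball_normE /= /l opprD addNKr normrN normrZ ger0_norm// => te'.
      apply: le_lt_trans te'; rewrite -[leRHS]mul1r distrC.
      by apply: ler_wpM2r.
    have [dr _ er] := imgP (be _ blr).
    split; last by rewrite /= row_mxKr.
    by exists (param cy (slice_at sy (l r))).
  - apply: connected_continuous_connected; first exact: segment_connected.
    exact: continuous_subspaceT.
exists 1; first exact: in01 (or_intror erefl).
by rewrite l1 -[LHS]ez.
Qed.

(** Test functions for the Jacobi identity: their leaf differential at [x] can be prescribed. *)
Definition leaf_linear x (k : 'rV[R]_p) : M -> R :=
  fun z => pairing k (lsubmx (coord (chart_at x) z)).

Lemma leaf_linear_smooth x y k : dom (chart_at x) y -> exists O : set 'rV[R]_p,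
  [/\ open O, O (leaf_coord y) &
      smooth_on O (leaf_linear x k \o leaf_param y : _ -> R^o)].
Proof.
move=> dy; set c := chart_at x; have ac := chart_at_atlas x.
have ay := chart_at_atlas y; have dyy := chart_at_dom y; set cy := chart_at y in ay dyy.
set sy := rsubmx (coord cy y).
have ey : slice_at sy (leaf_coord y) = coord cy y by rewrite /slice_at hsubmxK.
have oI : open (img cy (dom c)) by apply: open_img; exact: dom_open.
pose O := [set t | img cy (dom c) (slice_at sy t)].
have oO : open O.
  rewrite openE => t Ot; apply: slice_at_near; exact: open_nbhs_nbhs.
exists O; split=> //; first by rewrite /O /= ey; exact: img_coord.
have ss : smooth_on O (slice_at sy).
  exact: smooth_on_row_mx oO (smooth_on_id oO) (smooth_on_cst sy oO).
have sc := smooth_on_compmx oO oI (fun t (Ot : O t) => Ot) ss (trans_smooth ay ac).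
have sl := smooth_on_mxsub id (@lshift p q) oO sc.
apply: smooth_on_eq (smooth_on_pairing oO (smooth_on_cst k oO) sl) => // t _.
by rewrite /= /leaf_linear lsubmxEsub.
Qed.

Lemma leaf_linear_dfun x k : leaf_dfun (leaf_linear x k) x = k.
Proof.
set c := chart_at x; have ac := chart_at_atlas x; have dx := chart_at_dom x.
set s0 := rsubmx (coord c x).
have ne : {near leaf_coord x, (fun t => pairing k t : R^o) =1
    (leaf_linear x k \o leaf_param x : _ -> R^o)}.
  have nI : \forall t \near leaf_coord x, img c setT (slice_at s0 t).
    by apply: slice_at_near; rewrite slice_at0; exact: near_img openT dx I.
  by apply: filterS nI => t /imgP[_ _ et]; rewrite /= /leaf_linear /leaf_param et row_mxKl.
have -> : leaf_dfun (leaf_linear x k) x = grad (pairing k) (leaf_coord x).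
  exact: esym (near_eq_grad ne).
apply/rowP => i; rewrite mxE.
have dI : differentiable (fun t : 'rV[R]_p => t) (leaf_coord x) by [].
have [_ D] := derive_pairing (delta_mx 0 i) (differentiable_cst k (leaf_coord x)) dI.
apply: etrans D _; rewrite derive_cst derive_id pairing0l add0r /pairing.
by rewrite trmx_delta -colE mxE.
Qed.

End LeafFunctions.

(** By [leaf_jacobi] the Jacobiator at a point depends only on the three leaf differentials there,
    and functions linear in the leaf coordinates realise all of them. *)
Lemma leaf_poisson_tensor (R : realType) (p q : nat) (M : foliated_manifold R p q)
    (L : M -> {vspace 'rV[R]_(p + q) * 'rV[R]_(p + q)}) (sigma Pi : M -> 'M[R]_(p + q)) :
  almost_dirac L -> coupling L -> geometric_data L sigma Pi ->
  leaf_tangent_poisson Pi <->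
  forall x U A, represents L (chart_at x) U A -> U x ->
    forall k l m, tens sigma Pi x A (Gpart k) (Gpart l) (Gpart m) = 0.
Proof.
move=> HL Hc Hg; split=> [jac x U A rep Ux k l m|T0 x0 W _ f g h lf lg lh br x Wx].
  pose W := leaf x `&` dom (chart_at x); have dx := chart_at_dom x.
  have Wx : W x by split.
  have lin k' : leaf_smooth W (leaf_linear x k').
    by move=> y [_ dy]; exact: leaf_linear_smooth.
  have J := jac x W (leaf_open_chart x (chart_at_atlas x)) _ _ _ (lin k) (lin l) (lin m) x Wx.
  have sm k' : exists O, [/\ open O, O (leaf_coord x) &
      smooth_on O (leaf_linear x k' \o leaf_param x : _ -> R^o)].
    exact: leaf_linear_smooth.
  have [B [oB Bx [s1 s2 s3]]] := smooth_on_common (sm k) (sm l) (sm m).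
  have := etrans (esym (leaf_jacobi Hg rep Ux oB Bx s1 s2 s3)) J.
  by rewrite !leaf_linear_dfun.
have [U [A [Ux rep]]] := exists_represents HL Hc Hg (chart_at_atlas x) (chart_at_dom x).
have [B [oB Bx [s1 s2 s3]]] := smooth_on_common (lf x Wx) (lg x Wx) (lh x Wx).
apply: etrans (leaf_jacobi Hg rep Ux oB Bx s1 s2 s3) _.
exact: T0 rep Ux _ _ _.
Qed.

(** * Integrability of L in terms of its geometric data *)

Theorem proposition2p4 (R : realType) (p q : nat)
    (M : foliated_manifold R p q)
    (L : M -> {vspace 'rV[R]_(p + q) * 'rV[R]_(p + q)})
    (sigma Pi : M -> 'M[R]_(p + q)) :
  almost_dirac L -> coupling L -> geometric_data L sigma Pi ->
  (dirac L <->
    [/\ leaf_tangent_poisson Pi,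
        forall x u v w, d'form2 L sigma x u v w = 0,
        forall U X1 X2, open U -> sectionH_pr L U X1 -> sectionH_pr L U X2 ->
          forall x, U x ->
          prF L x (bracket X1 X2 x) =
          sharp Pi x (d''fun L (fun y => bil (sigma y) (X1 y) (X2 y)) x) &
        forall U X, open U -> sectionH_pr L U X ->
          forall x, U x -> forall a b, lie_bivector X Pi x a b = 0])
  /\
  ((forall x u v w, d'form2 L sigma x u v w = 0) <->
   (forall U X1 X2 X3, open U ->
      sectionH L U X1 -> sectionH L U X2 -> sectionH L U X3 ->
      forall x, U x -> dform2 sigma x (X1 x) (X2 x) (X3 x) = 0)).
Proof.
move=> HL Hc Hg.
have ex x := exists_represents HL Hc Hg (chart_at_atlas x) (chart_at_dom x).
(* The two forms of (ii): values of sections of H are fixed by [prH], and conversely every vector of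
   H at [x] is the value of a section with constant [s]. *)
split; last first.
  split=> [d0 U X1 X2 X3 oU [_ H1] [_ H2] [_ H3] x Ux|d0 x u v w].
  - have [V [A [Vx rep]]] := ex x.
    have prX X : X x \in normalH L x -> prH L x (X x) = X x.
      by move=> XH; rewrite (prHE Hc rep Vx) -((normalH_center rep Vx _).1 XH).
    by rewrite -(prX X1) ?H1// -(prX X2) ?H2// -(prX X3) ?H3//; exact: d0.
  - have [V [A [Vx rep]]] := ex x; have [oV _ _ _] := rep.
    have pf s := projectable_frame Hg rep Vx s.
    have prX s z : s = rsubmx z ->
        (fst \o frame_section sigma Pi (chart_at x) A (Epart s)) x = prH L x z.
      move=> ->; have [HX e] := pf (rsubmx z).
      by rewrite (prHE Hc rep Vx) (XxE rep Vx Vx HX) e.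
    have := d0 V _ _ _ oV (pf (rsubmx u)).1.1 (pf (rsubmx v)).1.1 (pf (rsubmx w)).1.1 x Vx.
    by rewrite (prX _ u erefl) (prX _ v erefl) (prX _ w erefl).
apply: (iff_trans (dirac_tensor Hg HL Hc)); split=> [T0|[c1 c2 c3 c4] x U A rep Ux].
  split.
  - apply/(leaf_poisson_tensor HL Hc Hg) => x U A rep Ux k l m; exact: T0 rep Ux _ _ _.
  - move=> x u v w; have [U [A [Ux rep]]] := ex x.
    by rewrite (d'form2_tens Hc Hg rep Ux); exact: T0 rep Ux _ _ _.
  - move=> V X1 X2 oV H1 H2 x Vx; have [U [A [Ux rep]]] := ex x.
    by apply/(cond3_tens Hc Hg rep Ux oV Vx H1 H2) => l; exact: T0 rep Ux _ _ _.
  - move=> V X oV HX x Vx a b; have [U [A [Ux rep]]] := ex x.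
    by rewrite (lie_bivector_tens Hg rep Ux oV Vx HX); exact: T0 rep Ux _ _ _.
have [oU _ _ _] := rep.
apply: (tens_parts Hg rep Ux) => [s t r|s t l|s l m|k l m].
(* Any vectors with the prescribed transverse parts serve, since [prH] at [x] depends on these
   alone. *)
- have := c2 x (row_mx 0 s) (row_mx 0 t) (row_mx 0 r).
  by rewrite (d'form2_tens Hc Hg rep Ux) !row_mxKr.
- have [Hs es] := projectable_frame Hg rep Ux s.
  have [Ht et] := projectable_frame Hg rep Ux t.
  have := (cond3_tens Hc Hg rep Ux oU Ux Hs Ht).1 (c3 U _ _ oU Hs Ht x Ux) l.
  by rewrite es et.
- have [Hs es] := projectable_frame Hg rep Ux s.
  (* The covectors are chosen by their leaf parts, the only ones that enter. *)
  have := c4 U _ oU Hs x Ux (row_mx l 0) (row_mx m 0).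
  by rewrite (lie_bivector_tens Hg rep Ux oU Ux Hs) es !row_mxKl.
- exact: (leaf_poisson_tensor HL Hc Hg).1 c1 x U A rep Ux k l m.
Qed.
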